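(* Let $L$ be a Lorentzian lattice of rank $n+1$ with root system $\Pi$, let $C$ be a chamber of $W(L)$, let $k$ be a corner of $C$, let $e$ be an edge of $C$ incident to $k$, and let $k'$ be the other endpoint of $e$. Let $u_1,\dots,u_{n-1}$, $\Delta$, $U$, $P$, $\pi_U$, $\pi_P$, $S$ (with its total order), $r_0$ and $L_N$ be as defined in the context. The following procedure finds the corner $k'$ and the simple roots of $C$ that are orthogonal to $k'$. Let $\mathcal{N}$ be a list of positive numbers that contains the norms of all roots of $L$. For each $N\in\mathcal{N}$ let $\mathcal{D}_N$ be the set of all norm $N$ spherical extensions $\Delta\to\Delta'$ of normed Dynkin diagrams. For each $N\in\mathcal{N}$ and each extension $\Delta\to\Delta'$ in $\mathcal{D}_N$ define the following, if the stated conditions are met: (1) $u_{N,\Delta'}$ is the element of $U$ whose inner products with $u_1,\dots,u_{n-1}$ are those of the extending node with the nodes of $\Delta$, as specified by the extension $\Delta\to\Delta'$. (2) $R_{N,\Delta'}=N-u_{N,\Delta'}^2$. (3) If some $v\in L_N$ satisfies $\pi_U(v)=u_{N,\Delta'}$, then $C_{N,\Delta'}$ is the coset $\pi_P(v)+(L_N\cap P)$ (which is independent of $v$). (4) If $C_{N,\Delta'}$ is defined, and some vector of $S\cap C_{N,\Delta'}$ has norm $R_{N,\Delta'}$ and comes after the ray $\mathbb{R}_{>0}r_0\subseteq S$, then $r_{N,\Delta'}$ is the first such vector. (5) If $r_{N,\Delta'}$ is defined, then the candidate $\alpha_{N,\Delta'}$ is $u_{N,\Delta'}+r_{N,\Delta'}$.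 Then: (a) If no candidates exist, then $k'$ is the ideal point at the end of the ray emanating from $k$ along $e$, and the cuspidal batch 0 procedure (described in the context), applied to $k'$, $U$ and $u_1,\dots,u_{n-1}$, extends $\{u_1,\dots,u_{n-1}\}$ to a set of simple roots for $\Pi\cap k'^\perp$, namely the one corresponding to the chamber $C$. (b) If candidates exist, then there is a unique candidate $\alpha=\alpha_{N,\Delta'}$ such that: (i) among all candidates, it minimizes $-k\cdot r_{N,\Delta'}/\sqrt{R_{N,\Delta'}}$; (ii) among all candidates satisfying (i), it minimizes $-k\cdot\alpha_{N,\Delta'}/\sqrt{N}=-k\cdot r_{N,\Delta'}/\sqrt{N}$; (iii) among all candidates satisfying (i) and (ii), it has smallest norm. Moreover $\{u_1,\dots,u_{n-1},\alpha\}$ is the set of simple roots for $\Pi\cap k'^\perp$ corresponding to the chamber $C$. In particular, $k'$ corresponds to the line $\alpha^\perp\cap P$ in $L\otimes\mathbb{R}$.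
   Context: A lattice is a finitely generated free abelian group $L$ with a $\mathbb{Q}$-valued symmetric bilinear form $v\cdot w$; $v^2=v\cdot v$ is the norm. $L$ is Lorentzian if it has signature $(n,1)$, $n\geq 1$. Vectors of positive (negative) norm are spacelike (timelike), and nonzero norm $0$ vectors are lightlike. Hyperbolic space $H^n$ and its boundary $\partial H^n$ are the images in $P(L\otimes\mathbb{R})$ of the timelike and lightlike vectors, and $\overline{H^n}=H^n\cup\partial H^n$. One light cone is distinguished as the future one; points of $\overline{H^n}$ are represented by future-directed vectors, i.e. vectors in the convex hull of that light cone, and the same symbol is used for a point and a vector representing it. A root of $L$ is a primitive $\alpha\in L$ with $\alpha^2>0$ and $\alpha\cdot L\subseteq\frac{\alpha^2}{2}\mathbb{Z}$. $\Pi$ is the set of roots, and $W(L)$ is the group generated by the reflections $x\mapsto x-2\frac{x\cdot\alpha}{\alpha^2}\alpha$ in roots. A chamber is the closure in $\overline{H^n}$ of a component of the complement in $H^n$ of all mirrors (fixed-point sets in $H^n$ of these reflections). A simple root of $C$ is a root orthogonal to a facet of $C$ and having negative inner product with vectors in the interior of $C$. An ordinary corner of $C$ is a point $k\in C\cap H^n$ with $k^\perp\cap\Pi$ of rank $n$; an ideal corner is a point $k\in C\cap\partial H^n$ such that every horosphere centered at $k$ meets $C$ in a compact set. A corner is an ordinary or ideal corner. Edges ($1$-dimensional faces) of $C$ contain their ideal endpoints. The set of simple roots for $\Pi\cap k'^\perp$ corresponding to $C$ means the set of simple roots of the chamber of $W(\Pi\cap k'^\perp)$ (the group generated by reflections in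 the roots orthogonal to $k'$) that contains $C$; these are the simple roots of $C$ orthogonal to $k'$. Normed Dynkin diagrams. A Dynkin diagram is a graph in which each pair of nodes is joined by at most one bond, of type single, double, triple or heavy; double and triple bonds are oriented and heavy bonds may be oriented or not. A norm on it assigns a positive number (norm) to each node such that nodes joined by a single bond or an unoriented heavy bond have equal norms, and if two nodes are joined by a double, triple, resp. oriented heavy bond, then the norm of the node at the tail of the arrow is $2$, $3$, resp. $4$ times that of the node at the tip. A normed Dynkin diagram determines an inner product on the free abelian group on its nodes: each node has the assigned norm; unjoined nodes are orthogonal; nodes joined by a single bond with common norm $a$ have inner product $-a/2$; nodes joined by an unoriented heavy bond with common norm $a$ have inner product $-a$; nodes joined by a double, triple or oriented heavy bond have inner product minus half the larger of their norms. The normed Dynkin diagram of a set of roots with pairwise nonpositive inner products, any two having positive definite or semidefinite span, is the one with the roots as nodes, reproducing their norms and inner products. A normed diagram is spherical if its inner product is positive definite, and cuspidal if its inner product is positive semidefinite but not definite. A norm $N$ spherical (resp. cuspidal) extension of $\Delta$ is an inclusion of $\Delta$ into a spherical (resp. cuspidal) normed Dynkin diagram $\Delta'$ with exactly one more node (the extending node), the extending node having norm $N$. Notation. $u_1,\dots,u_{n-1}$ are the simple roots of $C$ orthogonal to $e$; $\Delta$ is their normed Dynkin diagram; $U$ is their real span; $P$ is the plane in $L\otimes\mathbb{R}$ orthogonal to $U$; $\pi_U,\pi_P$ are the orthogonal projections to $U$ and $P$. $\frac12P$ is the open half-plane of $P$ bounded by $\mathbb{R}k$ corresponding to $e$, i.e.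 containing the (future-directed) vectors representing the interior of $e$. $S$ is the sector of spacelike and lightlike vectors of $P$ on the side $\frac12P$, including both of its bounding lightlike rays (when $k$ is lightlike, one of these is $\mathbb{R}_{>0}(-k)$). $r_0$ is the primitive lattice vector in $S$ orthogonal to $k$ (so $\mathbb{R}_{>0}r_0$ is the ray of $S$ orthogonal to $k$; it is $\mathbb{R}_{>0}(-k)$ if $k$ is lightlike). Orient $P$ by any basis whose first member lies in $\frac12P$ and whose second member is $k$. $S$ is totally ordered: for nonproportional $v,w\in S$, $v$ precedes $w$ if $(v,w)$ is an oriented basis of $P$; for proportional ones, the one closer to $0$ comes first. For $N>0$, $L_N=L\cap\frac N2L^*=\{v\in L: v\cdot L\subseteq\frac N2\mathbb{Z}\}$. The cuspidal batch 0 procedure (used in case (a)). Here $k'$ is ideal and is represented by the future-directed primitive lightlike lattice vector, also written $k'$. $U$ is a complement to $\mathbb{R}k'$ in $k'^\perp\subset L\otimes\mathbb{R}$, and $u_1,\dots,u_{n-1}$ are a system of simple roots for $\Pi\cap U$ that span $U$. The procedure finds the remaining simple roots of the unique chamber of $W(\Pi\cap k'^\perp)$ that contains $k'$ and whose simple roots include $u_1,\dots,u_{n-1}$ (this is the chamber containing $C$), as follows. Choose any future-directed vector $h$ in the plane $U^\perp=P$ that is not in $\mathbb{R}k'$. Take a list $\mathcal{N}$ of positive numbers containing the norms of all roots of $L$. For each $N\in\mathcal{N}$ and each norm $N$ cuspidal extension $\Delta\to\Delta'$, consider the element $u_{N,\Delta'}$ of $U$ whose inner products with $u_1,\dots,u_{n-1}$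 are as specified by $\Delta'$; if $L_N$ contains a vector of the form $u_{N,\Delta'}+ck'$ with $c\in\mathbb{Q}$, let $v_{N,\Delta'}$ be the vector of this form in $L_N$ with $c$ as small as possible subject to being positive. Call these vectors $v_{N,\Delta'}$ the cuspidal candidates. Order them first by their priority $-h\cdot v_{N,\Delta'}/\sqrt N$ and second by norm. Inductively define a cuspidal candidate to be approved if it has nonpositive inner products with all of its predecessors that were approved. The output is the set consisting of $u_1,\dots,u_{n-1}$ and the approved cuspidal candidates. *)

(* Defs.v *)
From mathcomp Require Import all_boot all_order all_algebra.
From mathcomp Require Import all_classical all_reals all_analysis.
Import Order.TTheory GRing.Theory Num.Theory.
Import numFieldNormedType.Exports.

Set Implicit Arguments.
Unset Strict Implicit.
Unset Printing Implicit Defensive.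

Local Open Scope classical_set_scope.
Local Open Scope ring_scope.

(* Normed Dynkin diagrams. The constructors describe the bond from a node i to
   a node j; the boolean of an oriented bond is true iff its arrow has its tail
   at i and its tip at j.                                                      *)

Inductive bond :=
  | NoBond
  | Single
  | Double of bool
  | Triple of bool
  | Heavy
  | HeavyArrow of bool.

Definition bond_rev (b : bond) : bond :=
  match b with
  | Double o => Double (~~ o)
  | Triple o => Triple (~~ o)
  | HeavyArrow o => HeavyArrow (~~ o)
  | _ => b
  end.

Record dynkin (T : finType) := Dynkin {
  bond_of :> T -> T -> bond;
  bond_of_diag : forall i, bond_of i i = NoBond;
  bond_of_sym : forall i j, bond_of j i = bond_rev (bond_of i j) }.

(* The constraint a bond from i to j puts on the norms a of i and b of j. *)
Definition bond_norms (R : realType) (bd : bond) (a b : R) : Prop :=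
  match bd with
  | NoBond => True
  | Single | Heavy => a = b
  | Double o => if o then a = 2 * b else b = 2 * a
  | Triple o => if o then a = 3 * b else b = 3 * a
  | HeavyArrow o => if o then a = 4 * b else b = 4 * a
  end.

Record normed_dynkin (R : realType) (T : finType) := NormedDynkin {
  diagram :> dynkin T;
  node_norm : T -> R;
  node_norm_gt0 : forall i, 0 < node_norm i;
  node_norm_bond :
    forall i j, bond_norms (diagram i j) (node_norm i) (node_norm j) }.

Definition dynkin_ip (R : realType) (T : finType) (D : normed_dynkin R T)
    (i j : T) : R :=
  if i == j then node_norm D i else
  match D i j with
  | NoBond => 0
  | Single => - (node_norm D i / 2)
  | Heavy => - node_norm D i
  | Double _ | Triple _ | HeavyArrow _ =>
      - (Num.max (node_norm D i) (node_norm D j) / 2)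
  end.

Definition dynkin_sq (R : realType) (T : finType) (D : normed_dynkin R T)
    (x : {ffun T -> R}) : R :=
  \sum_(i : T) \sum_(j : T) x i * x j * dynkin_ip D i j.

Definition spherical (R : realType) (T : finType) (D : normed_dynkin R T) :=
  forall x : {ffun T -> R}, x != 0 -> 0 < dynkin_sq D x.

Definition cuspidal (R : realType) (T : finType) (D : normed_dynkin R T) :=
  (forall x : {ffun T -> R}, 0 <= dynkin_sq D x) /\
  (exists2 x : {ffun T -> R}, x != 0 & dynkin_sq D x = 0).

(* D' has the nodes Some i of D and the extending node None. *)
Definition extension (R : realType) (T : finType) (N : R)
    (D : normed_dynkin R T) (D' : normed_dynkin R (option T)) : Prop :=
  [/\ forall i j, D' (Some i) (Some j) = D i j,
      forall i, node_norm D' (Some i) = node_norm D i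
    & node_norm D' None = N].

Definition minimizers (R : realType) (T : Type) (A : set T) (f : T -> R) :
    set T :=
  [set c | A c /\ forall c', A c' -> f c <= f c'].

Section Lattice.
Context (R : realType) (n : nat) (G : 'M[rat]_n.+1).
Local Notation V := 'rV[R]_n.+1.

(* The lattice is Z^(n+1) with Gram matrix G; V is its tensor product with the
   reals, in which it is embedded as the vectors with integer entries.         *)
Definition gramR : 'M[R]_n.+1 := map_mx ratr G.

Definition ip (x y : V) : R := (x *m gramR *m y^T) 0 0.

Definition lorentzian : Prop :=
  G^T = G /\
  exists2 B : 'M[R]_n.+1, B \in unitmx &
    B *m gramR *m B^T =
      diag_mx (\row_(i < n.+1) (if i == ord_max then -1 else 1)).

Definition lat : set V := [set v | v \is a mxOver Num.int].

Definition primitive (v : V) : Prop :=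
  lat v /\ forall (w : V) (m : int), lat w -> v = w *~ m -> m = 1 \/ m = -1.

Definition lat_N (N : R) : set V :=
  [set v | lat v /\ forall w, lat w -> exists m : int, ip v w = m%:~R * (N / 2)].

Definition lattice_roots : set V :=
  [set a | [/\ primitive a, 0 < ip a a &
    forall w, lat w -> exists m : int, ip a w = m%:~R * (ip a a / 2)]].

Definition reflection (a x : V) : V := x - (2 * (ip x a / ip a a)) *: a.

(* Subsets of hyperbolic space and of its closure are encoded as the cones of
   all future-directed vectors representing their points. The future light
   cone is singled out by a timelike vector t: a nonzero x with ip x x <= 0 is
   future-directed iff ip x t < 0. As the projection of Hbar to projective
   space is open with connected fibres, closures in Hbar, interiors, and
   components of subsets of Hyp may be computed on cones.                      *)
Definition Hyp (t : V) : set V := [set x | ip x x < 0 /\ ip x t < 0].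

Definition Hbar (t : V) : set V := [set x | ip x x <= 0 /\ ip x t < 0].

Definition mirror (t a : V) : set V := [set x | Hyp t x /\ reflection a x = x].

(* Chambers of the group generated by the reflections in the roots in Phi. *)
Definition mirror_complement (t : V) (Phi : set V) : set V :=
  Hyp t `\` \bigcup_(a in Phi) mirror t a.

Definition chamber (t : V) (Phi : set V) (C : set V) : Prop :=
  exists2 x, mirror_complement t Phi x &
    C = closure (connected_component (mirror_complement t Phi) x) `&` Hbar t.

Definition span_rank (A : set V) (d : nat) : Prop :=
  exists B : 'M[R]_(d, n.+1),
    [/\ row_free B, forall i, A (row i B) & forall x, A x -> (x <= B)%MS].

(* Faces in the sense of convex sets, for cones: F is a convex subset such that
   a segment of C whose interior meets F lies in F.                            *)
Definition face (C F : set V) : Prop :=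
  [/\ F `<=` C,
      forall c x, 0 < c -> F x -> F (c *: x),
      forall x y, F x -> F y -> F (x + y)
    & forall x y, C x -> C y -> F (x + y) -> F x /\ F y].

(* A d-dimensional subset of the closed hyperbolic space spans d + 1
   dimensions of V.                                                            *)
Definition facet (C F : set V) : Prop := face C F /\ span_rank F n.

Definition edge (C e : set V) : Prop := face C e /\ span_rank e 2.

Definition segment (x y : V) : set V :=
  [set z | exists a b, [/\ 0 <= a, 0 <= b, 0 < a + b & z = a *: x + b *: y]].

Definition simple_root (Phi C : set V) : set V :=
  [set a | [/\ Phi a,
    exists2 F, facet C F & forall x, F x -> ip a x = 0
    & forall x, (interior C) x -> ip a x < 0]].

Definition roots_perp (k : V) : set V := [set a | lattice_roots a /\ ip a k = 0].

(* The simple roots, corresponding to C, of the roots orthogonal to k. *)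
Definition simple_root_at (t : V) (C : set V) (k : V) : set V :=
  [set a | exists D, [/\ chamber t (roots_perp k) D, C `<=` D
                       & simple_root (roots_perp k) D a]].

Definition ordinary_corner (C : set V) (k : V) : Prop :=
  [/\ C k, ip k k < 0 & span_rank (roots_perp k) n].

(* Here hyperbolic space is realized as the hyperboloid of norm -1. *)
Definition horosphere (t k : V) (c : R) : set V :=
  [set x | [/\ Hyp t x, ip x x = -1 & ip x k = - c]].

Definition ideal_corner (t : V) (C : set V) (k : V) : Prop :=
  [/\ C k, ip k k = 0 & forall c, 0 < c -> compact (C `&` horosphere t k c)].

Definition corner (t : V) (C : set V) (k : V) : Prop :=
  ordinary_corner C k \/ ideal_corner t C k.

Section Edge.
(* The rows of u are the simple roots u_1, ..., u_(n-1) orthogonal to the edge;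
   their row space is the subspace U.                                          *)
Context (u : 'M[R]_(n.-1, n.+1)).

Definition orthU : 'M[R]_n.+1 := kermx (gramR *m u^T).

Definition planeP : set V := [set x | (x <= orthU)%MS].

Definition projU (x : V) : V := x *m proj_mx <<u>>%MS orthU.

Definition projP (x : V) : V := x *m proj_mx orthU <<u>>%MS.

Definition diagram_of (D : normed_dynkin R 'I_n.-1) : Prop :=
  (forall i, node_norm D i = ip (row i u) (row i u)) /\
  (forall i j, dynkin_ip D i j = ip (row i u) (row j u)).

(* x is the element of U specified by the extension D'. *)
Definition specified (D' : normed_dynkin R (option 'I_n.-1)) (x : V) : Prop :=
  (x <= u)%MS /\ forall i, ip x (row i u) = dynkin_ip D' None (Some i).

Definition root_norms (Ns : seq R) : Prop :=
  (forall N, N \in Ns -> 0 < N) /\ (forall a, lattice_roots a -> ip a a \in Ns).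

(* In what follows k and k' are the endpoints of the edge. *)

(* The open half-plane of P bounded by the line of k containing the interior
   of the edge, hence also k'.                                                 *)
Definition halfP (k k' : V) : set V :=
  [set x | planeP x /\ exists a b, 0 < b /\ x = a *: k + b *: k'].

(* The second alternative only occurs when k is lightlike: it is then the
   bounding ray of the sector that lies on the boundary of the half-plane.     *)
Definition sector (k k' : V) : set V :=
  [set x | [/\ planeP x, 0 <= ip x x
             & halfP k k' x \/ exists c, 0 < c /\ x = c *: - k]].

(* P is oriented by its basis (k', k). *)
Definition oriented (k k' v w : V) : Prop :=
  exists a b c d, [/\ v = a *: k' + b *: k, w = c *: k' + d *: k
                    & 0 < a * d - b * c].

Definition sector_lt (k k' v w : V) : Prop :=
  oriented k k' v w \/ exists c, 1 < c /\ w = c *: v.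

Definition coset_at (N : R) (v : V) : set V :=
  [set projP v + z | z in lat_N N `&` planeP].

(* A choice of N and of an extension, with the corresponding vectors
   u_(N, D') and r_(N, D').                                                    *)
Record candidate_data := CandidateData {
  cand_N : R;
  cand_D : normed_dynkin R (option 'I_n.-1);
  cand_u : V;
  cand_r : V }.

Definition cand_R (c : candidate_data) : R :=
  cand_N c - ip (cand_u c) (cand_u c).

Definition cand_alpha (c : candidate_data) : V := cand_u c + cand_r c.

Definition admissible (k k' r0 : V) (Q : set V) (rho : R) : set V :=
  [set r | [/\ sector k k' r, Q r, ip r r = rho
             & forall c, 0 < c -> sector_lt k k' (c *: r0) r]].

Definition candidate (D : normed_dynkin R 'I_n.-1) (k k' r0 : V) (Ns : seq R) :
    set candidate_data :=
  [set c | [/\ cand_N c \in Ns,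
    extension (cand_N c) D (cand_D c) /\ spherical (cand_D c),
    specified (cand_D c) (cand_u c)
  & exists v, [/\ lat_N (cand_N c) v, projU v = cand_u c,
      admissible k k' r0 (coset_at (cand_N c) v) (cand_R c) (cand_r c)
    & forall r, admissible k k' r0 (coset_at (cand_N c) v) (cand_R c) r ->
        r = cand_r c \/ sector_lt k k' (cand_r c) r]]].

Definition best_candidate (D : normed_dynkin R 'I_n.-1) (k k' r0 : V)
    (Ns : seq R) : set candidate_data :=
  minimizers
    (minimizers
      (minimizers (candidate D k k' r0 Ns)
        (fun c => - ip k (cand_r c) / Num.sqrt (cand_R c)))
      (fun c => - ip k (cand_alpha c) / Num.sqrt (cand_N c)))
    (fun c => ip (cand_alpha c) (cand_alpha c)).

(* The cuspidal batch 0 procedure, for the primitive lightlike vector kappa.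
   A candidate is recorded as a pair (N, v).                                   *)
Definition cuspidal_candidate (D : normed_dynkin R 'I_n.-1) (kappa : V)
    (Ns : seq R) : set (R * V) :=
  [set p | p.1 \in Ns /\
    exists D' x (c : rat),
      [/\ extension p.1 D D' /\ cuspidal D', specified D' x,
          p.2 = x + ratr c *: kappa /\ lat_N p.1 p.2, 0 < c
        & forall c' : rat, 0 < c' -> lat_N p.1 (x + ratr c' *: kappa) ->
            c <= c']].

Definition priority (h : V) (p : R * V) : R := - ip h p.2 / Num.sqrt p.1.

Definition precedes (h : V) (p q : R * V) : Prop :=
  priority h p < priority h q \/
  (priority h p = priority h q /\ ip p.2 p.2 < ip q.2 q.2).

Inductive approved (A : set (R * V)) (h : V) : R * V -> Prop :=
  | Approved q : A q ->
      (forall p, A p -> precedes h p q -> rejected A h p \/ ip p.2 q.2 <= 0) ->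
      approved A h q
with rejected (A : set (R * V)) (h : V) : R * V -> Prop :=
  | Rejected p q : A q ->
      approved A h p -> precedes h p q -> 0 < ip p.2 q.2 -> rejected A h q.

Definition batch0 (D : normed_dynkin R 'I_n.-1) (kappa : V) (Ns : seq R)
    (h : V) : set V :=
  [set a | (exists i, a = row i u) \/
           exists N, approved (cuspidal_candidate D kappa Ns) h (N, a)].

End Edge.

End Lattice.

(* Main.v *)
Require Import Defs.
From mathcomp Require Import all_boot all_order all_algebra.
From mathcomp Require Import all_classical all_reals all_analysis.
From mathcomp Require Import zify ring lra.
Import Order.TTheory GRing.Theory Num.Theory.
Import numFieldNormedType.Exports.

Set Implicit Arguments.
Unset Strict Implicit.
Unset Printing Implicit Defensive.

Local Open Scope classical_set_scope.
Local Open Scope ring_scope.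

(** The chamber is the closed cell of the future vectors on which no root has
    the sign opposite to that at an interior point x0 [chamberE]. The roots
    orthogonal to a point k' of it lie in a semidefinite space, so the usual
    theory applies to them: those that are negative at x0 are nonnegative
    combinations of pairwise obtuse ones [pos_root_cone], and these are the
    simple roots defined by facets [simple_root_at_base]. The u_i are among
    them [u_base], are independent by obtuseness, and so span the complement U
    of the plane P spanned by k and k'.

    A candidate is a multiple of a root, since a vector of norm N in L_N is an
    integer multiple of one [lat_N_root]. It is negative at k, hence nonpositive
    on the chamber, so its mirror cannot meet the edge before k'. As the
    extended diagram is spherical, the mirror meets P in a timelike line, and
    this line would separate k from k' if k' were ideal [candidate_timelike].

    Suppose that k' is timelike. Some root orthogonal to k' lies outside U,
    since the edge could be prolonged otherwise [root_outside], and by counting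
    dimensions there is exactly one simple root alpha at k' besides the u_i
    [base_unique]. It is a candidate [alpha_candidate]. The quantity minimized
    first measures how far from k the mirror meets the edge, so it selects the
    candidates orthogonal to k' [ral_closest]. Such a candidate v is a
    combination of the u_i and of alpha with nonnegative coefficients, m being
    that of alpha. As v has nonpositive products with the u_i, its norm is at
    most m times its product with alpha, and Cauchy-Schwarz turns this into
    |v| <= m |alpha|. This is the inequality of the second criterion, with
    equality only for multiples of alpha [closer_simple_root,
    alpha_priority], among which the norm selects alpha itself.

    Suppose that k' is lightlike. The plane P is rational. If it were
    anisotropic, k would be ordinary, and a solution of Pell's equation would
    give an isometry of P that moves a mirror through k to one that separates k
    from k'; hence k' is rational [null_end_lattice_timelike]. For the primitive
    vector kap on its ray and suitable m, the vectors m kap - u_i are multiples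
    of roots; they bound the chamber across the edge, so k' is an ideal corner
    [ideal_corner_end]. In the cuspidal procedure, the argument of the second
    criterion shows that a candidate that is not simple is preceded by a simple
    root with which it has positive product [nonsimple_preceded]; induction
    along the precedence then shows that the approved candidates are the simple
    roots other than the u_i [simple_approved, approved_base]. *)

(** * The Lorentzian form *)

Section Form.
Context (R : realType) (n : nat) (G : 'M[rat]_n.+1).
Local Notation V := 'rV[R]_n.+1.
Local Notation B := (ip G).

Lemma ipDl (x y z : V) : B (x + y) z = B x z + B y z.
Proof. by rewrite /ip !mulmxDl mxE. Qed.

Lemma ipDr (x y z : V) : B z (x + y) = B z x + B z y.
Proof. by rewrite /ip linearD mulmxDr mxE. Qed.

Lemma ipZl c (x y : V) : B (c *: x) y = c * B x y.
Proof. by rewrite /ip -!scalemxAl mxE. Qed.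

Lemma ipZr c (x y : V) : B x (c *: y) = c * B x y.
Proof. by rewrite /ip linearZ -scalemxAr mxE. Qed.

Lemma ipNl (x y : V) : B (- x) y = - B x y.
Proof. by rewrite -scaleN1r ipZl mulN1r. Qed.

Lemma ipNr (x y : V) : B x (- y) = - B x y.
Proof. by rewrite -scaleN1r ipZr mulN1r. Qed.

Lemma ip0l (x : V) : B 0 x = 0.
Proof. by rewrite -[0 : V](scale0r (0 : V)) ipZl mul0r. Qed.

Lemma ip0r (x : V) : B x 0 = 0.
Proof. by rewrite -[0 : V](scale0r (0 : V)) ipZr mul0r. Qed.

Definition ipE := (ipDl, ipDr, ipNl, ipNr, ipZl, ipZr, ip0l, ip0r).

Lemma ip_suml (I : Type) (s : seq I) (P : pred I) (f : I -> V) y :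
  B (\sum_(i <- s | P i) f i) y = \sum_(i <- s | P i) B (f i) y.
Proof.
by elim/big_rec2: _ => [|i a b _ <-]; rewrite ?ip0l ?ipDl.
Qed.

Lemma ip_mull m (c : 'rV[R]_m) (M : 'M[R]_(m, n.+1)) y :
  B (c *m M) y = \sum_i c 0 i * B (row i M) y.
Proof.
rewrite mulmx_sum_row ip_suml.
by apply: eq_bigr => i _; rewrite ipZl.
Qed.

Hypothesis hG : lorentzian R G.

Lemma ipC (x y : V) : B x y = B y x.
Proof.
have [Gs _] := hG.
have gT : (gramR R G)^T = gramR R G by rewrite /gramR map_trmx Gs.
by rewrite /ip -[in RHS](trmxK (y *m _ *m _)) [RHS]mxE !trmx_mul trmxK mulmxA gT.
Qed.

Lemma ip_sumr (I : Type) (s : seq I) (P : pred I) (f : I -> V) y :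
  B y (\sum_(i <- s | P i) f i) = \sum_(i <- s | P i) B y (f i).
Proof. by rewrite ipC ip_suml; apply: eq_bigr => i _; rewrite ipC. Qed.

(** Inertia by hand: a plane on which the form is negative semidefinite would
    meet the positive definite hyperplane where the last diagonalizing
    coordinate vanishes. *)
Lemma orth_timelike_gt0 (y v : V) :
  B y y < 0 -> B v y = 0 -> v != 0 -> 0 < B v v.
Proof.
have [_ [M Mu MJ]] := hG.
pose J : 'M[R]_n.+1 :=
  diag_mx (\row_(i < n.+1) (if i == ord_max then -1 else 1)).
have ipJ (x : V) :
    B x x = \sum_i (x *m invmx M) 0 i ^+ 2 * (if i == ord_max then -1 else 1).
  have {1 2}-> : x = x *m invmx M *m M by rewrite mulmxKV.
  move: (x *m invmx M) => X; rewrite /ip trmx_mul !mulmxA.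
  have -> : X *m M *m gramR R G *m M^T = X *m J by rewrite /J -MJ !mulmxA.
  rewrite mxE; apply: eq_bigr => i _; rewrite /J mul_mx_diag !mxE.
  by rewrite expr2 mulrAC.
pose l (x : V) := (x *m invmx M) 0 ord_max.
have l0 (x : V) : l x = 0 -> 0 <= B x x /\ (B x x = 0 -> x = 0).
  move=> lx; have E : B x x = \sum_i (x *m invmx M) 0 i ^+ 2.
    rewrite ipJ; apply: eq_bigr => i _; case: eqP => [->|_]; last by rewrite mulr1.
    by rewrite -/(l x) lx expr0n mul0r.
  have p i : true -> 0 <= (x *m invmx M) 0 i ^+ 2 by move=> _; exact: sqr_ge0.
  split=> [|/eqP]; first by rewrite E; apply: sumr_ge0.
  rewrite E psumr_eq0 // => /allP z.
  have : x *m invmx M = 0.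
    apply/rowP => i; rewrite [RHS]mxE; apply/eqP.
    by have := z i (mem_index_enum _); rewrite sqrf_eq0.
  by move/(congr1 (mulmx^~ M)); rewrite mulmxKV // mul0mx.
have lD (a b : R) (x z : V) : l (a *: x + b *: z) = a * l x + b * l z.
  by rewrite /l mulmxDl -!scalemxAl !mxE.
move=> yy vy v0.
have ly : l y != 0 by apply: contraTneq yy => /l0[+ _]; rewrite -leNgt.
have ly2 : 0 < l y ^+ 2 by rewrite exprn_even_gt0.
pose z := l y *: v + - l v *: y.
have lz : l z = 0 by rewrite lD; ring.
have zz : B z z = l y ^+ 2 * B v v + l v ^+ 2 * B y y.
  by rewrite /z !ipE (ipC y v) vy; ring.
have [z0 z1] := l0 _ lz.
have lv2 := sqr_ge0 (l v).
have vv : 0 <= B v v.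
  by rewrite -(pmulr_rge0 _ ly2); nra.
rewrite lt_neqAle vv andbT; apply: contra_neq v0 => vv0.
have lv : l v = 0.
  apply/eqP; rewrite -sqrf_eq0 eq_le lv2 andbT.
  move: z0; rewrite zz -vv0 mulr0 add0r => h; nra.
have : z = 0 by apply: z1; rewrite zz -vv0 lv; ring.
rewrite /z lv oppr0 scale0r addr0 => /eqP; rewrite scaler_eq0 (negPf ly) /=.
by move/eqP.
Qed.

Lemma orth_timelike_ge0 (y v : V) : B y y < 0 -> B v y = 0 -> 0 <= B v v.
Proof.
move=> yy vy; have [->|v0] := eqVneq v 0; first by rewrite ip0l.
exact: ltW (orth_timelike_gt0 yy vy v0).
Qed.

Section Future.
Context (t : V) (ht : B t t < 0).

Lemma Hyp_Hbar (x : V) : Hyp G t x -> Hbar G t x.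
Proof. by case=> /ltW. Qed.

Lemma Hbar_neq0 (x : V) : Hbar G t x -> x != 0.
Proof. by case=> _; apply: contraTneq => ->; rewrite ip0l ltxx. Qed.

(** The combination of x and y that is orthogonal to t has nonnegative norm. *)
Lemma Hbar_ip_le0 (x y : V) : Hbar G t x -> Hbar G t y -> B x y <= 0.
Proof.
move=> [xx xt] [yy yt].
pose z := B y t *: x + (- B x t) *: y.
have zt : B z t = 0 by rewrite /z !ipE; ring.
have := orth_timelike_ge0 ht zt; rewrite /z !ipE (ipC y x) => h.
have ab : 0 < B y t * B x t by rewrite nmulr_rgt0.
have a2 : B y t ^+ 2 * B x x <= 0 by rewrite mulr_ge0_le0 // sqr_ge0.
have b2 : B x t ^+ 2 * B y y <= 0 by rewrite mulr_ge0_le0 // sqr_ge0.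
rewrite -(pmulr_rle0 _ ab); nra.
Qed.

Lemma Hbar_ip_eq0 (x y : V) : Hbar G t x -> Hbar G t y -> B x y = 0 ->
  B x x = 0 /\ exists2 c, 0 < c & y = c *: x.
Proof.
move=> hx hy xy; have [xx xt] := hx; have [yy yt] := hy.
pose z := B y t *: x + (- B x t) *: y.
have zt : B z t = 0 by rewrite /z !ipE; ring.
have zz : B z z = B y t ^+ 2 * B x x + B x t ^+ 2 * B y y.
  by rewrite /z !ipE (ipC y x) xy; ring.
have a2 : B y t ^+ 2 * B x x <= 0 by rewrite mulr_ge0_le0 // sqr_ge0.
have b2 : B x t ^+ 2 * B y y <= 0 by rewrite mulr_ge0_le0 // sqr_ge0.
have z0 : z = 0.
  apply/eqP; apply: contraT => z0.
  by have := orth_timelike_gt0 ht zt z0; rewrite zz; lra.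
split.
  have : B y t ^+ 2 * B x x = 0.
    by move: (orth_timelike_ge0 ht zt); rewrite zz; lra.
  by move/eqP; rewrite mulf_eq0 sqrf_eq0 (lt_eqF yt) => /eqP.
exists (B y t / B x t); first by rewrite nmulr_rgt0 // invr_lt0.
move/eqP: z0; rewrite addr_eq0 scaleNr opprK => /eqP e.
by rewrite mulrC -scalerA e scalerA mulVf ?scale1r // lt_eqF.
Qed.

Lemma Hyp_ip_lt0 (x y : V) : Hyp G t x -> Hbar G t y -> B x y < 0.
Proof.
move=> hx hy; rewrite lt_neqAle (Hbar_ip_le0 (Hyp_Hbar hx) hy) andbT.
apply/eqP => /(Hbar_ip_eq0 (Hyp_Hbar hx) hy)[xx _].
by case: hx; rewrite xx ltxx.
Qed.

Lemma Hbar_ip_lt0 (x y : V) : Hbar G t x -> Hbar G t y ->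
  (forall c, y <> c *: x) -> B x y < 0.
Proof.
move=> hx hy xy; rewrite lt_neqAle (Hbar_ip_le0 hx hy) andbT.
by apply/eqP => /(Hbar_ip_eq0 hx hy)[_ [c _ /xy]].
Qed.

Lemma HbarZ c (x : V) : 0 < c -> Hbar G t x -> Hbar G t (c *: x).
Proof.
move=> c0 [xx xt]; split; rewrite !ipE; last by rewrite pmulr_rlt0.
by rewrite !pmulr_rle0.
Qed.

Lemma HypZ c (x : V) : 0 < c -> Hyp G t x -> Hyp G t (c *: x).
Proof.
move=> c0 [xx xt]; split; rewrite !ipE; last by rewrite pmulr_rlt0.
by rewrite !pmulr_rlt0.
Qed.

Lemma HbarD (x y : V) : Hbar G t x -> Hbar G t y -> Hbar G t (x + y).
Proof.
move=> hx hy; have xy := Hbar_ip_le0 hx hy.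
case: hx hy => [xx xt] [yy yt]; split; rewrite !ipE (ipC y x) || rewrite !ipE.
  by lra.
by lra.
Qed.

Lemma HypD (x y : V) : Hyp G t x -> Hbar G t y -> Hyp G t (x + y).
Proof.
move=> hx hy; have xy := Hyp_ip_lt0 hx hy.
case: hx hy => [xx xt] [yy yt]; split; rewrite !ipE ?(ipC y x); by lra.
Qed.

Lemma causal_orth_ge0 (x v : V) : B x x <= 0 -> x != 0 -> B v x = 0 ->
  0 <= B v v.
Proof.
move=> xx x0 vx; rewrite leNgt; apply/negP => vv.
by move: (orth_timelike_gt0 vv (etrans (ipC x v) vx) x0); rewrite ltNge xx.
Qed.

Lemma causal_orth_eq0 (x v : V) : Hbar G t x -> B v x = 0 -> B v v = 0 ->
  exists c, v = c *: x.
Proof.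
move=> [xx xt] vx vv; exists (B v t / B x t).
pose z := B v t *: x + (- B x t) *: v.
have zt : B z t = 0 by rewrite /z !ipE; ring.
have zz : B z z = B v t ^+ 2 * B x x.
  by rewrite /z !ipE (ipC x v) vx vv; ring.
have a2 : B v t ^+ 2 * B x x <= 0 by rewrite mulr_ge0_le0 // sqr_ge0.
have z0 : z = 0.
  apply/eqP; apply: contraT => z0.
  by have := orth_timelike_gt0 ht zt z0; rewrite zz; lra.
move/eqP: z0; rewrite addr_eq0 scaleNr opprK => /eqP e.
by rewrite mulrC -scalerA e scalerA mulVf ?scale1r // lt_eqF.
Qed.

(** The form is semidefinite on the complement of a causal vector. *)
Lemma causal_orth_CS (x a b : V) : B x x <= 0 -> x != 0 ->
  B a x = 0 -> B b x = 0 -> 0 < B b b -> B a b ^+ 2 <= B a a * B b b.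
Proof.
move=> xx x0 ax bx bb.
pose z := B b b *: a + (- B a b) *: b.
have zx : B z x = 0 by rewrite /z !ipE ax bx; ring.
have := causal_orth_ge0 xx x0 zx.
have -> : B z z = B b b * (B a a * B b b - B a b ^+ 2).
  by rewrite /z !ipE (ipC b a); ring.
by rewrite pmulr_rge0 // subr_ge0.
Qed.

(** When x is timelike, the component of y orthogonal to x is spacelike. *)
Lemma Hbar_revCS (x y : V) : Hbar G t x -> Hbar G t y ->
  (forall c, y <> c *: x) -> B x x * B y y < B x y ^+ 2.
Proof.
move=> hx hy xy; have xy0 := Hbar_ip_lt0 hx hy xy.
have [xx0|xx0] := eqVneq (B x x) 0.
  by rewrite xx0 mul0r exprn_even_gt0 //= lt_eqF.
have xx : B x x < 0 by rewrite lt_neqAle xx0; case: hx.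
pose v := y - (B x y / B x x) *: x.
have vx : B v x = 0 by rewrite /v !ipE (ipC y x); field.
have v0 : v != 0 by rewrite subr_eq0; apply/eqP => /xy.
have := orth_timelike_gt0 xx vx v0.
have -> : B v v = B y y - B x y ^+ 2 / B x x.
  by rewrite /v !ipE (ipC y x); field.
rewrite subr_gt0 ltr_ndivrMr // [B y y * _]mulrC.
by [].
Qed.
End Future.

Lemma gram_unit : gramR R G \in unitmx.
Proof.
have [_ [M Mu MJ]] := hG.
have : M *m gramR R G *m M^T \in unitmx.
  rewrite MJ; set J := diag_mx _.
  have : J *m J = 1%:M.
    apply/matrixP => i j; rewrite /J mul_diag_mx !mxE.
    by have [->|_] := eqVneq i j; rewrite ?mulr0 //= !mulr1n; case: ifP => _; ring.
  by case/mulmx1_unit.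
by rewrite !unitmx_mul => /andP[/andP[]].
Qed.

Lemma coord_ip (i : 'I_n.+1) : exists g, forall v : V, v 0 i = B v g.
Proof.
exists (invmx (gramR R G) *m (delta_mx 0 i : V)^T)^T => v.
rewrite /ip trmxK !mulmxA mulmxK ?gram_unit // trmx_delta -colE.
by rewrite mxE.
Qed.

(** The form with the sign of the timelike direction y changed is positive
    definite, so it bounds every linear functional. *)
Lemma timelike_bounded (y : V) (M K : R) : B y y < 0 -> exists C : R, forall v : V,
  B v v <= M -> `|B v y| <= K -> forall i, `|v 0 i| <= C.
Proof.
move=> yy; pose q (v w : V) := B v w - 2 * B v y * B w y / B y y.
have q0 v : 0 <= q v v.
  pose w := v - (B v y / B y y) *: y.
  have wy : B w y = 0 by rewrite /w !ipE; field; rewrite lt_eqF.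
  have e : q v v = B w w - B v y ^+ 2 / B y y.
    by rewrite /q /w !ipE (ipC y v); field; rewrite lt_eqF.
  rewrite e addr_ge0 ?(orth_timelike_ge0 yy wy) // oppr_ge0.
  by rewrite mulr_ge0_le0 ?sqr_ge0 // invr_le0 ltW.
have qb v w : `|q v w| <= q v v + q w w.
  have := q0 (v + w); have := q0 (v - w); have := q0 v; have := q0 w.
  rewrite ler_norml /q !ipE (ipC w v) => h1 h2 h3 h4.
  have y0 : B y y != 0 by rewrite lt_eqF.
  move: h1 h2 h3 h4; set j := (B y y)^-1 => h1 h2 h3 h4.
  by apply/andP; split; lra.
have [g gP] := choice coord_ip.
pose g' i := g i - (2 * B (g i) y / B y y) *: y.
exists (M - 2 * K ^+ 2 / B y y + \sum_i q (g' i) (g' i)) => v vM vK i.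
have -> : v 0 i = q v (g' i).
  by rewrite gP /q /g' !ipE; field; rewrite lt_eqF.
apply: (le_trans (qb _ _)); apply: lerD; last first.
  by rewrite (bigD1 i) //= lerDl sumr_ge0.
have h : B v y ^+ 2 <= K ^+ 2.
  rewrite -real_normK ?num_real //.
  by rewrite lerXn2r ?nnegrE // (le_trans _ vK).
have j0 : (B y y)^-1 <= 0 by rewrite invr_le0 ltW.
rewrite /q lerD // lerN2 ler_wnM2r //; lra.
Qed.

Lemma lat_bounded_finite (C : R) :
  finite_set [set v : V | lat v /\ forall i, `|v 0 i| <= C].
Proof.
pose m := (Num.truncn C).+1.
pose F (f : {ffun 'I_n.+1 -> 'I_(2 * m).+1}) : V :=
  \row_i ((f i)%:R - m%:R).
apply: (@sub_finite_set _ _ [set F f | f in setT]); last first.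
  by apply: finite_image; exact: finite_finset.
move=> v /= [vl vC].
have E i : exists z : int, v 0 i = z%:~R.
  by move/mxOverP: vl => /(_ 0 i)/intrP[z ->]; exists z.
have {E}[z zP] := choice E.
have zm i : `|z i| <= m :> int.
  rewrite -(ler_int R) intr_norm -zP (le_trans (vC i)) //.
  by rewrite ltW // -pmulrn truncnS_gt.
exists [ffun i => inord (absz (z i + m%:Z)%R)] => //.
apply/rowP => i; rewrite !mxE ffunE inordK ?zP; last first.
  by have := zm i; lia.
have -> : (absz (z i + m%:Z))%:R = (z i + m%:Z)%:~R :> R.
  have h : (absz (z i + m%:Z))%:Z = z i + m%:Z by have := zm i; lia.
  by rewrite -[in RHS]h.
by rewrite intrD -[in X in _ + X - _]pmulrn addrK.
Qed.

Lemma lat_finite (y : V) (M K : R) : B y y < 0 ->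
  finite_set [set v : V | [/\ lat v, B v v <= M & `|B v y| <= K]].
Proof.
move=> yy; have [C CP] := timelike_bounded M K yy.
apply: sub_finite_set (lat_bounded_finite C) => v /= [vl vM vK].
by split=> // i; exact: CP.
Qed.

End Form.
(** * Lattice vectors, roots and reflections *)

Section Lattices.
Context (R : realType) (n : nat) (G : 'M[rat]_n.+1).
Local Notation V := 'rV[R]_n.+1.
Local Notation B := (ip G).

Lemma latD (v w : V) : lat v -> lat w -> lat (v + w).
Proof.
by move=> /mxOverP hv /mxOverP hw; apply/mxOverP => i j; rewrite mxE rpredD.
Qed.

Lemma latN (v : V) : lat v -> lat (- v).
Proof.
by move=> /mxOverP hv; apply/mxOverP => i j; rewrite mxE rpredN.
Qed.

Lemma lat0 : lat (0 : V).
Proof. by apply/mxOverP => i j; rewrite mxE rpred0. Qed.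

Lemma latZ (c : R) (v : V) : c \is a Num.int -> lat v -> lat (c *: v).
Proof.
by move=> hc /mxOverP hv; apply/mxOverP => i j; rewrite mxE rpredM.
Qed.

Lemma denq_ratr_int (q : rat) (d : int) : (denq q %| d)%Z ->
  d%:~R * ratr q \is a (@Num.int R).
Proof.
case/dvdzP => m ->; rewrite intrM /ratr.
have d0 : (denq q)%:~R != 0 :> R by rewrite intr_eq0 denq_neq0.
have -> : m%:~R * (denq q)%:~R * ((numq q)%:~R / (denq q)%:~R) =
  m%:~R * (numq q)%:~R :> R by field.
by rewrite rpredM ?intr_int.
Qed.

Lemma scaler_lat_map (q : 'rV[rat]_n.+1) :
  exists2 d : nat, (0 < d)%N & lat (d%:R *: map_mx ratr q : V).
Proof.
pose d : int := \prod_j denq (q 0 j).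
have d0 : 0 < d by apply: prodr_gt0 => j _; exact: denq_gt0.
exists (absz d); first by lia.
apply/mxOverP => i j; rewrite !mxE (ord1 i).
have -> : (absz d)%:R = d%:~R :> R by rewrite -[RHS]/((d)%:~R) -[in RHS](gtz0_abs d0).
by apply: denq_ratr_int; rewrite /d (bigD1 j) //= dvdz_mulr.
Qed.

Lemma ip_denominator : exists2 d : nat, (0 < d)%N &
  forall v w : V, lat v -> lat w -> d%:R * B v w \is a Num.int.
Proof.
pose d : int := \prod_i \prod_j denq (G i j).
have d0 : 0 < d.
  by apply: prodr_gt0 => i _; apply: prodr_gt0 => j _; exact: denq_gt0.
exists (absz d); first by lia.
have -> : (absz d)%:R = d%:~R :> R by rewrite -[RHS]/((d)%:~R) -[in RHS](gtz0_abs d0).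
move=> v w /mxOverP vl /mxOverP wl.
rewrite /ip !mxE big_distrr rpred_sum //= => j _; rewrite !mxE mulrA.
rewrite rpredM // big_distrr rpred_sum //= => i _.
rewrite !mxE mulrCA rpredM //; apply: denq_ratr_int.
by rewrite /d (bigD1 i) //= (bigD1 j) //= -mulrA dvdz_mulr.
Qed.

Hypothesis hG : lorentzian R G.

Lemma primitive_neq0 (v : V) : primitive v -> v != 0.
Proof.
move=> [_ h]; apply/eqP => v0.
by have [] := h 0 2 lat0; rewrite ?v0 ?mul0rz.
Qed.

Lemma primitiveN (v : V) : primitive v -> primitive (- v).
Proof.
move=> [vl h]; split=> [|w m wl e]; first exact: latN.
by apply: (h (- w) m (latN wl)); rewrite mulNrz -e opprK.
Qed.

(** The largest integer that divides v exists, since it divides a nonzero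
    coordinate. *)
Lemma lat_primitive (v : V) : lat v -> v != 0 ->
  exists2 m : nat, (0 < m)%N & exists2 w, primitive w & v = m%:R *: w.
Proof.
move=> vl v0; have [i vi] : exists i, v 0 i != 0.
  by apply/existsP; apply: contraNT v0 => /existsPn h; apply/eqP/rowP => i;
    rewrite mxE; apply/eqP; have := h i; rewrite negbK.
have /intrP[z zP] : v 0 i \is a Num.int by move/mxOverP: vl; exact.
pose P (m : nat) := `[< (0 < m)%N /\ exists2 w : V, lat w & v = m%:R *: w >].
have P1 : exists m, P m.
  by exists 1%N; apply/asboolP; split => //; exists v => //; rewrite scale1r.
have Pb m : P m -> (m <= absz z)%N.
  move=> /asboolP[m0 [w /mxOverP wl e]].
  have /intrP[y yP] := wl 0 i.
  have : z = m%:Z * y.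
    by apply/eqP; rewrite -(eqr_int R) intrM -zP -yP e mxE.
  have : z != 0 by apply: contraNneq vi; rewrite zP => ->.
  move=> z0 e'; rewrite e' abszM leq_pmulr // absz_gt0.
  by apply: contraNneq z0 => y0; rewrite e' y0 mulr0.
case: (ex_maxnP P1 Pb) => m /asboolP[m0 [w wl e]] mmax.
exists m => //; exists w => //; split=> // w' m' wl' e'.
have w0 : w != 0 by apply: contraNneq v0 => w0; rewrite e w0 scaler0.
have m'0 : m' != 0 by apply: contraNneq w0 => m'0; rewrite e' m'0 mulr0z.
have /mmax : P (m * absz m')%N.
  apply/asboolP; split; first by rewrite muln_gt0 m0 absz_gt0.
  exists (if m' < 0 then - w' else w'); first by case: ifP => // _; exact: latN.
  rewrite e e' -scaler_int natrM -scalerA; congr (_ *: _).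
  case: ifP => m'n.
    by rewrite scalerN -scaleNr; congr (_ *: _); rewrite pmulrn -mulrNz; congr (_ *~ _); lia.
  by congr (_ *: _); rewrite pmulrn; congr (_ *~ _); lia.
move: m0 m'0 => m0 m'0 h.
have : (absz m' <= 1)%N by rewrite -(leq_pmul2l m0) muln1.
by lia.
Qed.

(** The ratio is rational, and by Bezout the two vectors are the multiples of one
    lattice vector by its coprime numerator and denominator. *)
Lemma primitive_parallel (a b : V) (c : R) : primitive a -> primitive b -> 0 < c ->
  a = c *: b -> a = b.
Proof.
move=> [al ap] bp0 c0 e; have [bl bp] := bp0.
have [i bi] : exists i, b 0 i != 0.
  have := primitive_neq0 bp0.
  move=> v0; apply/existsP; apply: contraNT v0 => /existsPn h; apply/eqP/rowP => i.
  by rewrite mxE; apply/eqP; have := h i; rewrite negbK.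
have /intrP[y yP] : b 0 i \is a Num.int by move/mxOverP: bl; exact.
have /intrP[x xP] : a 0 i \is a Num.int by move/mxOverP: al; exact.
have cE : c = x%:~R / y%:~R by rewrite -xP -yP e mxE mulfK.
have yab : y%:~R *: a = x%:~R *: b.
  by rewrite e cE scalerA mulrC divfK // -yP.
have y0 : y != 0 by apply: contraNneq bi; rewrite yP => ->.
have [u [v uv]] := Bezoutz x y.
pose g := gcdz x y.
have g0 : g%:~R != 0 :> R by rewrite intr_eq0 gcdz_eq0 (negPf y0) andbF.
have gR : g%:~R = u%:~R * x%:~R + v%:~R * y%:~R :> R.
  by rewrite /g -uv intrD !intrM.
have /dvdzP[x' x'P] := dvdz_gcdl x y; have /dvdzP[y' y'P] := dvdz_gcdr x y.
pose w : V := u%:~R *: a + v%:~R *: b.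
have wl : lat w by apply: latD; apply: latZ => //; exact: intr_int.
have aw : a = w *~ x'.
  apply: (scalerI g0); rewrite -[w *~ _]scaler_int scalerA -intrM mulrC -x'P gR.
  rewrite scalerDl scalerDr !scalerA [x%:~R * v%:~R]mulrC -[(v%:~R * x%:~R) *: b]scalerA.
  by rewrite -yab scalerA [x%:~R * u%:~R]mulrC.
have bw : b = w *~ y'.
  apply: (scalerI g0); rewrite -[w *~ _]scaler_int scalerA -intrM mulrC -y'P gR.
  rewrite scalerDl scalerDr !scalerA [y%:~R * u%:~R]mulrC -[(u%:~R * y%:~R) *: a]scalerA.
  by rewrite yab scalerA [y%:~R * v%:~R]mulrC.
have w0 : w != 0.
  by apply: contraNneq bi => w0; rewrite bw w0 mul0rz mxE.
have bab : b = - a -> a = b.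
  move=> ba; have : (1 + c) *: b = 0 by rewrite scalerDl scale1r -e ba addNr.
  move/eqP; rewrite scaler_eq0 (negPf (primitive_neq0 bp0)) orbF => /eqP h; exfalso; lra.
have [ex|ex] := ap _ _ wl aw; have [ey|ey] := bp _ _ wl bw; move: aw bw;
  rewrite ex ey ?mulrN1z ?mulr1z => aw bw.
- by rewrite aw bw.
- by apply: bab; rewrite aw.
- by apply: bab; rewrite bw aw opprK.
- by rewrite aw bw.
Qed.

Local Notation root := (lattice_roots G).

Lemma lattice_rootN (a : V) : root a -> root (- a).
Proof.
move=> [ap aa ai]; split; first exact: primitiveN.
  by rewrite !ipE opprK.
move=> w wl; have [m mP] := ai w wl; exists (- m).
by rewrite !ipE mP opprK mulrNz mulNr.
Qed.

Lemma root_neq0 (a : V) : root a -> a != 0.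
Proof. by case=> /primitive_neq0. Qed.

Lemma root_gt0 (a : V) : root a -> 0 < B a a.
Proof. by case. Qed.

Lemma root_lat (a : V) : root a -> lat a.
Proof. by case=> -[]. Qed.

(** A vector of norm N in L_N is a multiple of a root: dividing it by m
    divides N by m ^ 2 but its inner products only by m. *)
Lemma lat_N_root (N : R) (v : V) : lat_N G N v -> B v v = N -> 0 < N ->
  exists2 m : nat, (0 < m)%N & exists2 b, root b & v = m%:R *: b.
Proof.
move=> [vl vN] vv N0.
have v0 : v != 0 by apply: contraTneq N0 => v0; rewrite -vv v0 ip0l ltxx.
have [m m0 [b bp e]] := lat_primitive vl v0; exists m => //; exists b => //.
have mR : m%:R != 0 :> R by rewrite pnatr_eq0 -lt0n.
have NE : N = m%:R ^+ 2 * B b b by rewrite -vv e !ipE; ring.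
split=> //.
  by move: N0; rewrite NE pmulr_rgt0 // exprn_gt0 // ltr0n.
move=> w wl; have [z] := vN w wl; rewrite e NE !ipE => h.
exists (z * m%:Z); rewrite intrM.
have -> : m%:Z%:~R = m%:R :> R by [].
by apply: (mulfI mR); rewrite h; ring.
Qed.

Lemma root_parallel (a b : V) (c : R) : root a -> root b -> 0 < c -> a = c *: b ->
  a = b.
Proof. by move=> [ap _ _] [bp _ _]; exact: primitive_parallel. Qed.

Local Notation s := (reflection G).

Lemma reflectionZ a c (x : V) : s a (c *: x) = c *: s a x.
Proof.
by rewrite /reflection ipZl scalerBr scalerA; congr (_ - _ *: _); ring.
Qed.

Lemma reflectionK a (x : V) : B a a != 0 -> s a (s a x) = x.
Proof.
move=> aa; rewrite {1}/reflection /reflection !ipE -addrA -opprD -scalerDl.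
have -> : 2 * (B x a / B a a) + 2 * ((B x a + - (2 * (B x a / B a a) * B a a)) / B a a) = 0.
  by field.
by rewrite scale0r subr0.
Qed.

Lemma reflection_adj a (x y : V) : B (s a x) y = B x (s a y).
Proof. by rewrite /reflection !ipE (ipC hG a y); ring. Qed.

Lemma reflection_ip a (x y : V) : B a a != 0 -> B (s a x) (s a y) = B x y.
Proof. by move=> aa; rewrite reflection_adj reflectionK. Qed.

Lemma root_integral a (x : V) : root a -> lat x ->
  exists m : int, 2 * (B x a / B a a) = m%:~R.
Proof.
move=> ar xl; have a0 := root_gt0 ar; have [_ _ /(_ x xl)[m mP]] := ar.
by exists m; rewrite (ipC hG) mP; field; rewrite gt_eqF.
Qed.

Lemma reflection_lat a (x : V) : root a -> lat x -> lat (s a x).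
Proof.
move=> ar xl; have [m mP] := root_integral ar xl; rewrite /reflection mP.
by apply: latD => //; apply: latN; apply: latZ (intr_int _ _) (root_lat ar).
Qed.

Lemma reflection_root (a b : V) : root a -> root b -> root (s a b).
Proof.
move=> ar br; have a0 : B a a != 0 by rewrite gt_eqF ?root_gt0.
have [[bl bp] bb bi] := br; split.
- split=> [|w m wl e]; first exact: reflection_lat.
  apply: (bp (s a w) m); first exact: reflection_lat.
  by rewrite -(reflectionK b a0) e -[w *~ m]scaler_int reflectionZ scaler_int.
- by rewrite reflection_ip.
- move=> w wl; have [m mP] := bi _ (reflection_lat ar wl); exists m.
  by rewrite reflection_adj mP reflection_ip.
Qed.

Lemma root_lat_N (a : V) : root a -> lat_N G (B a a) a.
Proof. by move=> [[al _] _ ai]. Qed.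

(** The products of lattice vectors have a common denominator d, and N is a
    multiple of 1 / d; m = N d does. *)
Lemma lat_N_multiple (a : V) : root a -> exists2 m : nat, (0 < m)%N &
  forall v, lat v -> lat_N G (B a a) (m%:R *: v).
Proof.
move=> ar; have [d d0 dP] := ip_denominator.
have aa := root_gt0 ar; have := dP _ _ (root_lat ar) (root_lat ar).
case/intrP => z zP.
have dR : 0 < d%:R :> R by rewrite ltr0n.
have z0 : 0 < z by rewrite -(ltr_int R) -zP mulr_gt0.
exists (absz z); first by lia.
move=> v vl; split; first by apply: latZ => //; rewrite -pmulrn intr_int.
move=> w wl; have /intrP[y yP] := dP _ _ vl wl; exists (2 * y).
have -> : (absz z)%:R = z%:~R :> R by rewrite -[in RHS](gtz0_abs z0).
by rewrite ipE -zP intrM -yP; field.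
Qed.

End Lattices.
(** * Chambers as cells of constant sign *)

Section Chambers.
Context (R : realType) (n : nat) (G : 'M[rat]_n.+1).
Local Notation V := 'rV[R]_n.+1.
Local Notation B := (ip G).

Lemma ip_coordr (x y : V) : B x y = \sum_i y 0 i * B x (delta_mx 0 i).
Proof.
have {1}-> : y = \sum_i y 0 i *: delta_mx 0 i.
  by rewrite {1}[y]matrix_sum_delta big_ord_recl big_ord0 addr0.
elim/big_rec2: _ => [|i a b _ <-]; first exact: ip0r.
by rewrite ipDr ipZr.
Qed.

Hypothesis hG : lorentzian R G.

Lemma ip_coordl (x y : V) : B x y = \sum_i x 0 i * B (delta_mx 0 i) y.
Proof.
rewrite (ipC hG) ip_coordr; apply: eq_bigr => i _.
by rewrite (ipC hG y).
Qed.

Lemma sum_continuous (m : nat) (f : 'I_m -> V -> R) :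
  (forall i, continuous (f i)) -> continuous (fun x => \sum_i f i x).
Proof.
move=> fc x; elim: m f fc => [|m IH] f fc.
  have -> : (fun x => \sum_i f i x) = (fun=> 0).
    by apply/funext => y; rewrite big_ord0.
  exact: cst_continuous.
have -> : (fun x => \sum_i f i x) =
    (fun x => f ord0 x + \sum_(i < m) f (lift ord0 i) x).
  by apply/funext => y; rewrite big_ord_recl.
by apply: continuousD; [exact: fc|apply: IH => i; exact: fc].
Qed.

Lemma ip_continuousl (y : V) : continuous (fun x => B x y).
Proof.
have -> : (fun x => B x y) = (fun x => \sum_i x 0 i * B (delta_mx 0 i) y).
  by apply/funext => x; exact: ip_coordl.
apply: sum_continuous => i x.
exact: (@continuousM R V (fun x => x 0 i) (fun=> B (delta_mx 0 i) y) x
  (@coord_continuous R 1 n.+1 0 i x) (@cst_continuous _ _ _ x)).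
Qed.

Lemma ip_continuousr (y : V) : continuous (fun x => B y x).
Proof.
have -> : (fun x => B y x) = (fun x => B x y); last exact: ip_continuousl.
by apply/funext => x; rewrite (ipC hG).
Qed.

Lemma sq_continuous : continuous (fun x : V => B x x).
Proof.
have -> : (fun x : V => B x x) = (fun x => \sum_i x 0 i * B (delta_mx 0 i) x).
  by apply/funext => x; exact: ip_coordl.
apply: sum_continuous => i x.
exact: (@continuousM R V (fun x => x 0 i) (fun x => B (delta_mx 0 i) x) x
  (@coord_continuous R 1 n.+1 0 i x) (@ip_continuousr (delta_mx 0 i) x)).
Qed.

Lemma nbhs_line (y v : V) (W : set V) : nbhs y W ->
  exists2 e : R, 0 < e & W (y + e *: v).
Proof.
have : (fun s : R => y + s *: v) @ 0 --> y + (0 : R) *: v.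
  by apply: cvgD; [exact: cvg_cst|exact: scalel_continuous].
rewrite scale0r addr0 => /[apply] /nbhs_ballP[e /= e0 he].
have e20 : 0 < e / 2 by rewrite divr_gt0.
exists (e / 2) => //; apply: he; rewrite /ball /= sub0r normrN gtr0_norm //.
by rewrite ltr_pdivrMr // ltr_pMr // ltr1n.
Qed.

Lemma near_ip_lt0 (a p : V) : B a p < 0 -> \forall z \near p, B a z < 0.
Proof.
move=> ap; have := @ip_continuousr a p => /(_ [set x | x < 0]); apply.
by apply: open_nbhs_nbhs; split => //; exact: open_lt.
Qed.

Lemma near_sq_lt0 (p : V) : B p p < 0 -> \forall z \near p, B z z < 0.
Proof.
move=> pp; have := @sq_continuous p => /(_ [set x | x < 0]); apply.
by apply: open_nbhs_nbhs; split => //; exact: open_lt.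
Qed.

Lemma near_Hyp t (p : V) : Hyp G t p -> \forall z \near p, Hyp G t z.
Proof.
move=> [pp pt]; rewrite (ipC hG) in pt.
have := near_ip_lt0 pt; have := near_sq_lt0 pp; apply: filterS2 => z zz tz.
by split=> //; rewrite (ipC hG).
Qed.

(** Local finiteness of the mirrors: roots have bounded norm, so only
    finitely many of them can change sign near a timelike vector p. *)
Lemma near_mirrors (M : R) (p : V) : B p p < 0 ->
    (forall a, lattice_roots G a -> B a a <= M) ->
  \forall z \near p, forall a, lattice_roots G a -> B a p < 0 -> B a z < 0.
Proof.
move=> pp aM.
have [C CP] := timelike_bounded hG 1 1 pp.
pose M1 : R := `|M| + 1.
have M1P : 1 <= M1 by rewrite /M1 lerDr.
pose e : R := (2 * ((n.+1)%:R * (`|C| + 1)))^-1.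
have e0 : 0 < e by rewrite invr_gt0 !mulr_gt0 // ltr_wpDl.
have fin := lat_finite hG M M1 pp.
have /finite_seqP[S SE] := fin.
have nS : \forall z \near p, forall a, a \in S -> B a p < 0 -> B a z < 0.
  elim: S {SE} => [|b S IH]; first by apply: (@nearW _ (nbhs p)) => z a; rewrite in_nil.
  have : \forall z \near p, B b p < 0 -> B b z < 0.
    case: (ltP (B b p) 0) => ap; last by apply: (@nearW _ (nbhs p)).
    by move: (near_ip_lt0 ap); apply: filterS.
  move: IH; apply: filterS2 => z IH bz a; rewrite inE => /orP[/eqP->//|].
  exact: IH.
have ne : \forall z \near p, forall i : 'I_n.+1,
    `|B (delta_mx 0 i) z - B (delta_mx 0 i) p| < e.
  apply: (@filter_forall V _ (fun (i : 'I_n.+1) z =>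
    `|B (delta_mx 0 i) z - B (delta_mx 0 i) p| < e) (nbhs p)) => i.
  have := @ip_continuousr (delta_mx 0 i) p.
  move/cvgrPdist_lt => /(_ e e0); apply: filterS => z.
  by rewrite distrC.
move: nS ne; apply: filterS2 => z nS ne a ar ap.
rewrite ltNge; apply/negP => az.
pose l : R := M1 + `|B a p|.
have l1 : 1 <= l by rewrite /l ler_wpDr.
have l0 : 0 < l by rewrite (lt_le_trans _ l1).
have lc i : `|a 0 i| <= `|C| * l.
  have : `|(l^-1 *: a) 0 i| <= C.
    apply: CP; rewrite !ipE.
      have -> : l^-1 * (l^-1 * B a a) = B a a / l ^+ 2 by field; rewrite gt_eqF.
      rewrite ler_pdivrMr ?exprn_gt0 // mul1r.
      have := aM _ ar; have := ler_norm M.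
      have : M1 <= l by rewrite /l lerDl.
      rewrite /M1; nra.
    by rewrite normrM gtr0_norm ?invr_gt0 // ler_pdivrMl // mulr1 /l lerDr (le_trans ler01).
  rewrite mxE normrM gtr0_norm ?invr_gt0 // ler_pdivrMl // mulrC => h.
  by apply: (le_trans h); rewrite ler_pM2r // ler_norm.
have : `|B a p| <= l / 2.
  have h : `|B a p| <= `|B a z - B a p|.
    rewrite ltr0_norm // ger0_norm; lra.
  apply: (le_trans h); rewrite (ip_coordl a z) (ip_coordl a p) -sumrB.
  apply: (le_trans (ler_norm_sum _ _ _)).
  have : \sum_i `|a 0 i * B (delta_mx 0 i) z - a 0 i * B (delta_mx 0 i) p| <=
      \sum_(i < n.+1) (`|C| * l * e).
    apply: ler_sum => i _; rewrite -mulrBr normrM ler_pM // ltW //; exact: ne.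
  move/le_trans; apply; rewrite sumr_const card_ord -[leLHS]mulr_natr /e.
  have aux (N c : R) : 0 < N -> 0 <= c ->
      c * l * (2 * (N * (c + 1)))^-1 * N <= l / 2.
    move=> N0 c0.
    have -> : c * l * (2 * (N * (c + 1)))^-1 * N = (l / 2) * (c / (c + 1)).
      by field; apply/andP; split; lra.
    by rewrite ger_pMr ?divr_gt0 // ler_pdivrMr; lra.
  by apply: aux; rewrite ?ltr0n.
move=> h; have : a \in S.
  have : [set` S] a; last by [].
  rewrite -SE; split; first exact: root_lat ar.
    exact: aM.
  by move: h; rewrite /l; lra.
by move/nS => /(_ ap); rewrite ltNge az.
Qed.

Section Cells.
Context (t : V) (ht : B t t < 0).

(** The closed cell of x, cut out by the half-spaces of the elements of Phi that
    are negative at x. *)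
Definition signed_chamber (Phi : set V) (x : V) : set V :=
  [set y | Hbar G t y /\ forall a, Phi a -> B a x < 0 -> B a y <= 0].

Lemma mirror_complementP (Phi : set V) (x : V) :
  (forall a, Phi a -> lattice_roots G a) ->
  mirror_complement G t Phi x <->
  Hyp G t x /\ forall a, Phi a -> B a x != 0.
Proof.
move=> Pr; split=> [[hx h]|[hx h]]; split=> //.
  move=> a Pa; apply/eqP => ax; apply: h; exists a => //; split=> //.
  by rewrite /reflection (ipC hG) ax mul0r mulr0 scale0r subr0.
move=> [a Pa [_ ax]]; have := h a Pa; rewrite (ipC hG).
have aa := root_gt0 (Pr _ Pa).
have : (2 * (B x a / B a a)) *: a == 0.
  by move/eqP: ax; rewrite /reflection -subr_eq0 addrAC subrr add0r oppr_eq0.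
rewrite scaler_eq0 (negPf (root_neq0 (Pr _ Pa))) orbF mulf_eq0 pnatr_eq0 /=.
by rewrite mulf_eq0 invr_eq0 (gt_eqF aa) orbF => ->.
Qed.

Lemma segment_cell (x y : V) (s : R) (Phi : set V) :
  Hyp G t x -> Hyp G t y -> s \in `[0, 1] ->
  (forall a, Phi a -> 0 < B a x * B a y) ->
  Hyp G t ((1 - s) *: x + s *: y) /\
  forall a, Phi a -> B a ((1 - s) *: x + s *: y) != 0.
Proof.
move=> hx hy; rewrite in_itv /= => /andP[s0 s1] h; split.
  have [->|s00] := eqVneq s 0; first by rewrite subr0 scale1r scale0r addr0.
  have [->|s11] := eqVneq s 1; first by rewrite subrr scale1r scale0r add0r.
  apply: HypD => //; first by apply: HypZ => //; rewrite subr_gt0 lt_neqAle s11.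
  by apply/Hyp_Hbar/HypZ => //; rewrite lt_neqAle eq_sym s00.
move=> a /h; rewrite ipDr !ipZr => axy; apply/eqP => e.
have : B a x * B a x * (1 - s) + s * (B a x * B a y) = 0.
  by rewrite -[RHS](mulr0 (B a x)) -e; ring.
have x2 : 0 < B a x * B a x.
  rewrite -expr2 exprn_even_gt0 //=; apply/eqP => ax.
  by rewrite ax mul0r ltxx in axy.
have h1 : 0 <= B a x * B a x * (1 - s) by rewrite mulr_ge0 ?subr_ge0 // ltW.
have [ss|ss] := ltP 0 s; first by have := mulr_gt0 ss axy; lra.
have -> : s = 0 by lra.
lra.
Qed.

(** Segments do not leave the cell of points with given signs, and a connected
    set avoiding a mirror lies on one side of it. *)
Lemma component_cell (Phi : set V) (x : V) :
  (forall a, Phi a -> lattice_roots G a) -> mirror_complement G t Phi x ->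
  connected_component (mirror_complement G t Phi) x =
  [set y | Hyp G t y /\ forall a, Phi a -> 0 < B a x * B a y].
Proof.
move=> Pr mx; apply/seteqP; split=> y.
  move=> yc; have yM := connected_component_sub yc.
  have /(mirror_complementP _ Pr)[hy hya] := yM.
  have /(mirror_complementP _ Pr)[hx hxa] := mx.
  split=> // a Pa; rewrite ltNge; apply/negP => axy.
  pose Cc := connected_component (mirror_complement G t Phi) x.
  have : is_interval ((fun z => B a z) @` Cc).
    apply/connected_intervalP/connected_continuous_connected.
      exact: component_connected.
    by apply: continuous_subspaceT => z; exact: ip_continuousr.
  have fx : ((fun z => B a z) @` Cc) (B a x).
    by exists x => //; exact: connected_component_refl.
  have fy : ((fun z => B a z) @` Cc) (B a y) by exists y.
  move=> h; have : ((fun z => B a z) @` Cc) 0.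
    case: (ltP (B a x) 0) => ax.
      by apply: (h _ _ fx fy); apply/andP; split; nra.
    apply: (h _ _ fy fx); apply/andP; split => //.
    have := hxa _ Pa; rewrite neq_lt ltNge ax /= => ax0; nra.
  move=> [z zc za]; have /(mirror_complementP _ Pr)[_ /(_ a Pa)] :=
    connected_component_sub zc.
  by rewrite za eqxx.
move=> [hy hya]; have /(mirror_complementP _ Pr)[hx hxa] := mx.
pose f (s : R) : V := (1 - s) *: x + s *: y.
exists (f @` `[0, 1]%classic); last first.
  exists 1; first by rewrite /= in_itv /= ler01 lexx.
  by rewrite /f subrr scale0r scale1r add0r.
split.
- exists 0; first by rewrite /= in_itv /= ler01 lexx.
  by rewrite /f subr0 scale0r scale1r addr0.
- move=> _ [s hs <-]; apply/mirror_complementP => //.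
  exact: segment_cell.
- apply: connected_continuous_connected; first exact: segment_connected.
  apply: continuous_subspaceT => s; apply: cvgD; last exact: scalel_continuous.
  apply: cvgZl; apply: cvgB; first exact: cvg_cst.
  exact: cvg_id.
Qed.

(** A point of the closed cell is a limit of its translates towards x, which
    lie in the open cell. *)
Lemma chamberE (Phi : set V) (x : V) :
  (forall a, Phi a -> lattice_roots G a) -> (forall a, Phi a -> Phi (- a)) ->
  mirror_complement G t Phi x ->
  closure (connected_component (mirror_complement G t Phi) x) `&` Hbar G t =
  signed_chamber Phi x.
Proof.
move=> Pr PN mx; have /(mirror_complementP _ Pr)[hx hxa] := mx.
rewrite component_cell //; apply/seteqP; split=> y.
  move=> [yc hy]; split=> // a Pa ax.
  have cl : closed [set z | B a z <= 0].
    by apply: (@closed_comp _ _ (fun z => B a z) [set r | r <= 0]);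
       [move=> z _; exact: ip_continuousr|exact: closed_le].
  apply: cl; move: yc; apply: closureS => z [_ /(_ a Pa)]/=.
  by move=> h; nra.
move=> [hy hya]; split=> // W /(nbhs_line x)[e e0 We].
exists (y + e *: x); split=> //; split; first by rewrite addrC; apply: HypD => //; exact: HypZ.
move=> a Pa; rewrite ipDr ipZr.
have h : 0 < e * (B a x * B a x).
  by rewrite mulr_gt0 // -expr2 exprn_even_gt0 // hxa.
suff : 0 <= B a x * B a y by lra.
have := hxa a Pa; rewrite neq_lt => /orP[ax|ax].
  by rewrite mulr_le0 // ?(ltW ax) // hya.
have := hya _ (PN _ Pa); rewrite !ipNl oppr_lt0 oppr_le0 => /(_ ax) ay.
by rewrite mulr_ge0 // ltW.
Qed.

End Cells.
End Chambers.
(** * Cones and spans *)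

(** Induction on the number of predecessors, counted in the finite segment
    below a. *)
Lemma finite_wf_ind (T : choiceType) (A : set T) (r : T -> T -> Prop)
    (P : T -> Prop) :
  (forall a b c, r a b -> r b c -> r a c) -> (forall a, ~ r a a) ->
  (forall a, A a -> finite_set [set b | A b /\ r b a]) ->
  (forall a, A a -> (forall b, A b -> r b a -> P b) -> P a) ->
  forall a, A a -> P a.
Proof.
move=> tr ir fin step a Aa; have /finite_seqP[s sE] := fin a Aa.
have sP b : A b -> r b a -> b \in s.
  by move=> Ab ba; have : [set` s] b by rewrite -sE.
suff H m b : A b -> (b = a \/ r b a) ->
    (count (fun c => `[< r c b >]) s < m)%N -> P b.
  by apply: (H _ a Aa _ (ltnSn _)); left.
elim: m b => // m IH b Ab ba; rewrite ltnS => cm.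
apply: step => // c Ac cb.
have ca : r c a by case: ba => [<-//|]; exact: tr.
apply: (IH c Ac (or_intror ca)); apply: leq_trans cm.
pose p : pred T := fun x => `[< r x c >].
have E := count_predUI p (pred1 c) s.
have I0 : count (predI p (pred1 c)) s = 0%N.
  apply/eqP; rewrite -leqn0 leqNgt -has_count; apply/hasPn => x _ /=.
  by case: eqP => [->|_]; rewrite ?andbF // andbT; apply/negP => /asboolP /ir.
have c1 : (0 < count (pred1 c) s)%N.
  by rewrite -has_count has_pred1; exact: sP.
have : (count (predU p (pred1 c)) s <= count (fun x => `[< r x b >]) s)%N.
  apply: sub_count => x /= /orP[/asboolP xc|/eqP ->]; apply/asboolP => //.
  exact: tr cb.
rewrite -/p; apply: leq_trans; move: E; rewrite I0 addn0 => ->.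
by rewrite -addn1 leq_add2l.
Qed.

Section Cone.
Context (R : realType) (V : lmodType R).

Definition cone (A : set V) : set V :=
  [set v | exists2 s : seq (R * V), (forall p, p \in s -> 0 <= p.1 /\ A p.2)
           & v = \sum_(p <- s) p.1 *: p.2].

Lemma cone_sub (A : set V) v : A v -> cone A v.
Proof.
move=> Av; exists [:: (1, v)]; last by rewrite big_seq1 scale1r.
by move=> p; rewrite inE => /eqP ->.
Qed.

Lemma cone_mono (A A' : set V) : A `<=` A' -> cone A `<=` cone A'.
Proof. by move=> AA v [s sA ->]; exists s => // p /sA[p0 /AA]. Qed.

Lemma coneD (A : set V) v w : cone A v -> cone A w -> cone A (v + w).
Proof.
move=> [s sA ->] [s' sA' ->]; exists (s ++ s'); last by rewrite big_cat.
by move=> p; rewrite mem_cat => /orP[/sA|/sA'].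
Qed.

Lemma coneZ (A : set V) c v : 0 <= c -> cone A v -> cone A (c *: v).
Proof.
move=> c0 [s sA ->]; exists [seq (c * p.1, p.2) | p <- s].
  by move=> _ /mapP[p /sA[p0 pA] ->]; split => //=; rewrite mulr_ge0.
by rewrite big_map scaler_sumr; apply: eq_bigr => p _; rewrite scalerA.
Qed.

Lemma cone_idem (A : set V) : cone (cone A) `<=` cone A.
Proof.
move=> v [s sA ->]; elim: s sA => [|p s IH] sA.
  by rewrite big_nil; exists [::] => //; rewrite big_nil.
rewrite big_cons; apply: coneD; last first.
  by apply: IH => q qs; apply: sA; rewrite inE qs orbT.
have [|p0 pA] := sA p; first by rewrite inE eqxx.
exact: coneZ.
Qed.
End Cone.

Section Span.
Context (R : realType) (n : nat) (G : 'M[rat]_n.+1).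
Local Notation V := 'rV[R]_n.+1.
Local Notation B := (ip G).

Lemma span_rank_exists (A : set V) : exists d, span_rank A d.
Proof.
pose P d := `[< exists M : 'M[R]_(d, n.+1),
  row_free M /\ forall i, A (row i M) >].
have P0 : exists d, P d.
  exists 0%N; apply/asboolP; exists 0; split; last by case.
  by rewrite /row_free mxrank0.
have Pb d : P d -> (d <= n.+1)%N.
  by move=> /asboolP[M [/eqP Mf _]]; rewrite -[leqLHS]Mf rank_leq_col.
case: (ex_maxnP P0 Pb) => d /asboolP[M [Mf MA]] dmax.
exists d, M; split=> // x Ax; apply/negPn/negP => xM.
suff /dmax : P (d + 1)%N by rewrite addn1 ltnn.
apply/asboolP; exists (col_mx M x); split; last first.
  move=> i; case: (splitP i) => j ij.
    by rewrite (_ : i = lshift 1 j) ?rowKu //; exact: val_inj.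
  rewrite (_ : i = rshift d j); last exact: val_inj.
  by rewrite rowKd (ord1 j) row_id.
rewrite /row_free eqn_leq rank_leq_row /= -[leqLHS]/(d + 1)%N [leqLHS]addn1.
have : (M < col_mx M x)%MS.
  by rewrite ltmxE col_mx_sub submx_refl xM andbT -addsmxE addsmxSl.
by move/rank_ltmx; rewrite (eqP Mf).
Qed.

Lemma span_rank_le (A : set V) d m (W : 'M[R]_(m, n.+1)) : span_rank A d ->
  (forall x, A x -> (x <= W)%MS) -> (d <= \rank W)%N.
Proof.
move=> [M [/eqP Mf MA _]] AW; rewrite -[leqLHS]Mf mxrankS //.
by apply/row_subP => i; exact/AW/MA.
Qed.

Lemma span_rank_ge (A : set V) d m (W : 'M[R]_(m, n.+1)) : span_rank A d ->
  (forall d' (S : 'M[R]_(d', n.+1)),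
     (forall x, A x -> (x <= S)%MS) -> (W <= S)%MS) -> (\rank W <= d)%N.
Proof.
by move=> [M [/eqP Mf _ /[swap]/[apply] WM]]; rewrite -[leqRHS]Mf mxrankS.
Qed.

Hypothesis hG : lorentzian R G.

Definition orthmx (a : V) : 'M[R]_n.+1 := kermx (gramR R G *m a^T).

Lemma orthmxP (a x : V) : (x <= orthmx a)%MS <-> B x a = 0.
Proof.
split=> [/sub_kermxP h|h]; first by rewrite /ip -mulmxA h mxE.
apply/sub_kermxP/matrixP => i j; rewrite (ord1 i) (ord1 j) mulmxA [RHS]mxE.
exact: h.
Qed.

Lemma rank_orthmx (a : V) : a != 0 -> \rank (orthmx a) = n.
Proof.
move=> a0; have gu : row_free (gramR R G)^T by rewrite row_free_unit unitmx_tr gram_unit.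
by rewrite mxrank_ker -mxrank_tr trmx_mul trmxK mxrankMfree // rank_rV a0 subn1.
Qed.

(** The complement of n independent vectors has dimension one. *)
Lemma orth_span_parallel (F : set V) (a b : V) : span_rank F n -> a != 0 ->
  (forall x, F x -> B a x = 0) -> (forall x, F x -> B b x = 0) ->
  exists c, b = c *: a.
Proof.
move=> [M [Mf MF _]] a0 aF bF.
pose K := kermx (gramR R G *m M^T).
have KP (x : V) : (forall y, F y -> B x y = 0) -> (x <= K)%MS.
  move=> h; apply/sub_kermxP/rowP => i.
  rewrite [RHS]mxE -(h _ (MF i)) /ip mulmxA; move: (x *m _) => X.
  by rewrite !mxE; apply: eq_bigr => j _; rewrite !mxE.
have Kr : \rank K = 1%N.
  have gu : row_free (gramR R G)^T by rewrite row_free_unit unitmx_tr gram_unit.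
  rewrite mxrank_ker -mxrank_tr trmx_mul trmxK mxrankMfree // (eqP Mf).
  by rewrite subSnn.
have aK := KP _ aF; have bK := KP _ bF.
have /eqmxP/eqmx_sym Ka : (a == K)%MS.
  by rewrite -(geq_leqif (mxrank_leqif_eq aK)) Kr rank_rV a0.
by move: bK; rewrite Ka => /sub_rVP.
Qed.
End Span.
(** * Simple systems of the roots orthogonal to a point *)

Section Corner.
Context (R : realType) (n : nat) (G : 'M[rat]_n.+1).
Local Notation V := 'rV[R]_n.+1.
Local Notation B := (ip G).
Hypothesis hG : lorentzian R G.
Context (t : V) (ht : B t t < 0) (M : R).
Hypothesis rootM : forall a, lattice_roots G a -> B a a <= M.
Context (x0 : V).
Hypothesis hx0 : mirror_complement G t (lattice_roots G) x0.
Context (k : V).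
Hypothesis hk : Hbar G t k.

Local Notation root := (lattice_roots G).
Local Notation Phi := (roots_perp G k).

Lemma base_Hyp : Hyp G t x0.
Proof. by case/(mirror_complementP hG t x0 (fun a h => h)): hx0. Qed.

Lemma base_lt0 : B x0 x0 < 0.
Proof. by case: base_Hyp. Qed.

Lemma base_neq0 (a : V) : root a -> B a x0 != 0.
Proof. by case/(mirror_complementP hG t x0 (fun a h => h)): hx0 => _; exact. Qed.

Lemma root_sign (a : V) : root a -> B a x0 < 0 \/ B (- a) x0 < 0.
Proof.
move=> /base_neq0; rewrite neq_lt ipNl oppr_lt0 => /orP.
by case; [left|right].
Qed.

Lemma perpN (a : V) : Phi a -> Phi (- a).
Proof. by move=> [ar ak]; split; [exact: lattice_rootN|rewrite ipNl ak oppr0]. Qed.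

Lemma perp_reflection (a b : V) : Phi a -> Phi b -> Phi (reflection G a b).
Proof.
move=> [ar ak] [br bk]; split; first exact: reflection_root.
by rewrite /reflection !ipE ak bk mulr0 oppr0 addr0.
Qed.

(** A timelike vector is future or past, and a past one has positive products
    with future vectors. *)
Lemma timelike_future (y : V) : B y y < 0 -> B y k < 0 -> Hyp G t y.
Proof.
move=> yy yk; split=> //; rewrite ltNge; apply/negP => yt.
have [y0|yt0] := eqVneq (B y t) 0.
  by have := orth_timelike_ge0 hG ht y0; rewrite leNgt yy.
have Ny : Hyp G t (- y).
  by split; rewrite !ipE ?opprK // oppr_lt0 lt_neqAle eq_sym yt0.
by have := Hyp_ip_lt0 hG ht Ny hk; rewrite ipNl oppr_lt0 ltNge ltW.
Qed.

Definition pos_root : set V := [set a | Phi a /\ B a x0 < 0].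

Lemma perp_CS (a b : V) : Phi a -> Phi b -> B a b ^+ 2 <= B a a * B b b.
Proof.
move=> [_ ak] [/root_gt0 bb bk]; have [kk _] := hk.
exact: causal_orth_CS kk (Hbar_neq0 hk) ak bk bb.
Qed.

(** The positive roots not obtained from lower ones, in the form that makes
    the pairwise obtuseness of simple roots evident. *)
Definition base_root : set V :=
  [set a | pos_root a /\ forall b, pos_root b -> b <> a ->
     B a x0 <= B b x0 -> B a b <= 0].

Lemma base_root_pos (a : V) : base_root a -> pos_root a.
Proof. by case. Qed.

Lemma base_root_obtuse (a b : V) : base_root a -> base_root b -> a <> b ->
  B a b <= 0.
Proof.
move=> [ap ah] [bp bh] ab; have [le|/ltW le] := leP (B a x0) (B b x0).
  by apply: ah => //; exact/nesym.
by rewrite (ipC hG); exact: bh.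
Qed.

Lemma pos_root_finite (a : V) :
  finite_set [set b | pos_root b /\ B a x0 < B b x0].
Proof.
apply: sub_finite_set (lat_finite hG M (- B a x0) base_lt0) => b /= [[[br _] b0] ab].
split; [exact: root_lat br|exact: rootM|].
by rewrite ltr0_norm // lerN2 ltW.
Qed.

Definition lower (a : V) : set V := [set b | pos_root b /\ B a x0 < B b x0].

(** If b and its translate by the null vector z are both roots, then so are all
    b - j z; the last positive one and the negative of the next one add up to
    a multiple of z. *)
Lemma null_translation_cone (z b : V) : B z z = 0 -> B b z = 0 -> B z x0 < 0 ->
  pos_root b -> Phi (b + z) -> cone (lower (b + z)) z.
Proof.
move=> zz + z0; pose r := fun b c : V => B c x0 < B b x0.
move=> + bp; move: b bp.
apply: (@finite_wf_ind _ pos_root r).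
- by move=> a b c ab bc; exact: lt_trans bc ab.
- by move=> a; rewrite /r ltxx.
- by move=> a _; exact: pos_root_finite.
move=> b [bP b0] IH bz bzP; have bb := root_gt0 bP.1.
have zbP : Phi (z - b).
  have := perp_reflection bP bzP.
  rewrite /reflection ipDl (ipC hG z) bz addr0 divff ?gt_eqF // mulr1 scaler_nat mulr2n.
  by rewrite opprD addrACA subrr add0r.
have [zb0|zb0] := root_sign zbP.1.
  have zE : z = b + (z - b) by rewrite addrC subrK.
  rewrite [X in cone _ X]zE; apply: coneD; apply: cone_sub; split => //.
    by rewrite ipDl gtrDl.
  by rewrite !ipDl ipNl; lra.
have bmz : pos_root (b - z) by split; rewrite -opprB //; exact: perpN.
have := IH (b - z) bmz; rewrite /r subrK => IH'.
apply: cone_mono (IH' _ _ bP).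
- by move=> c [cp bc]; split => //; rewrite ipDl; move: bc; lra.
- by rewrite ipDl ipNl; lra.
- by rewrite ipDl ipNl bz zz subr0.
Qed.

(** By Cauchy-Schwarz the two Cartan integers c and d of a and b have product at
    most 4. So one of them is 1, and then a - b is a root, or both are 2, and
    then a - b is null. *)
Lemma pos_root_lower (a b : V) : pos_root a -> pos_root b -> b <> a ->
  B a x0 <= B b x0 -> 0 < B a b -> cone (lower a) a.
Proof.
move=> [aP a0] [bP b0] ba le ab.
have aa := root_gt0 aP.1; have bb := root_gt0 bP.1.
have [c cE] := root_integral hG bP.1 (root_lat aP.1).
have [d dE] := root_integral hG aP.1 (root_lat bP.1).
have c0 : 0 < c by rewrite -(ltr_int R) -cE mulr_gt0 // divr_gt0.
have d0 : 0 < d by rewrite -(ltr_int R) -dE mulr_gt0 // divr_gt0 // (ipC hG).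
have cd : c * d <= 4.
  rewrite -(ler_int R) intrM -cE -dE (ipC hG b a).
  have -> : 2 * (B a b / B b b) * (2 * (B a b / B a a)) =
     4 * (B a b ^+ 2 / (B a a * B b b)).
    by field; rewrite !gt_eqF.
  have := perp_CS aP bP => h.
  by rewrite ger_pMr // ler_pdivrMr ?mul1r // mulr_gt0.
have diff : Phi (a - b) -> cone (lower a) a.
  move=> abP; have ab0 : B (a - b) x0 < 0.
    by have := base_neq0 abP.1; rewrite ipDl ipNl neq_lt; lra.
  have -> : a = b + (a - b) by rewrite addrC subrK.
  apply: coneD; apply: cone_sub; rewrite addrC subrK; split => //.
    by move: ab0; rewrite ipDl ipNl; lra.
  by rewrite ipDl ipNl; lra.
have : c = 1 \/ d = 1 \/ (c = 2 /\ d = 2) by nia.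
case=> [c1|[d1|[c2 d2]]].
- apply: diff; have := perp_reflection bP aP.
  by rewrite /reflection cE c1 scale1r.
- apply: diff; have := perp_reflection aP bP.
  by rewrite /reflection dE d1 scale1r => /perpN; rewrite opprB.
have abb : B a b = B b b.
  have : B a b / B b b = 1 by move: cE; rewrite c2; lra.
  by move=> h; rewrite -[LHS](divfK (lt0r_neq0 bb)) h mul1r.
have aba : B a b = B a a.
  have : B b a / B a a = 1 by move: dE; rewrite d2; lra.
  by rewrite (ipC hG b a) => h; rewrite -[LHS](divfK (lt0r_neq0 aa)) h mul1r.
pose z := a - b.
have zz : B z z = 0 by rewrite /z !ipE (ipC hG b a); lra.
have bz : B b z = 0 by rewrite /z !ipE (ipC hG b a); lra.
have z0 : B z x0 < 0.
  rewrite lt_neqAle /z !ipE; apply/andP; split; last by lra.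
  apply/eqP => h; have : z != 0 by rewrite subr_eq0; apply/eqP => /esym.
  move/(orth_timelike_gt0 hG base_lt0); rewrite zz ltxx => H.
  by apply: notF; apply: H; rewrite !ipE.
have E : a = b + z by rewrite addrC subrK.
have := null_translation_cone zz bz z0 (conj bP b0); rewrite -E => /(_ aP) zc.
rewrite [X in cone _ X]E; apply: coneD => //; apply: cone_sub; split => //.
by rewrite E ipDl; lra.
Qed.

(** Induction on the height - B a x0, below which there are only finitely many
    positive roots. *)
Lemma pos_root_cone (a : V) : pos_root a -> cone base_root a.
Proof.
apply: (@finite_wf_ind _ pos_root (fun b c => B c x0 < B b x0)).
- by move=> b c d bc cd; exact: lt_trans cd bc.
- by move=> b; rewrite ltxx.
- by move=> b _; exact: pos_root_finite.
move=> {}a ap IH; have [aS|aS] := pselect (base_root a); first exact: cone_sub.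
apply: cone_idem; apply: (@cone_mono _ _ (lower a)).
  by move=> b [bp ab]; exact: IH.
have [b [bp ba le ab]] : exists b, [/\ pos_root b, b <> a, B a x0 <= B b x0 & 0 < B a b].
  apply: contrapT => h; apply: aS; split => // b bp ba le.
  by rewrite leNgt; apply/negP => ab; apply: h; exists b.
exact: pos_root_lower bp ba le ab.
Qed.

Lemma cone_ip_le0 (A : set V) (v y : V) : cone A v ->
  (forall a, A a -> B a y <= 0) -> B v y <= 0.
Proof.
move=> [s sA ->] Ay; rewrite ip_suml big_seq; apply: sumr_le0 => p /sA[p0 pA].
by rewrite ipZl mulr_ge0_le0 // Ay.
Qed.

(** Terms of one sign cannot cancel. *)
Lemma cone_ip_eq0 (A : set V) (v y : V) : cone A v ->
  (forall a, A a -> B a y <= 0) -> B v y = 0 -> cone [set a | A a /\ B a y = 0] v.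
Proof.
move=> [s sA ->] Ay; elim: s sA => [|p s IH] sA.
  by rewrite big_nil => _; exists [::] => //; rewrite big_nil.
have [|p0 pA] := sA p; first by rewrite inE eqxx.
have sA' q : q \in s -> 0 <= q.1 /\ A q.2 by move=> qs; apply: sA; rewrite inE qs orbT.
rewrite big_cons ipDl ipZl => e.
have h1 : p.1 * B p.2 y <= 0 by rewrite mulr_ge0_le0 // Ay.
have h2 : B (\sum_(q <- s) q.1 *: q.2) y <= 0.
  by apply: (@cone_ip_le0 A) => //; exists s.
apply: coneD; last by apply: IH => //; lra.
have [->|p10] := eqVneq p.1 0.
  by rewrite scale0r; exists [::] => //; rewrite big_nil.
apply: coneZ => //; apply: cone_sub; split => //.
have /eqP : p.1 * B p.2 y = 0 by lra.
by rewrite mulf_eq0 (negPf p10) => /eqP.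
Qed.

Lemma cone_ray (a v : V) : cone [set a] v -> exists2 c, 0 <= c & v = c *: a.
Proof.
move=> [s sA ->]; elim: s sA => [|p s IH] sA.
  by exists 0 => //; rewrite big_nil scale0r.
have [|p0 pA] := sA p; first by rewrite inE eqxx.
have [|c c0 e] := IH; first by move=> q qs; apply: sA; rewrite inE qs orbT.
rewrite big_cons e pA -scalerDl; exists (p.1 + c) => //; exact: addr_ge0.
Qed.

Lemma pos_root_ray (a b : V) : pos_root a -> pos_root b -> cone [set a] b -> b = a.
Proof.
move=> [[ar _] _] [[br _] _] /cone_ray[c c0 e].
apply: (root_parallel br ar _ e); rewrite lt_neqAle c0 andbT eq_sym.
by apply: contraTneq (root_gt0 br) => c00; rewrite e c00 scale0r ip0l ltxx.
Qed.

(** The midpoint of the base point and its reflection is a point of the wall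
    of a that lies on no other mirror through k. *)
Definition wall_point (a : V) : V := x0 + reflection G a x0.

(** By obtuseness a base root other than a is also negative at the mirror image
    of x0. A positive root that vanishes at the midpoint is a combination of
    base roots that vanish there, hence a multiple of a. *)
Lemma wall_pointP (a : V) : base_root a ->
  [/\ Hyp G t (wall_point a), B a (wall_point a) = 0
    & forall b, pos_root b -> b <> a -> B b (wall_point a) < 0].
Proof.
move=> aS; have [aP a0] := base_root_pos aS; have aa := root_gt0 aP.1.
have aN : B a a != 0 by rewrite gt_eqF.
have aw : B a (wall_point a) = 0.
  by rewrite /wall_point /reflection !ipE (ipC hG x0 a); field.
have bw b : base_root b -> b <> a -> B b (wall_point a) < 0.
  move=> bS ba; have [_ b0] := base_root_pos bS.
  have := base_root_obtuse bS aS ba => ab.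
  rewrite /wall_point /reflection !ipE (ipC hG x0 a).
  have : 0 <= B a x0 / B a a * B b a.
    by rewrite mulr_le0 // pmulr_lle0 ?invr_gt0 // ltW.
  by lra.
split=> //.
  pose c := B a x0 / B a a.
  have w2 : B (wall_point a) (wall_point a) = 4 * B x0 x0 - 4 * (B a x0 ^+ 2 / B a a).
    by rewrite /wall_point /reflection !ipE (ipC hG x0 a); field.
  apply: timelike_future.
    have := sqr_ge0 (B a x0); have := base_lt0; rewrite w2 => h1 h2.
    have : 0 <= B a x0 ^+ 2 / B a a by rewrite divr_ge0 // ltW.
    by lra.
  have := Hyp_ip_lt0 hG ht base_Hyp hk; case: aP => _ ak.
  by rewrite /wall_point /reflection !ipE ak; lra.
move=> b bp ba; have bc := pos_root_cone bp.
have wle c : base_root c -> B c (wall_point a) <= 0.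
  move=> cS; have [->|/eqP ca] := eqVneq c a; first by rewrite aw.
  exact/ltW/bw.
rewrite lt_neqAle (cone_ip_le0 bc wle) andbT; apply/eqP => e.
apply: ba; apply: pos_root_ray bp _ => //.
apply: cone_mono (cone_ip_eq0 bc wle e) => c /= [cS c0].
apply: contrapT => ca; have := bw c cS ca; by rewrite c0 ltxx.
Qed.

End Corner.
(** * Facets and simple roots *)

Section Facets.
Context (R : realType) (n : nat) (G : 'M[rat]_n.+1).
Local Notation V := 'rV[R]_n.+1.
Local Notation B := (ip G).
Hypothesis hG : lorentzian R G.
Context (t : V) (ht : B t t < 0) (M : R).
Hypothesis rootM : forall a, lattice_roots G a -> B a a <= M.
Context (x0 : V).
Hypothesis hx0 : mirror_complement G t (lattice_roots G) x0.
Local Notation root := (lattice_roots G).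

Lemma signed_chamber_interior (Phi : set V) (a y : V) :
  Phi a -> B a x0 < 0 -> 0 < B a a -> interior (signed_chamber G t Phi x0) y ->
  B a y < 0.
Proof.
move=> Pa a0 aa /(nbhs_line a)[e e0 [_ /(_ a Pa a0)]].
by rewrite ipDr ipZr; have := mulr_gt0 e0 aa; lra.
Qed.

Lemma base_interior (Phi : set V) : Phi `<=` root ->
  interior (signed_chamber G t Phi x0) x0.
Proof.
move=> Pr; have := near_Hyp hG (base_Hyp hG hx0).
have := near_mirrors hG (base_lt0 hG hx0) rootM; apply: filterS2 => z za hz.
by split=> [|a /Pr ar a0]; [exact: Hyp_Hbar|exact/ltW/za].
Qed.

Lemma signed_chamberZ (Phi : set V) c y : 0 < c ->
  signed_chamber G t Phi x0 y -> signed_chamber G t Phi x0 (c *: y).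
Proof.
move=> c0 [hy ya]; split=> [|a Pa a0]; first exact: HbarZ.
by rewrite ipZr pmulr_rle0 // ya.
Qed.

Lemma signed_chamberD (Phi : set V) y z : signed_chamber G t Phi x0 y ->
  signed_chamber G t Phi x0 z -> signed_chamber G t Phi x0 (y + z).
Proof.
move=> [hy ya] [hz za]; split=> [|a Pa a0]; first exact: HbarD.
by rewrite ipDr -[0]addr0 lerD ?ya ?za.
Qed.

Lemma cone_term (A F : set V) (v : V) : cone A v -> v != 0 ->
  (forall x a, F x -> A a -> B a x <= 0) -> (forall x, F x -> B v x = 0) ->
  exists2 a, A a & forall x, F x -> B a x = 0.
Proof.
move=> [s sA ->] v0 FA Fv.
have [p ps p0] : exists2 p, p \in s & p.1 != 0.
  apply/hasP; apply: contraNT v0 => /hasPn h; rewrite big_seq big1 // => p /h.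
  by rewrite negbK => /eqP ->; rewrite scale0r.
have [p1 pA] := sA p ps; exists p.2 => // x Fx.
have := Fv x Fx; rewrite ip_suml big_seq => /eqP.
rewrite -oppr_eq0 -sumrN psumr_eq0 => [/allP/(_ p ps)|q /sA[q0 qA]].
  by rewrite ps /= oppr_eq0 ipZl mulf_eq0 (negPf p0) => /eqP.
by rewrite oppr_ge0 ipZl mulr_ge0_le0 // FA.
Qed.

Section AtPoint.
Context (k : V).
Hypothesis hk : Hbar G t k.
Local Notation Phi := (roots_perp G k).
Local Notation pos_root := (pos_root G x0 k).
Local Notation base_root := (base_root G x0 k).

(** The terms of a as a combination of base roots vanish on F as well, so they
    are parallel to a. *)
Lemma facet_base_root (F : set V) (a : V) : span_rank F n -> pos_root a ->
  (forall x b, F x -> pos_root b -> B b x <= 0) ->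
  (forall x, F x -> B a x = 0) -> base_root a.
Proof.
move=> Fn ap Fp Fa; have aP := ap.1.
have ac := pos_root_cone hG ht rootM hx0 hk ap.
have [b bS bF] : exists2 b, base_root b & forall x, F x -> B b x = 0.
  apply: (cone_term ac) => //; first exact: root_neq0 aP.1.
  by move=> x b Fx [bp _]; exact: Fp.
have bp := base_root_pos bS.
have [c e] := orth_span_parallel hG Fn (root_neq0 aP.1) Fa bF.
have c0 : 0 < c.
  have := bp.2; rewrite e ipZl nmulr_llt0 //; exact: ap.2.
by rewrite -(root_parallel bp.1.1 aP.1 c0 e).
Qed.

(** Near the wall point, which is on no other mirror through k, the wall
    fills the hyperplane orthogonal to a. *)
Lemma base_root_facet (a : V) : base_root a ->
  facet (signed_chamber G t Phi x0)
        [set x | signed_chamber G t Phi x0 x /\ B a x = 0].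
Proof.
move=> aS; have ap := base_root_pos aS; have [aP a0] := ap.
have [hp ap0 bp] := wall_pointP hG ht rootM hx0 hk aS.
set p := wall_point G x0 a in hp ap0 bp.
split.
  split.
  - by move=> x [].
  - move=> c x c0 [Cx ax]; split; first exact: signed_chamberZ.
    by rewrite ipZr ax mulr0.
  - move=> x y [Cx ax] [Cy ay]; split; first exact: signed_chamberD.
    by rewrite ipDr ax ay addr0.
  - move=> x y Cx Cy [_]; rewrite ipDr => e.
    have h1 := Cx.2 _ aP a0; have h2 := Cy.2 _ aP a0.
    by split; split => //; lra.
have pF z : B a z = 0 ->
    exists2 e : R, 0 < e & signed_chamber G t Phi x0 (p + e *: z).
  move=> az; have := near_Hyp hG hp.
  have := near_mirrors hG hp.1 rootM => n1 n2.
  have [e e0 [ez hz]] := nbhs_line z (filterI n1 n2).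
  exists e => //; split; first exact: Hyp_Hbar.
  move=> b bP b0; have [->|/eqP ba] := eqVneq b a.
    by rewrite ipDr ipZr ap0 az mulr0 addr0.
  by apply/ltW/ez; [exact: bP.1|exact: bp].
have pD : signed_chamber G t Phi x0 p.
  by have [|e _] := pF 0; rewrite ?ip0r // scaler0 addr0.
set F := [set x | _].
have [d Fd] := span_rank_exists F.
have rn := rank_orthmx hG (root_neq0 aP.1).
suff dn : d = n by move: Fd; rewrite dn.
apply/eqP; rewrite eqn_leq; apply/andP; split.
  rewrite -[leqRHS]rn; apply: (span_rank_le Fd) => x [_ ax]; apply/orthmxP.
  by rewrite (ipC hG).
rewrite -[leqLHS]rn; apply: (span_rank_ge Fd) => d' S FS; apply/row_subP => i.
  have az : B a (row i (orthmx G a)) = 0.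
    by rewrite (ipC hG); apply/orthmxP; exact: row_sub.
  have [e e0 pe] := pF _ az.
  have h1 := FS p (conj pD ap0).
  have h2 : F (p + e *: row i (orthmx G a)).
    by split=> //; rewrite ipDr ipZr ap0 az mulr0 addr0.
  move/FS: h2 => h2.
  have : (e^-1 *: (p + e *: row i (orthmx G a) - p) <= S)%MS.
    by rewrite scalemx_sub // addmx_sub // eqmx_opp.
  by rewrite addrC addKr scalerA mulVf ?scale1r // gt_eqF.
Qed.

Lemma simple_root_base :
  simple_root G Phi (signed_chamber G t Phi x0) = base_root.
Proof.
have Pr : Phi `<=` root by move=> a [].
apply/seteqP; split=> a.
  move=> [aP [F [[FD _ _ _] Fn] Fa] ai].
  have a0 := ai x0 (base_interior Pr).
  apply: (facet_base_root Fn) => // x b Fx [bP b0].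
  exact: (FD _ Fx).2.
move=> aS; have [aP a0] := base_root_pos aS; split => //.
  exists [set x | signed_chamber G t Phi x0 x /\ B a x = 0].
    exact: base_root_facet.
  by move=> x [].
move=> x; apply: signed_chamber_interior => //; exact: root_gt0 aP.1.
Qed.

(** The whole chamber lies in the chamber at k, so the positive roots at k are
    nonpositive on its facets. *)
Lemma simple_root_base_root (a : V) :
  simple_root G root (signed_chamber G t root x0) a -> B a k = 0 -> base_root a.
Proof.
move=> [ar [F [[FD _ _ _] Fn] Fa] ai] ak.
have a0 := ai x0 (base_interior (fun a h => h)).
apply: (facet_base_root Fn) => // x b Fx [[br bk] b0].
exact: (FD _ Fx).2.
Qed.

(** A chamber at k that contains the whole chamber contains x0, so it is the one
    whose signs are those of x0. *)
Lemma simple_root_at_base :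
  simple_root_at G t (signed_chamber G t root x0) k = base_root.
Proof.
have Pr : Phi `<=` root by move=> a [].
have PN a : Phi a -> Phi (- a) by exact: perpN.
have Cx0 : signed_chamber G t root x0 x0.
  by split=> [|a _ /ltW //]; exact/Hyp_Hbar/(base_Hyp hG hx0).
have mx0 : mirror_complement G t Phi x0.
  apply/(mirror_complementP hG _ _ Pr); split; first exact: base_Hyp hx0.
  by move=> a /Pr; exact: (base_neq0 hG hx0).
rewrite -simple_root_base; apply/seteqP; split=> a; last first.
  move=> aS; exists (signed_chamber G t Phi x0); split=> //; last first.
    by move=> x [hx xa]; split=> // b /Pr; exact: xa.
  by exists x0; rewrite ?chamberE.
move=> [D [[x mx ->] CD]]; rewrite chamberE //.
suff -> : signed_chamber G t Phi x = signed_chamber G t Phi x0 by [].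
move: CD; rewrite chamberE // => CD.
have [_ x0D] := CD _ Cx0.
have /(mirror_complementP hG _ _ Pr)[_ xN] := mx.
have sg b : Phi b -> (B b x < 0) = (B b x0 < 0).
  move=> bP; have b0 := base_neq0 hG hx0 (Pr _ bP).
  apply/idP/idP => h; first by rewrite lt_neqAle b0 x0D.
  rewrite ltNge; apply/negP => h'.
  have := x0D _ (PN _ bP); rewrite !ipNl oppr_lt0 oppr_le0 leNgt h.
  by rewrite lt_neqAle eq_sym xN // h' => /(_ isT).
by apply/seteqP; split=> y [hy ya]; split => // b bP;
   have := ya b bP; rewrite sg.
Qed.

End AtPoint.
End Facets.
(** * Pell's equation *)

Section Pell.

Lemma nonsquare_ratio (m x y : nat) : (forall s, (s * s)%N <> m) -> (0 < y)%N ->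
  (x * x)%N <> (m * (y * y))%N.
Proof.
move=> ns y0 e; have : (y ^ 2 %| x ^ 2)%N by rewrite -!mulnn e dvdn_mull.
rewrite dvdn_pexp2r // => /dvdnP[q xE]; apply: (ns q).
apply/eqP; rewrite -(eqn_pmul2r (_ : 0 < y * y)%N) ?muln_gt0 ?y0 //.
by apply/eqP; rewrite -e xE; lia.
Qed.

Context (R : realType).

(** Two of the fractional parts of 0, a, ..., Q a lie in the same one of Q
    intervals of length 1 / Q. *)
Lemma dirichlet (a : R) (Q : nat) : 0 <= a -> (0 < Q)%N ->
  exists x y : nat, [/\ (0 < y)%N, (y <= Q)%N & `|x%:R - y%:R * a| < Q%:R^-1].
Proof.
move=> a0 Q0; have QR : 0 < Q%:R :> R by rewrite ltr0n.
pose fr (y : nat) : R := y%:R * a - (Num.truncn (y%:R * a))%:R.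
have fr0 y : 0 <= fr y < 1.
  have := truncn_itv (mulr_ge0 (ler0n R y) a0); rewrite /fr -natr1; lra.
pose box (y : 'I_Q.+1) : 'I_Q := Ordinal (ltn_pmod (Num.truncn (fr y * Q%:R)) Q0).
have boxE (y : 'I_Q.+1) : box y = Num.truncn (fr y * Q%:R) :> nat.
  rewrite /= modn_small //; have /andP[h1 h2] := fr0 y.
  rewrite -(ltr_nat R); apply: le_lt_trans (_ : fr y * Q%:R < _).
    by have /andP[] := truncn_itv (mulr_ge0 h1 (ltW QR)).
  by rewrite gtr_pMl.
have : ~~ injectiveb box.
  apply/negP => /injectiveP /leq_card; by rewrite !card_ord ltnn.
move/injectivePn => [y1 [y2 y12 e]].
wlog lt12 : y1 y2 y12 e / (y1 < y2)%N.
  move=> H; have := y12; rewrite -val_eqE neq_ltn => /orP[|] h; first exact: H h.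
  by apply: H h => //; rewrite eq_sym.
exists (Num.truncn (y2%:R * a) - Num.truncn (y1%:R * a))%N, (y2 - y1)%N.
split; [by rewrite subn_gt0|by rewrite (leq_trans (leq_subr _ _)) // -ltnS|].
have le12 : (Num.truncn (y1%:R * a) <= Num.truncn (y2%:R * a))%N.
  by rewrite le_truncn // ler_wpM2r // ler_nat ltnW.
rewrite !natrB // 1?ltnW //.
have -> : (Num.truncn (y2%:R * a))%:R - (Num.truncn (y1%:R * a))%:R -
   (y2%:R - y1%:R) * a = fr y1 - fr y2 :> R by rewrite /fr; ring.
have /andP[p1 _] := fr0 y1; have /andP[p2 _] := fr0 y2.
have := truncn_itv (mulr_ge0 p1 (ltW QR)).
have := truncn_itv (mulr_ge0 p2 (ltW QR)).
rewrite -!boxE e -!natr1 => /andP[q1 q2] /andP[q3 q4].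
rewrite -(ltr_pM2r QR) mulVf ?gt_eqF // -[X in _ * X](gtr0_norm QR) -normrM.
by rewrite ltr_norml mulrBl; apply/andP; split; lra.
Qed.

Lemma shift_bound (w : int) (K : nat) : `|w| <= K%:Z ->
  (absz (w + K%:Z)%R < (2 * K).+1)%N.
Proof. by lia. Qed.

Lemma shift_inj (w w' : int) (K : nat) : `|w| <= K%:Z -> `|w'| <= K%:Z ->
  absz (w + K%:Z)%R = absz (w' + K%:Z)%R -> w = w'.
Proof. by lia. Qed.

Lemma modn_quotient (w : int) (x y : nat) :
  (x %% absz w = y %% absz w)%N -> exists q : int, y%:Z = x%:Z + w * q.
Proof.
move=> e; pose q := (y %/ absz w)%N%:Z - (x %/ absz w)%N%:Z.
have yE : y%:Z = x%:Z + (absz w)%:Z * q.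
  rewrite /q {1}(divn_eq y (absz w)) {1}(divn_eq x (absz w)) e !PoszD !PoszM.
  ring.
have [w0|w0] := ltP w 0; last by exists q; rewrite yE gez0_abs.
by exists (- q); rewrite yE ltz0_abs // mulrN mulNr.
Qed.

(** Dirichlet's approximations of the square root of m give infinitely many
    pairs with bounded norm x ^ 2 - m y ^ 2. Among them are two of the same norm
    w that are congruent modulo w, and their quotient is a unit. *)
Lemma pell (m : nat) : (forall s, (s * s)%N <> m) ->
  exists x y : nat, (0 < y)%N /\ (x * x = m * (y * y) + 1)%N.
Proof.
move=> ns; have m0 : (0 < m)%N by rewrite lt0n; apply/eqP => e; exact: (ns 0%N).
pose a : R := Num.sqrt m%:R.
have a2 : a * a = m%:R by rewrite -expr2 sqr_sqrtr.
have a0 : 0 <= a by exact: sqrtr_ge0.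
pose d (p : nat * nat) : R := `|p.1%:R - p.2%:R * a|.
have d0 p : (0 < p.2)%N -> 0 < d p.
  move=> p0; rewrite normr_gt0 subr_eq0; apply/eqP => e.
  apply: (nonsquare_ratio ns p0 (x := p.1)); apply/eqP.
  by rewrite -(eqr_nat R) !natrM e -a2; apply/eqP; ring.
(* K bounds the norm of (x, y) when |x - y a| < 1 / Q and y <= Q. *)
pose K := Num.truncn (2 * a + 2).
pose z (p : nat * nat) : int := (p.1 * p.1)%N%:Z - (m * (p.2 * p.2))%N%:Z.
pose good p := (0 < p.2)%N /\ `|z p| <= K%:Z.
(* Approximations get strictly better when 1 / Q is below the last distance. *)
have step p : (0 < p.2)%N -> exists q, good q /\ d q < d p.
  move=> p0; have dp := d0 p p0.
  pose Q := (Num.truncn (d p)^-1).+1.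
  have QR : 0 < Q%:R :> R by rewrite ltr0n.
  have Qd : Q%:R^-1 < d p.
    by rewrite invf_plt ?posrE //; exact: truncnS_gt.
  have [x [y [y0 yQ xy]]] := dirichlet a0 (isT : 0 < Q)%N.
  exists (x, y); split; last exact: lt_trans xy Qd.
  split=> //; rewrite -(ler_int R) intr_norm /z intrB /=.
  have Q1 : 1 <= Q%:R :> R by rewrite ler1n.
  have yQR : y%:R <= Q%:R :> R by rewrite ler_nat.
  have e : `|x%:R - y%:R * a| * Q%:R <= 1 by rewrite -ler_pdivlMr // mul1r ltW.
  have zE : (x * x)%N%:~R - (m * (y * y))%N%:~R =
     (x%:R - y%:R * a) * (x%:R + y%:R * a) :> R.
    by rewrite -!pmulrn !natrM -a2; ring.
  rewrite zE normrM [X in _ * X]ger0_norm; last first.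
    by rewrite addr_ge0 ?mulr_ge0.
  have le1 : `|x%:R - y%:R * a| * (x%:R + y%:R * a) <= 2 * a + 1.
    have h1 : x%:R <= y%:R * a + 1.
      have := ler_norm (x%:R - y%:R * a).
      have : `|x%:R - y%:R * a| <= 1.
        by apply: le_trans e; rewrite ler_peMr.
      by lra.
    have h2 : x%:R + y%:R * a <= Q%:R * (2 * a + 1).
      have : y%:R * a <= Q%:R * a by rewrite ler_wpM2r.
      by lra.
    apply: (le_trans (ler_wpM2l (normr_ge0 _) h2)).
    by rewrite mulrA ler_piMl //; lra.
  apply: (le_trans le1).
  by have := truncnS_gt (2 * a + 2); rewrite -/K -natr1 -pmulrn; lra.
have [f fP] := choice (fun p : {p : nat * nat | (0 < p.2)%N} =>
  step (sval p) (svalP p)).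
have gp p (h : good p) : (0 < p.2)%N by case: h.
pose nxt (p : {p | good p}) : {p | good p} :=
  exist _ (f (exist _ (sval p) (gp _ (svalP p))))
          (fP (exist _ (sval p) (gp _ (svalP p)))).1.
have [p0 [p0g _]] := step (0%N, 1%N) isT.
pose g i := sval (iter i nxt (exist _ p0 p0g)).
have gg i : good (g i) by exact: svalP.
have gS i : d (g i.+1) < d (g i).
  by rewrite /g iterS; exact: (fP (exist _ _ _)).2.
have gd i j : (i < j)%N -> d (g j) < d (g i).
  elim: j => // j IH; rewrite ltnS leq_eqVlt => /orP[/eqP->//|/IH].
  exact: lt_trans.
pose T : finType := ('I_(2 * K).+1 * 'I_K.+1 * 'I_K.+1)%type.
pose cl (i : 'I_(#|T|).+1) : T :=
  (inord (absz (z (g i) + K%:Z)), inord ((g i).1 %% absz (z (g i))),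
   inord ((g i).2 %% absz (z (g i)))).
have : ~~ injectiveb cl.
  apply/negP => /injectiveP /leq_card; by rewrite card_ord ltnn.
move/injectivePn => [i [j ij e]].
have zK i' : `|z (g i')| <= K%:Z by case: (gg i').
have z0 i' : z (g i') != 0.
  rewrite /z subr_eq0; apply/eqP => -[h].
  by apply: (nonsquare_ratio ns (gp _ (gg i')) h).
have dij : d (g i) != d (g j).
  have := ij; rewrite -val_eqE neq_ltn => /orP[/gd|/gd] h.
    by rewrite gt_eqF.
  by rewrite lt_eqF.
move: e => [e1 e2 e3].
have zi := zK i; have zj := zK j.
have zE : z (g i) = z (g j).
  by move/(congr1 val): e1; rewrite /= !inordK ?shift_bound //; exact: shift_inj.
have modK i' (x : nat) : (x %% absz (z (g i')) < K.+1)%N.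
  rewrite ltnS ltnW // (leq_trans (ltn_pmod _ _)) //.
    by rewrite absz_gt0.
  by have := zK i'; lia.
move/(congr1 val): e2; rewrite /= !inordK // -zE => e2.
move/(congr1 val): e3; rewrite /= !inordK // -zE => e3.
have zi0 := z0 i.
have Ez1 : z (g i) = (g i).1%:Z * (g i).1%:Z - m%:Z * ((g i).2%:Z * (g i).2%:Z).
  by rewrite /z !PoszM.
have Ez2 : z (g i) = (g j).1%:Z * (g j).1%:Z - m%:Z * ((g j).2%:Z * (g j).2%:Z).
  by rewrite zE /z !PoszM.
have [q1 q1E] := modn_quotient e2; have [q2 q2E] := modn_quotient e3.
move: (g i) (g j) (gp _ (gg i)) (gp _ (gg j)) dij zi0 Ez1 Ez2 q1E q2E.
clear; move=> [x1 y1] [x2 y2] /=.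
move: (z _) => w y10 y20 dij w0 E1 E2 q1E q2E.
(* (X, Y) is the quotient of (x2, y2) by (x1, y1). *)
pose X : int := 1 + x1%:Z * q1 - m%:Z * y1%:Z * q2.
pose Y : int := x1%:Z * q2 - y1%:Z * q1.
have XY : X * X - m%:Z * (Y * Y) = 1.
  rewrite q1E q2E in E2.
  pose S := x1%:Z * q1 - m%:Z * y1%:Z * q2.
  pose T := q1 * q1 - m%:Z * (q2 * q2).
  have ST : 2 * S + w * T = 0.
    apply: (mulfI w0); rewrite mulr0.
    transitivity ((x1%:Z + w * q1) * (x1%:Z + w * q1) -
      m%:Z * ((y1%:Z + w * q2) * (y1%:Z + w * q2)) -
      (x1%:Z * x1%:Z - m%:Z * (y1%:Z * y1%:Z))); first by rewrite /S /T; ring.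
    by rewrite -E1 -E2 subrr.
  transitivity (1 + (2 * S +
    (x1%:Z * x1%:Z - m%:Z * (y1%:Z * y1%:Z)) * T)); first by rewrite /X /Y /S /T; ring.
  by rewrite -E1 ST addr0.
have Y0 : Y != 0.
  apply: contraNneq dij => Y0.
  have e : x1%:Z * y2%:Z = y1%:Z * x2%:Z.
    apply/eqP; rewrite -subr_eq0; apply/eqP.
    transitivity (w * Y); last by rewrite Y0 mulr0.
    by rewrite q1E q2E /Y; ring.
  have e2 : (y1%:Z * y1%:Z) * w = (y2%:Z * y2%:Z) * w.
    rewrite {1}E2 {1}E1.
    transitivity ((y1%:Z * x2%:Z) * (y1%:Z * x2%:Z) -
      m%:Z * (y1%:Z * y1%:Z * (y2%:Z * y2%:Z))); first by ring.
    by rewrite -e; ring.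
  have y12 : y1 = y2.
    move/(mulIf w0): e2 => /eqP; rewrite -!PoszM eqz_nat !mulnn eqn_exp2r //.
    by move/eqP.
  have x12 : x1 = x2.
    move: e; rewrite -y12 mulrC => /(mulfI _) h; have := h _; rewrite eqz_nat -lt0n => /(_ y10).
    by case.
  by rewrite y12 x12.
exists (absz X), (absz Y); split; first by rewrite absz_gt0.
have : `|X| * `|X| = m%:Z * (`|Y| * `|Y|) + 1 :> int.
  by rewrite -!normrM !ger0_norm -?expr2 ?sqr_ge0 // !expr2 -XY; ring.
lia.
Qed.
End Pell.
(** * Extensions of normed Dynkin diagrams *)

Section Dynkin.
Context (R : realType) (T : finType).

Lemma sum_option (F : option T -> R) :
  \sum_o F o = F None + \sum_i F (Some i).
Proof.
rewrite (bigD1 None) //=; congr (_ + _).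
rewrite (reindex_omap Some id) //=; last by case.
by apply: eq_bigl => i; rewrite eqxx.
Qed.

Lemma dynkin_ip_le0 (D : normed_dynkin R T) i j : i != j -> dynkin_ip D i j <= 0.
Proof.
move=> ij; rewrite /dynkin_ip (negPf ij).
have := node_norm_gt0 D i; have := node_norm_gt0 D j => h1 h2.
have : 0 < Num.max (node_norm D i) (node_norm D j) by rewrite lt_max h2.
by case: (D i j) => *; lra.
Qed.

Lemma dynkin_ipC (D : normed_dynkin R T) i j : dynkin_ip D i j = dynkin_ip D j i.
Proof.
rewrite /dynkin_ip eq_sym; case: eqP => [->//|_].
have := node_norm_bond D i j; rewrite (bond_of_sym D i j) maxC.
by case: (D i j) => [||o|o||o] //= ->.
Qed.

Definition bond_ip (b : bond) (x y : R) : R :=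
  match b with
  | NoBond => 0
  | Single => - (x / 2)
  | Heavy => - x
  | Double _ | Triple _ | HeavyArrow _ => - (Num.max x y / 2)
  end.

(** The bonds are exactly the crystallographic pairs of nonpositive inner
    product: 4 cos ^ 2 is at most 4 and is a product of two integers. *)
Lemma bond_exists (x y c : R) (p q : nat) : 0 < x -> 0 < y ->
  2 * c = - (p%:R * y) -> 2 * c = - (q%:R * x) -> (p * q <= 4)%N ->
  exists2 b, bond_norms b x y & bond_ip b x y = c.
Proof.
move=> x0 y0 cp cq pq.
have [p0|p0] := posnP p; first by exists NoBond => //=; rewrite p0 in cp; lra.
have [q0|q0] := posnP q; first by exists NoBond => //=; rewrite q0 in cq; lra.
have p4 : (p <= 4)%N by nia.
have q4 : (q <= 4)%N by nia.
have mx : x <= y -> Num.max x y = y by exact: max_r.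
have mn : y <= x -> Num.max x y = x by exact: max_l.
have tac : (p = 1 /\ q = 1 \/ p = 1 /\ q = 2 \/ p = 2 /\ q = 1 \/
  p = 1 /\ q = 3 \/ p = 3 /\ q = 1 \/ p = 1 /\ q = 4 \/ p = 4 /\ q = 1 \/
  p = 2 /\ q = 2)%N by nia.
move: tac; case=> [[ep eq]|]; last case=> [[ep eq]|]; last case=> [[ep eq]|];
  last case=> [[ep eq]|]; last case=> [[ep eq]|]; last case=> [[ep eq]|];
  last case=> [[ep eq]|[ep eq]]; rewrite {}ep {}eq in cp cq.
- by exists Single => /=; lra.
- by exists (Double false) => /=; [lra|rewrite mx; lra].
- by exists (Double true) => /=; [lra|rewrite mn; lra].
- by exists (Triple false) => /=; [lra|rewrite mx; lra].
- by exists (Triple true) => /=; [lra|rewrite mn; lra].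
- by exists (HeavyArrow false) => /=; [lra|rewrite mx; lra].
- by exists (HeavyArrow true) => /=; [lra|rewrite mn; lra].
- by exists Heavy => /=; lra.
Qed.

Lemma bond_rev_norms (b : bond) (x y : R) :
  bond_norms b x y -> bond_norms (bond_rev b) y x.
Proof. by case: b => [||[]|[]||[]] //=. Qed.

Lemma extension_exists (D : normed_dynkin R T) (N : R) (c : T -> R) : 0 < N ->
  (forall i, exists p q : nat, [/\ 2 * c i = - (p%:R * node_norm D i),
      2 * c i = - (q%:R * N) & (p * q <= 4)%N]) ->
  exists2 D', extension N D D' & forall i, dynkin_ip D' None (Some i) = c i.
Proof.
move=> N0 cP.
have bP i : exists b, bond_norms b N (node_norm D i) /\
    bond_ip b N (node_norm D i) = c i.
  have [p [q [h1 h2 h3]]] := cP i.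
  have [b h4 h5] := bond_exists N0 (node_norm_gt0 D i) h1 h2 h3.
  by exists b.
have [b {}bP] := choice bP.
pose bb (o o' : option T) := match o, o' with
  | Some i, Some j => D i j
  | None, Some j => b j
  | Some i, None => bond_rev (b i)
  | None, None => NoBond end.
have bbd o : bb o o = NoBond by case: o => //= i; exact: bond_of_diag.
have bbs o o' : bb o' o = bond_rev (bb o o').
  case: o o' => [i|] [j|] //=; first exact: bond_of_sym.
  by case: (b i) => //= o; rewrite negbK.
pose nn (o : option T) := if o is Some i then node_norm D i else N.
have nn0 o : 0 < nn o by case: o => //= i; exact: node_norm_gt0.
have nnb o o' : bond_norms (Dynkin bbd bbs o o') (nn o) (nn o').
  case: o o' => [i|] [j|] //=; first exact: node_norm_bond.
    by apply: bond_rev_norms; case: (bP i).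
  by case: (bP j).
exists (NormedDynkin nn0 nnb); first by split.
by move=> i; rewrite -(bP i).2 /dynkin_ip /=; case: (b i).
Qed.
End Dynkin.

Section DynkinForm.
Context (R : realType) (n : nat) (G : 'M[rat]_n.+1).
Local Notation V := 'rV[R]_n.+1.
Local Notation B := (ip G).
Hypothesis hG : lorentzian R G.
Context (u : 'M[R]_(n.-1, n.+1)) (D : normed_dynkin R 'I_n.-1).
Hypothesis hD : diagram_of G u D.

(** The form of an extension is that of U with one more orthogonal direction,
    of norm N - x ^ 2; its sign decides between spherical and cuspidal. *)
Lemma extension_form (N : R) (D' : normed_dynkin R (option 'I_n.-1)) (x : V)
    (y : {ffun option 'I_n.-1 -> R}) :
  extension N D D' -> specified G u D' x ->
  let w := \sum_i y (Some i) *: row i u + y None *: x in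
  dynkin_sq D' y = B w w + y None ^+ 2 * (N - B x x).
Proof.
move=> [eD eN N0] [_ xD] w; have [hDn hDi] := hD.
have DE i j : dynkin_ip D' (Some i) (Some j) = B (row i u) (row j u).
  by rewrite -hDi /dynkin_ip eD !eN.
have D0 : dynkin_ip D' None None = N by rewrite /dynkin_ip eqxx.
rewrite /dynkin_sq sum_option sum_option D0.
under [X in _ + X]eq_bigr => i _ do rewrite sum_option dynkin_ipC -xD.
under [X in _ + X + _]eq_bigr => i _ do rewrite -xD.
under [X in _ + X]eq_bigr => i _ do (under eq_bigr => j _ do rewrite DE).
rewrite big_split /= /w; set W := \sum_i _ *: _.
have Wx : B W x = \sum_i y (Some i) * B x (row i u).
  by rewrite ip_suml; apply: eq_bigr => i _; rewrite ipZl (ipC hG x).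
have WW : B W W = \sum_i \sum_j y (Some i) * y (Some j) * B (row i u) (row j u).
  rewrite {1}/W ip_suml; apply: eq_bigr => i _.
  rewrite ipZl /W (ip_sumr hG) big_distrr; apply: eq_bigr => j _ /=.
  by rewrite ipZr mulrA.
rewrite -WW; set s1 := \sum_i _; set s2 := \sum_i _.
have -> : s1 = y None * B W x.
  by rewrite Wx big_distrr; apply: eq_bigr => i _ /=; rewrite mulrA.
have -> : s2 = y None * B W x.
  rewrite Wx big_distrr; apply: eq_bigr => i _ /=.
  by rewrite mulrA [y None * _]mulrC.
by rewrite !ipE (ipC hG x W); ring.
Qed.

Hypothesis ufree : row_free u.
Hypothesis upos : forall x : V, (x <= u)%MS -> 0 <= B x x /\ (B x x = 0 -> x = 0).

Lemma sum_row_sub (c : 'I_n.-1 -> R) : ((\sum_i c i *: row i u)%R <= u)%MS.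
Proof. by apply: summx_sub => i _; rewrite scalemx_sub // row_sub. Qed.

Lemma sum_row_eq0 (c : 'I_n.-1 -> R) : \sum_i c i *: row i u = 0 -> forall i, c i = 0.
Proof.
move=> h i; have : (\row_i c i) *m u = 0.
  by rewrite mulmx_sum_row -[RHS]h; apply: eq_bigr => j _; rewrite mxE.
by move/eqP; rewrite mulmx_free_eq0 // => /eqP/rowP/(_ i); rewrite !mxE.
Qed.

Lemma specified_coef (x : V) : (x <= u)%MS -> exists c : 'I_n.-1 -> R,
  x = \sum_i c i *: row i u.
Proof. by move=> /submxP[c ->]; exists (c 0); rewrite mulmx_sum_row. Qed.

Lemma extension_spherical N D' (x : V) : extension N D D' ->
  specified G u D' x -> spherical D' <-> 0 < N - B x x.
Proof.
move=> eD xD; have F := extension_form _ eD xD; split=> [sph|Nx y y0].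
  have [c xc] := specified_coef xD.1.
  pose y : {ffun option 'I_n.-1 -> R} := [ffun o => if o is Some i then - c i else 1].
  have y0 : y != 0.
    by apply/eqP => /ffunP/(_ None); rewrite !ffunE => /eqP; rewrite oner_eq0.
  have := sph y y0; rewrite F /= ffunE.
  have -> : \sum_i y (Some i) *: row i u + 1 *: x = 0.
    rewrite scale1r {1}xc -big_split big1 //= => i _.
    by rewrite ffunE -scalerDl addNr scale0r.
  by rewrite ip0l add0r expr1n mul1r.
rewrite F /=; set w := \sum_i _ *: _ + _ *: _.
have wu : (w <= u)%MS by rewrite addmx_sub ?sum_row_sub // scalemx_sub // xD.1.
have [w0 w1] := upos wu.
have h : 0 <= y None ^+ 2 * (N - B x x) by rewrite mulr_ge0 ?sqr_ge0 // ltW.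
rewrite lt_neqAle addr_ge0 // andbT; apply: contraNneq y0 => /esym e.
have yN : y None = 0.
  have /eqP : y None ^+ 2 * (N - B x x) = 0 by lra.
  by rewrite mulf_eq0 sqrf_eq0 (gt_eqF Nx) orbF => /eqP.
have : w = 0 by apply: w1; lra.
rewrite /w yN scale0r addr0 => /sum_row_eq0 yS.
by apply/eqP/ffunP => -[i|]; rewrite ffunE.
Qed.

Lemma extension_cuspidal N D' (x : V) : extension N D D' ->
  specified G u D' x -> cuspidal D' <-> N = B x x.
Proof.
move=> eD xD; have F := extension_form _ eD xD.
have [c xc] := specified_coef xD.1.
pose y1 : {ffun option 'I_n.-1 -> R} := [ffun o => if o is Some i then - c i else 1].
have y10 : y1 != 0.
  by apply/eqP => /ffunP/(_ None); rewrite !ffunE => /eqP; rewrite oner_eq0.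
have F1 : dynkin_sq D' y1 = N - B x x.
  rewrite F /= ffunE.
  have -> : \sum_i y1 (Some i) *: row i u + 1 *: x = 0.
    rewrite scale1r {1}xc -big_split big1 //= => i _.
    by rewrite ffunE -scalerDl addNr scale0r.
  by rewrite ip0l add0r expr1n mul1r.
have wp (y : {ffun option 'I_n.-1 -> R}) :
    ((\sum_i y (Some i) *: row i u + y None *: x)%R <= u)%MS.
  by rewrite addmx_sub ?sum_row_sub // scalemx_sub // xD.1.
split=> [[psd [y y0 yn]]|Nx].
  have N0 : 0 <= N - B x x by rewrite -F1.
  have [w0 w1] := upos (wp y).
  move: yn; rewrite F /= => yn.
  have h : 0 <= y None ^+ 2 * (N - B x x) by rewrite mulr_ge0 ?sqr_ge0.
  have /eqP : y None ^+ 2 * (N - B x x) = 0 by lra.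
  rewrite mulf_eq0 sqrf_eq0 => /orP[/eqP yN|]; last by rewrite subr_eq0 => /eqP.
  exfalso; move/eqP: y0; apply.
  have : \sum_i y (Some i) *: row i u + y None *: x = 0 by apply: w1; lra.
  rewrite yN scale0r addr0 => /sum_row_eq0 yS.
  by apply/ffunP => -[i|]; rewrite ffunE.
split=> [y|]; last by exists y1 => //; rewrite F1 Nx subrr.
by rewrite F /= Nx subrr mulr0 addr0; case: (upos (wp y)).
Qed.

End DynkinForm.
(** * The plane of an edge *)

Section Edges.
Context (R : realType) (n : nat) (G : 'M[rat]_n.+1).
Local Notation V := 'rV[R]_n.+1.
Local Notation B := (ip G).
Hypothesis hG : lorentzian R G.

(** Pairwise obtuse vectors of a definite space on one side of a hyperplane
    are independent: the positive and the negative part of a relation are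
    equal and have nonpositive inner product. *)
Lemma obtuse_row_free (p x0 : V) m (W : 'M[R]_(m, n.+1)) : B p p < 0 ->
  (forall i, B (row i W) p = 0) -> (forall i, B (row i W) x0 < 0) ->
  (forall i j, i != j -> B (row i W) (row j W) <= 0) -> row_free W.
Proof.
move=> pp Wp Wx Wo; apply/row_freeP/row_freeP; rewrite -kermx_eq0.
apply/eqP/row_matrixP => l; rewrite row0.
have : row l (kermx W) *m W = 0 by apply/sub_kermxP; exact: row_sub.
move: (row l (kermx W)) => c cW.
pose w : V := \sum_i Num.max (c 0 i) 0 *: row i W.
have wE : w = \sum_i Num.max (- c 0 i) 0 *: row i W.
  apply/eqP; rewrite -subr_eq0; apply/eqP; rewrite -[RHS]cW mulmx_sum_row -sumrB.
  apply: eq_bigr => i _; rewrite -scalerBl; congr (_ *: _).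
  by case: (leP (c 0 i) 0) => h; case: (leP (- c 0 i) 0) => h'; lra.
have wp : B w p = 0.
  by rewrite ip_suml big1 // => i _; rewrite ipZl Wp mulr0.
have ww : B w w <= 0.
  rewrite {2}wE ip_suml; apply: sumr_le0 => i _; rewrite ipZl (ip_sumr hG).
  rewrite big_distrr; apply: sumr_le0 => j _ /=; rewrite ipZr mulrA.
  have [<-|ij] := eqVneq i j.
    have -> : Num.max (c 0 i) 0 * Num.max (- c 0 i) 0 = 0.
      by case: (leP (c 0 i) 0) => h; case: (leP (- c 0 i) 0) => h'; try lra; ring.
    by rewrite mul0r.
  by rewrite mulr_ge0_le0 ?Wo // mulr_ge0 // le_max lexx orbT.
have w0 : w = 0.
  apply/eqP; apply: contraT => w0.
  by have := orth_timelike_gt0 hG pp wp w0; rewrite ltNge ww.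
have coef (f : 'I_m -> R) : (forall i, 0 <= f i) -> \sum_i f i *: row i W = 0 ->
    forall i, f i = 0.
  move=> f0 /(congr1 (fun v => B v x0)); rewrite ip_suml ip0l => /eqP.
  rewrite -oppr_eq0 -sumrN psumr_eq0 => [/allP h i|i _].
    have /eqP := h i (mem_index_enum i); rewrite /= ipZl => /eqP.
    by rewrite oppr_eq0 mulf_eq0 (lt_eqF (Wx i)) orbF => /eqP.
  by rewrite oppr_ge0 ipZl mulr_ge0_le0 // ltW.
apply/rowP => i; rewrite mxE.
have h1 := @coef (fun i => Num.max (c 0 i) 0) _ w0 i.
have h2 := @coef (fun i => Num.max (- c 0 i) 0) _ (etrans (esym wE) w0) i.
have : Num.max (c 0 i) 0 = 0 by apply: h1 => j; rewrite le_max lexx orbT.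
have : Num.max (- c 0 i) 0 = 0 by apply: h2 => j; rewrite le_max lexx orbT.
by case: (leP (c 0 i) 0) => h; case: (leP (- c 0 i) 0) => h'; lra.
Qed.

Context (t : V) (ht : B t t < 0) (x0 : V).
Context (k k' : V) (hk : Hbar G t k) (hk' : Hbar G t k').
Hypothesis kk' : forall c, k' <> c *: k.
Context (u : 'M[R]_(n.-1, n.+1)) (n_gt0 : (0 < n)%N).
Hypothesis uk : forall i, B (row i u) k = 0.
Hypothesis uk' : forall i, B (row i u) k' = 0.
Hypothesis ux0 : forall i, B (row i u) x0 < 0.
Hypothesis uo : forall i j, i != j -> B (row i u) (row j u) <= 0.

Lemma edge_ip_lt0 : B k k' < 0.
Proof. exact: (Hbar_ip_lt0 hG ht hk hk' kk'). Qed.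

Lemma edge_det : B k k * B k' k' < B k k' ^+ 2.
Proof. exact: (Hbar_revCS hG ht hk hk' kk'). Qed.

Lemma edge_mid : B (k + k') (k + k') < 0.
Proof.
have := edge_ip_lt0; case: hk hk' => [h1 _] [h2 _].
by rewrite !ipE (ipC hG k' k); lra.
Qed.

Lemma u_free : row_free u.
Proof.
by apply: (obtuse_row_free edge_mid _ ux0 uo) => i; rewrite ipDr uk uk' addr0.
Qed.

Lemma sub_u_perp (x : V) : (x <= u)%MS -> B x k = 0 /\ B x k' = 0.
Proof.
move=> /submxP[c ->]; rewrite !ip_mull.
by split; rewrite big1 // => i _; rewrite ?uk ?uk' mulr0.
Qed.

Lemma u_pos (x : V) : (x <= u)%MS -> 0 <= B x x /\ (B x x = 0 -> x = 0).
Proof.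
move=> /sub_u_perp[xk xk'].
have xm : B x (k + k') = 0 by rewrite ipDr xk xk' addr0.
split; first exact: (orth_timelike_ge0 hG edge_mid xm).
move=> xx; apply/eqP; apply: contraT => x0'.
by have := orth_timelike_gt0 hG edge_mid xm x0'; rewrite xx ltxx.
Qed.

Lemma planePE (x : V) : planeP G u x <-> forall i, B x (row i u) = 0.
Proof.
have E i : (x *m (gramR R G *m u^T)) 0 i = B x (row i u).
  rewrite /ip mulmxA; move: (x *m _) => X.
  by rewrite !mxE; apply: eq_bigr => j _; rewrite !mxE.
split=> [/sub_kermxP h i|h]; first by rewrite -E h mxE.
by apply/sub_kermxP/rowP => i; rewrite E h mxE.
Qed.

Lemma plane_k : planeP G u k.
Proof. by apply/planePE => i; rewrite (ipC hG). Qed.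

Lemma plane_k' : planeP G u k'.
Proof. by apply/planePE => i; rewrite (ipC hG). Qed.

Lemma planeD (x y : V) : planeP G u x -> planeP G u y -> planeP G u (x + y).
Proof. by move=> /planePE hx /planePE hy; apply/planePE => i; rewrite ipDl hx hy addr0. Qed.

Lemma planeZ (c : R) (x : V) : planeP G u x -> planeP G u (c *: x).
Proof. by move=> /planePE hx; apply/planePE => i; rewrite ipZl hx mulr0. Qed.

Lemma plane_u_orth (x y : V) : planeP G u x -> (y <= u)%MS -> B x y = 0.
Proof.
move=> /planePE h /submxP[c ->]; rewrite (ipC hG) ip_mull big1 // => i _.
by rewrite (ipC hG) h mulr0.
Qed.

Lemma rank_orthU : \rank (orthU G u) = 2%N.
Proof.
have gu : row_free (gramR R G)^T by rewrite row_free_unit unitmx_tr gram_unit.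
rewrite /orthU mxrank_ker -mxrank_tr trmx_mul trmxK mxrankMfree //.
by rewrite (eqP u_free); case: (n) n_gt0 => // m _; rewrite /= subSn // subSn // subnn.
Qed.

Lemma plane_span (x : V) : planeP G u x -> exists a b : R, x = a *: k + b *: k'.
Proof.
move=> xP; pose K : 'M[R]_(1 + 1, n.+1) := col_mx k k'.
have KP : (K <= orthU G u)%MS by rewrite col_mx_sub plane_k plane_k'.
have rK : \rank K = 2%N.
  apply/eqP; rewrite eqn_leq rank_leq_row /=.
  have : (k < K)%MS.
    rewrite ltmxE col_mx_sub submx_refl -addsmxE addsmxSl /=.
    by apply/negP => /sub_rVP[c]; exact: kk'.
  by move/rank_ltmx; rewrite rank_rV (Hbar_neq0 hk).
have /eqmxP/eqmx_sym KE : (K == orthU G u)%MS.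
  by rewrite -(geq_leqif (mxrank_leqif_eq KP)) rK rank_orthU.
move: xP; rewrite /planeP /= KE -addsmxE => /sub_addsmxP[[a b] /= ->].
by exists (a 0 0), (b 0 0); congr (_ + _);
  rewrite [X in X *m _]mx11_scalar mul_scalar_mx.
Qed.

Lemma comb_inj (a b c d : R) : a *: k + b *: k' = c *: k + d *: k' -> a = c /\ b = d.
Proof.
move=> e; have e' : (b - d) *: k' = (c - a) *: k.
  rewrite !scalerBl; apply/eqP; rewrite subr_eq addrAC -e.
  by rewrite addrAC subrr add0r.
have bd : b = d.
  apply/eqP; rewrite -subr_eq0; apply: contraT => bd.
  exfalso; apply: (@kk' ((b - d)^-1 * (c - a))).
  by rewrite -scalerA -e' scalerA mulVf // scale1r.
split=> //; move: e'; rewrite bd subrr scale0r => /esym/eqP.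
by rewrite scaler_eq0 (negPf (Hbar_neq0 hk)) orbF subr_eq0 => /eqP.
Qed.

(** The Gram determinant of k and k' is negative by edge_det. *)
Lemma plane_nondeg (x : V) : planeP G u x -> B x k = 0 -> B x k' = 0 -> x = 0.
Proof.
move=> /plane_span[a [b ->]]; rewrite !ipE (ipC hG k' k) => h1 h2.
have d := edge_det.
have : (B k k' ^+ 2 - B k k * B k' k') * a = 0.
  transitivity (B k k' * (a * B k k' + b * B k' k') -
    B k' k' * (a * B k k + b * B k k')); first by ring.
  by rewrite h1 h2 !mulr0 subrr.
have : (B k k' ^+ 2 - B k k * B k' k') * b = 0.
  transitivity (B k k' * (a * B k k + b * B k k') -
    B k k * (a * B k k' + b * B k' k')); first by ring.
  by rewrite h1 h2 !mulr0 subrr.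
move/eqP; rewrite mulf_eq0 subr_eq0 (gt_eqF d) /= => /eqP ->.
move/eqP; rewrite mulf_eq0 subr_eq0 (gt_eqF d) /= => /eqP ->.
by rewrite !scale0r addr0.
Qed.

Lemma plane_u_disjoint (x : V) : planeP G u x -> (x <= u)%MS -> x = 0.
Proof.
by move=> xP xu; have [_] := u_pos xu; apply; exact: plane_u_orth.
Qed.

Lemma proj_decomp (v : V) :
  [/\ (projU G u v <= u)%MS, planeP G u (projP G u v)
    & projU G u v + projP G u v = v].
Proof.
have dis : (<<u>> :&: orthU G u = 0)%MS.
  apply/eqP; rewrite -submx0; apply/row_subP => i.
  have : (row i (<<u>> :&: orthU G u) <= <<u>> :&: orthU G u)%MS by exact: row_sub.
  rewrite sub_capmx genmxE => /andP[h1 h2].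
  by rewrite (plane_u_disjoint h2 h1) sub0mx.
have full : (1%:M <= <<u>> + orthU G u)%MS.
  rewrite sub1mx /row_full mxrank_disjoint_sum // genmxE rank_orthU (eqP u_free).
  by case: (n) n_gt0 => // m _; rewrite addn2.
split.
- by have := proj_mx_sub <<u>>%MS (orthU G u) v; rewrite genmxE.
- exact: proj_mx_sub.
- apply: add_proj_mx => //; apply: submx_trans full; exact: submx1.
Qed.

Lemma sub_uP (x : V) : (x <= u)%MS <-> B x k = 0 /\ B x k' = 0.
Proof.
split=> [|[xk xk']]; first exact: sub_u_perp.
have [pu pP e] := proj_decomp x.
have [uk0 uk0'] := sub_u_perp pu.
have : projP G u x = 0.
  apply: plane_nondeg => //.
    by move: xk; rewrite -{1}e ipDl uk0 add0r.
  by move: xk'; rewrite -{1}e ipDl uk0' add0r.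
by move=> p0; rewrite -e p0 addr0.
Qed.

End Edges.
(** * Spherical candidates *)

Section Candidates.
Context (R : realType) (n : nat) (G : 'M[rat]_n.+1).
Local Notation V := 'rV[R]_n.+1.
Local Notation B := (ip G).
Local Notation root := (lattice_roots G).
Hypothesis hG : lorentzian R G.
Context (t : V) (ht : B t t < 0) (x0 : V).
Hypothesis hx0 : mirror_complement G t root x0.
Context (k k' : V).
Hypothesis Ck : signed_chamber G t root x0 k.
Hypothesis Ck' : signed_chamber G t root x0 k'.
Hypothesis kk' : forall c, k' <> c *: k.
Context (u : 'M[R]_(n.-1, n.+1)) (n_gt0 : (0 < n)%N).
Hypothesis ur : forall i, root (row i u).
Hypothesis uk : forall i, B (row i u) k = 0.
Hypothesis uk' : forall i, B (row i u) k' = 0.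
Hypothesis ux0 : forall i, B (row i u) x0 < 0.
Context (D : normed_dynkin R 'I_n.-1).
Hypothesis hD : diagram_of G u D.
Context (r0 : V).
Hypothesis hr0 : [/\ primitive r0, sector G u k k' r0 & B r0 k = 0].
Context (Ns : seq R).
Hypothesis hNs : root_norms G Ns.

Let hk : Hbar G t k := Ck.1.
Let hk' : Hbar G t k' := Ck'.1.

Lemma u_obtuse i j : i != j -> B (row i u) (row j u) <= 0.
Proof. by move=> ij; rewrite -hD.2; exact: dynkin_ip_le0. Qed.

Let ufree := u_free hG ht hk hk' kk' uk uk' ux0 u_obtuse.
Let upos := u_pos hG ht hk hk' kk' uk uk'.
Let pspan := plane_span hG ht hk hk' kk' n_gt0 uk uk' ux0 u_obtuse.
Let pdec := proj_decomp hG ht hk hk' kk' n_gt0 uk uk' ux0 u_obtuse.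
Let cinj := comb_inj hk kk'.
Let kk'0 := edge_ip_lt0 hG ht hk hk' kk'.
Let uperp := plane_u_orth hG (u := u).

(** Orthogonality to k fixes the direction of r0, and the sector fixes the sign
    of the factor; k may be timelike or lightlike. *)
Lemma r0_coord : exists2 s : R, s < 0 &
  r0 = (s * B k k) *: k' + (- s * B k k') *: k.
Proof.
have [rp [rP rr rs] rk] := hr0; have rn0 := primitive_neq0 rp.
have [a [b rE]] := pspan rP.
move: rk; rewrite rE !ipE (ipC hG k' k) => rk.
have b0 : b != 0 -> 0 < b.
  case: rs => [[_ [a' [b' [b'0 e]]]]|[c [c0 e]]] bn.
    by move: e; rewrite rE => /cinj[_ ->].
  move: e; rewrite rE -[c *: - k]addr0 -(scale0r k') scalerN -scaleNr => /cinj[_ e].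
  by rewrite e eqxx in bn.
have [kk0|kk0] := eqVneq (B k k) 0.
  have bz : b = 0.
    move: rk; rewrite kk0 mulr0 add0r => /eqP.
    by rewrite mulf_eq0 (lt_eqF kk'0) orbF => /eqP.
  exists (a / - B k k').
    rewrite pmulr_llt0 ?invr_gt0 ?oppr_gt0 //.
    case: rs => [[_ [a' [b' [b'0 e]]]]|[c [c0 e]]].
      by move: e; rewrite rE => /cinj[_ e]; rewrite -e bz ltxx in b'0.
    move: e; rewrite rE bz -[c *: - k]addr0 -(scale0r k') scalerN -scaleNr.
    by move=> /cinj[-> _]; rewrite oppr_lt0.
  rewrite kk0 mulr0 bz !scale0r addr0 add0r; congr (_ *: _).
  by field; rewrite lt_eqF.
have kkn : B k k < 0 by rewrite lt_neqAle kk0; case: hk.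
have aE : a = - b * B k k' / B k k.
  apply: (mulIf kk0); rewrite divfK //; lra.
exists (b / B k k).
  rewrite pmulr_rlt0 ?invr_lt0 // b0 //; apply: contraNneq rn0 => bz.
  by rewrite rE bz aE bz oppr0 !mul0r !scale0r addr0.
rewrite divfK // addrC; congr (_ + _ *: _); rewrite aE; field.
by [].
Qed.

Lemma orientedE a b c d :
  oriented k k' (a *: k' + b *: k) (c *: k' + d *: k) <-> 0 < a * d - b * c.
Proof.
split=> [[a1 [b1 [c1 [d1 [e1 e2]]]]]|h]; last by exists a, b, c, d.
move: e1 e2; rewrite ![_ *: k' + _]addrC => /cinj[-> ->] /cinj[-> ->].
by [].
Qed.

(** By r0_coord, the determinant that orients (r0, r) is s times B r k. Letting c
    range over all positive numbers excludes the ray of r0 itself. *)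
Lemma after_r0 (r : V) : planeP G u r ->
  (forall c, 0 < c -> sector_lt k k' (c *: r0) r) <-> B r k < 0.
Proof.
move=> rP; have [d [c rE]] := pspan rP; have [s s0 r0E] := r0_coord.
have rk : B r k = d * B k k + c * B k k' by rewrite rE !ipE (ipC hG k' k).
have or c0 : 0 < c0 -> oriented k k' (c0 *: r0) r <-> B r k < 0.
  move=> c00; rewrite {1}rE addrC r0E scalerDr !scalerA orientedE rk.
  have -> : c0 * (s * B k k) * d - c0 * (- s * B k k') * c =
    (c0 * s) * (d * B k k + c * B k k') by ring.
  by rewrite nmulr_rgt0 // pmulr_rlt0.
split=> [h|h c0 c00]; last by left; apply/or.
case: (h 1 ltr01) => [/or|]; first exact.
rewrite scale1r => -[c1 [c1_gt1 e]].
have c10 : 0 < c1 by apply: lt_trans c1_gt1.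
case: (h c1 c10) => [/or|]; first exact.
rewrite {1}e => -[c2 [c2_gt1 e2]].
have r00 : r0 != 0 by case: hr0 => /primitive_neq0.
have : (c2 - 1) *: (c1 *: r0) = 0 by rewrite scalerBl scale1r -e2 subrr.
move/eqP; rewrite !scaler_eq0 (negPf r00) orbF subr_eq0.
by rewrite (gt_eqF c2_gt1) (gt_eqF c10).
Qed.

Lemma sector_half (r : V) : sector G u k k' r -> 0 < B r r ->
  exists a b : R, 0 < b /\ r = a *: k + b *: k'.
Proof.
move=> [_ _ [[_ h]|[c [c0 ->]]]] rr //.
move: rr; have -> : B (c *: - k) (c *: - k) = c ^+ 2 * B k k.
  by rewrite !ipE; ring.
by rewrite pmulr_rgt0 ?exprn_gt0 // ltNge hk.1.
Qed.

Lemma lat_N_add N (v w : V) : lat_N G N v -> lat_N G N w -> lat_N G N (v + w).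
Proof.
move=> [vl vN] [wl wN]; split; first exact: latD.
move=> y yl; have [m1 e1] := vN y yl; have [m2 e2] := wN y yl.
by exists (m1 + m2); rewrite ipDl e1 e2 intrD mulrDl.
Qed.

(** Membership of cand_r c in the coset means that cand_u c + cand_r c is in
    L_N. *)
Lemma candidate_facts c : candidate G u D k k' r0 Ns c ->
  let x := cand_u c in let r := cand_r c in let N := cand_N c in
  [/\ 0 < N, [/\ (x <= u)%MS, planeP G u r & forall i, B (x + r) (row i u) <= 0],
      [/\ cand_R G c = B r r, 0 < B r r & B (x + r) (x + r) = N],
      B r k < 0 /\ exists a b : R, 0 < b /\ r = a *: k + b *: k'
    & lat_N G N (x + r)].
Proof.
move=> [NN [eD sph] xD [v [vN vx [rs rc rR ra] _]]] x r N.
have N0 : 0 < N by case: hNs => h _; exact: h.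
have xu : (x <= u)%MS := xD.1.
have rP : planeP G u r by case: rs.
have xr : B r x = 0 by exact: uperp.
have R0 : 0 < cand_R G c by apply/(extension_spherical hG hD ufree upos eD xD).
have rr : 0 < B r r by rewrite rR.
split=> //.
- split=> // i; rewrite ipDl.
  have -> : B r (row i u) = 0 by apply: uperp => //; exact: row_sub.
  by rewrite addr0 xD.2 dynkin_ip_le0.
- by split=> //; rewrite !ipE xr (ipC hG x) xr rR /cand_R -/x -/N; ring.
- by split; [exact/after_r0|exact: sector_half].
- case: rc => z [zN zP] e; have [_ _ ve] := pdec v.
  have -> : x + r = v + z by rewrite /x /r -e -vx addrA ve.
  exact: lat_N_add.
Qed.

Lemma candidate_root c : candidate G u D k k' r0 Ns c ->
  exists2 m : nat, (0 < m)%N & exists b, [/\ root b, B b x0 < 0, B b k < 0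
    & cand_alpha c = m%:R *: b].
Proof.
move=> /candidate_facts[N0 [xu rP _] [_ _ aN] [rk _] aL].
have [m m0 [b br e]] := lat_N_root aL aN N0.
exists m => //; exists b.
have mR : 0 < m%:R :> R by rewrite ltr0n.
have bk : B b k < 0.
  rewrite -(pmulr_rlt0 _ mR) -ipZl -e ipDl.
  by have [-> _] := sub_u_perp uk uk' xu; rewrite add0r.
split=> //; have [//|h] := root_sign hG hx0 br.
have := Ck.2 _ (lattice_rootN br) h.
by rewrite ipNl oppr_le0 leNgt bk.
Qed.

(** The mirror of a candidate meets the plane of the edge in a timelike line,
    so it would separate k from an ideal endpoint. *)
Lemma candidate_timelike c : candidate G u D k k' r0 Ns c ->
  B k' k' < 0.
Proof.
move=> hc; have [m m0 [b [br bx bk e]]] := candidate_root hc.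
have [_ [xu _ _] [_ rr _] [_ [p [q [q0 rE]]]] _] := candidate_facts hc.
have mR : 0 < m%:R :> R by rewrite ltr0n.
have bk' : B (cand_r c) k' <= 0.
  have := Ck'.2 _ br bx; rewrite -(pmulr_rle0 _ mR) -ipZl -e ipDl.
  by have [_ ->] := sub_u_perp uk uk' xu; rewrite add0r.
rewrite lt_neqAle hk'.1 andbT; apply/negP => /eqP k'0.
move: rr bk'; rewrite rE !ipE (ipC hG k' k) k'0 !mulr0 !addr0.
move=> h1 h2.
have pn : p < 0.
  rewrite ltNge; apply/negP => p0; have h3 := hk.1; have h4 := kk'0.
  have h5 : 0 <= p * q by rewrite mulr_ge0 // ltW.
  have : p * q * B k k' <= 0 by rewrite mulr_ge0_le0 // ltW.
  have : p * p * B k k <= 0 by rewrite mulr_ge0_le0 // mulr_ge0.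
  by lra.
have := kk'0; move: h2; rewrite nmulr_rle0 // leNgt => /negP h /h.
by [].
Qed.

(** The Cartan integers of a and of each u_i determine the bonds. *)
Lemma root_extension (a : V) : root a ->
  (forall i, B a (row i u) <= 0) ->
  (forall i, B a (row i u) ^+ 2 <= B a a * B (row i u) (row i u)) ->
  exists2 D', extension (B a a) D D' & specified G u D' (projU G u a).
Proof.
move=> ar au aCS; have aa := root_gt0 ar.
have [D' eD cD] : exists2 D', extension (B a a) D D' &
    forall i, dynkin_ip D' None (Some i) = B a (row i u).
  apply: extension_exists => // i; rewrite hD.1.
  have uu := root_gt0 (ur i); have [z zE] := root_integral hG (ur i) (root_lat ar).
  have [y yE] := root_integral hG ar (root_lat (ur i)).
  have zn : z <= 0.
    by rewrite -(ler_int R) -zE pmulr_rle0 // pmulr_lle0 ?invr_gt0.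
  have yn : y <= 0.
    by rewrite -(ler_int R) -yE pmulr_rle0 // pmulr_lle0 ?invr_gt0 // (ipC hG).
  have zN : (absz z)%:R = - z%:~R :> R.
    by rewrite -mulrNz pmulrn; congr (_ *~ _); lia.
  have yN : (absz y)%:R = - y%:~R :> R.
    by rewrite -mulrNz pmulrn; congr (_ *~ _); lia.
  exists (absz z), (absz y); split.
  - by rewrite zN -zE; field; rewrite gt_eqF.
  - by rewrite yN -yE (ipC hG _ a); field; rewrite gt_eqF.
  - rewrite -(ler_nat R) natrM zN yN -zE -yE (ipC hG (row i u) a).
    rewrite mulrNN.
    have -> : 2 * (B a (row i u) / B (row i u) (row i u)) *
        (2 * (B a (row i u) / B a a)) =
       4 * (B a (row i u) ^+ 2 / (B a a * B (row i u) (row i u))).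
      by field; rewrite !gt_eqF.
    by rewrite ger_pMr // ler_pdivrMr ?mul1r // mulr_gt0.
exists D' => //; have [pu pP e] := pdec a; split=> // i.
rewrite cD -{2}e ipDl (uperp pP (row_sub i u)) addr0.
by [].
Qed.

End Candidates.
(** * Vinberg's priority *)

Section Vinberg.
Context (R : realType) (n : nat) (G : 'M[rat]_n.+1).
Local Notation V := 'rV[R]_n.+1.
Local Notation B := (ip G).
Hypothesis hG : lorentzian R G.

(** The heart of Vinberg's algorithm: v is a nonnegative combination of A, and
    not all of its terms can lie further from h than v itself, because
    v ^ 2 is at most the sum of the terms with positive product with v, to which
    Cauchy-Schwarz applies. *)
Lemma closer_simple_root (A S : set V) (h v : V) :
  cone A v -> 0 < B v v -> (forall a, A a -> 0 < B a a) ->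
  (forall a, S a -> B h a = 0 /\ B a v <= 0) ->
  (forall a, A a -> B h a <= 0) -> B h v < 0 ->
  (forall a, A a -> B a v ^+ 2 <= B a a * B v v) ->
  exists a, [/\ A a, ~ S a, 0 < B a v
    & - B h a / Num.sqrt (B a a) < - B h v / Num.sqrt (B v v) \/
      (- B h a / Num.sqrt (B a a) = - B h v / Num.sqrt (B v v) /\
       B a v ^+ 2 = B a a * B v v)].
Proof.
move=> [s sA vE] vv Apos Sh Ah hv CS; apply: contrapT => no.
have termP a : A a -> B a v * - B h v <= B v v * - B h a /\
    (0 < B a v -> B a v * - B h v < B v v * - B h a).
  move=> Aa; have ha := Ah a Aa.
  have h0 : 0 <= B v v * - B h a by rewrite mulr_ge0 ?oppr_ge0 // ltW.
  have [av|av] := leP (B a v) 0.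
    split=> //; apply: le_trans h0.
    by rewrite mulr_le0_ge0 // oppr_ge0 ltW.
  have aS : ~ S a by case/Sh => _; rewrite leNgt av.
  have aa := Apos a Aa.
  pose x := Num.sqrt (B a a); pose y := Num.sqrt (B v v).
  have x0 : 0 < x by rewrite sqrtr_gt0.
  have y0 : 0 < y by rewrite sqrtr_gt0.
  have x2 : B a a = x ^+ 2 by rewrite sqr_sqrtr // ltW.
  have y2 : B v v = y ^+ 2 by rewrite sqr_sqrtr // ltW.
  have avxy : B a v <= x * y.
    rewrite -(@ler_pXn2r _ 2) ?nnegrE ?mulr_ge0 // ?(ltW av) ?(ltW x0) ?(ltW y0) //.
    by rewrite exprMn -x2 -y2; exact: CS.
  have hv' : 0 < - B h v by rewrite oppr_gt0.
  suff lt : B a v * - B h v < B v v * - B h a by split=> //; exact: ltW.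
  have [lt|ge] := ltP (- B h a / x) (- B h v / y).
    by exfalso; apply: no; exists a; split=> //; left.
  have pr : - B h v * x <= - B h a * y.
    by rewrite -ler_pdivlMr // mulrAC -ler_pdivrMr.
  have e1 : B a v * - B h v <= y * (- B h v * x).
    have : B a v * - B h v <= x * y * - B h v by rewrite ler_wpM2r // ltW.
    by lra.
  have e2 : y * (- B h v * x) <= B v v * - B h a.
    by rewrite y2; have := ler_wpM2l (ltW y0) pr; lra.
  rewrite lt_neqAle (le_trans e1 e2) andbT; apply/eqP => e.
  have e3 : y * (- B h v * x) = B v v * - B h a by apply/eqP; rewrite eq_le e2 -e.
  apply: no; exists a; split=> //; right; split.
    apply/eqP; rewrite eqr_div ?(gt_eqF x0) ?(gt_eqF y0) //; apply/eqP.
    apply: (mulfI (lt0r_neq0 y0)); rewrite -/x -/y e3.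
    by transitivity (y ^+ 2 * - B h a); [ring|rewrite -y2].
  rewrite x2 y2 -exprMn; congr (_ ^+ _).
  by apply: (mulIf (lt0r_neq0 hv')); rewrite e -e3; ring.
have [p ps [p0 pv]] : exists2 p, p \in s & 0 < p.1 /\ 0 < B p.2 v.
  apply: contrapT => np; have : B v v <= 0; last by rewrite leNgt vv.
  rewrite {1}vE ip_suml big_seq; apply: sumr_le0 => p ps; rewrite ipZl.
  have [p0 _] := sA p ps; have [pv|pv] := leP (B p.2 v) 0.
    by rewrite mulr_ge0_le0.
  have [->|pn] := eqVneq p.1 0; first by rewrite mul0r.
  by exfalso; apply: np; exists p => //; rewrite lt_neqAle eq_sym pn p0.
have : \sum_(q <- s) q.1 * (B v v * - B h q.2 - B q.2 v * - B h v) = 0.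
  have hvE : B h v = \sum_(q <- s) q.1 * B h q.2.
    by rewrite {1}vE (ip_sumr hG); apply: eq_bigr => q _; rewrite ipZr.
  have vvE : B v v = \sum_(q <- s) q.1 * B q.2 v.
    by rewrite {1}vE ip_suml; apply: eq_bigr => q _; rewrite ipZl.
  transitivity (B v v * - \sum_(q <- s) q.1 * B h q.2 -
      (\sum_(q <- s) q.1 * B q.2 v) * - B h v); last first.
    by rewrite -hvE -vvE; ring.
  rewrite -sumrN big_distrr big_distrl -sumrB; apply: eq_bigr => q _ /=.
  by ring.
rewrite big_seq => /eqP; rewrite psumr_eq0 => [|q qs]; last first.
  have [q0 qA] := sA q qs; rewrite mulr_ge0 // subr_ge0.
  by have [] := termP _ qA.
move=> /allP /(_ p ps); rewrite ps /= mulf_eq0 (gt_eqF p0) /= subr_eq0.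
have [_ /(_ pv) lt] := termP _ (sA p ps).2.
by rewrite (gt_eqF lt).
Qed.

End Vinberg.
(** The component of v orthogonal to a is null in a definite space. *)
Lemma timelike_CS_eq (R : realType) (n : nat) (G : 'M[rat]_n.+1)
  (hG : lorentzian R G) (y a v : 'rV[R]_n.+1) : ip G y y < 0 ->
  ip G a y = 0 -> ip G v y = 0 -> 0 < ip G a a ->
  ip G a v ^+ 2 = ip G a a * ip G v v -> v = (ip G a v / ip G a a) *: a.
Proof.
move=> yy ay vy aa eq; apply/eqP; rewrite -subr_eq0; apply: contraT => w0.
have wk : ip G (v - (ip G a v / ip G a a) *: a) y = 0.
  by rewrite ipDl ipNl ipZl vy ay mulr0 subr0.
have := orth_timelike_gt0 hG yy wk w0.
have -> : ip G (v - (ip G a v / ip G a a) *: a) (v - (ip G a v / ip G a a) *: a) =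
   (ip G a a * ip G v v - ip G a v ^+ 2) / ip G a a.
  by rewrite !ipE (ipC hG v a); field; rewrite gt_eqF.
by rewrite eq subrr mul0r ltxx.
Qed.

(** * The ordinary end of an edge *)

Section EdgeEnd.
Context (R : realType) (n : nat) (G : 'M[rat]_n.+1).
Local Notation V := 'rV[R]_n.+1.
Local Notation B := (ip G).
Local Notation root := (lattice_roots G).
Hypothesis hG : lorentzian R G.
Context (t : V) (ht : B t t < 0) (M : R).
Hypothesis rootM : forall a, root a -> B a a <= M.
Context (x0 : V).
Hypothesis hx0 : mirror_complement G t root x0.
Local Notation C := (signed_chamber G t root x0).
Context (k k' : V).
Hypothesis Ck : C k.
Hypothesis Ck' : C k'.
Hypothesis kk' : forall c, k' <> c *: k.
Hypothesis he : face C (segment k k').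
Context (u : 'M[R]_(n.-1, n.+1)) (n_gt0 : (0 < n)%N).
Hypothesis u_inj : injective (fun i => row i u).
Hypothesis us : forall i, simple_root G root C (row i u).
Hypothesis uk : forall i, B (row i u) k = 0.
Hypothesis uk' : forall i, B (row i u) k' = 0.
Context (D : normed_dynkin R 'I_n.-1).
Hypothesis hD : diagram_of G u D.
Context (r0 : V).
Hypothesis hr0 : [/\ primitive r0, sector G u k k' r0 & B r0 k = 0].
Context (Ns : seq R).
Hypothesis hNs : root_norms G Ns.

Let hk : Hbar G t k := Ck.1.
Let hk' : Hbar G t k' := Ck'.1.

Lemma u_root i : root (row i u).
Proof. by case: (us i). Qed.

(** The interior of the chamber contains x0. *)
Lemma u_neg i : B (row i u) x0 < 0.
Proof.
case: (us i) => _ _; apply.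
exact: (base_interior hG rootM hx0 (fun a h => h)).
Qed.

Let ur := u_root.
Let ux0 := u_neg.
Let uo : forall i j, i != j -> B (row i u) (row j u) <= 0 := u_obtuse hD.
Let ufree := u_free hG ht hk hk' kk' uk uk' ux0 uo.
Let upos := u_pos hG ht hk hk' kk' uk uk'.
Let pspan := plane_span hG ht hk hk' kk' n_gt0 uk uk' ux0 uo.
Let pdec := proj_decomp hG ht hk hk' kk' n_gt0 uk uk' ux0 uo.
Let cinj := comb_inj hk kk'.
Let kk'0 := edge_ip_lt0 hG ht hk hk' kk'.
Let uperp := plane_u_orth hG (u := u).
Let subu := sub_uP hG ht hk hk' kk' n_gt0 uk uk' ux0 uo.
Let afterr0 := after_r0 hG ht Ck Ck' kk' n_gt0 uk uk' ux0 hD hr0.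
Let shalf := sector_half (k' := k') Ck (u := u).
Let cfacts := candidate_facts hG ht Ck Ck' kk' n_gt0 uk uk' ux0 hD hr0 hNs.
Let croot := candidate_root hG ht hx0 Ck Ck' kk' n_gt0 uk uk' ux0 hD hr0 hNs.
Local Notation base := (base_root G x0 k').

Lemma u_base i : base (row i u).
Proof. exact: (simple_root_base_root hG ht rootM hx0 hk' (us i) (uk' i)). Qed.

Lemma base_ip_k (a : V) : base a -> B a k <= 0.
Proof. by move=> /base_root_pos[[ar _] a0]; exact: Ck.2. Qed.

(** A further simple root at k' cannot lie in U, where the u_i are already a
    maximal independent family. *)
Lemma base_outside (a : V) : base a -> (forall i, a <> row i u) -> B a k < 0.
Proof.
move=> aS au; rewrite lt_neqAle base_ip_k // andbT; apply/eqP => ak.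
have [[ar ak'] a0] := base_root_pos aS.
have aU : (a <= u)%MS by apply/subu.
have : row_free (col_mx u a).
  apply: (obtuse_row_free hG (edge_mid hG ht hk hk' kk') (x0 := x0)) => i.
  - case: (splitP i) => j ij.
      rewrite (_ : i = lshift 1 j) ?rowKu; last exact: val_inj.
      by rewrite ipDr uk uk' addr0.
    rewrite (_ : i = rshift n.-1 j); last exact: val_inj.
    by rewrite rowKd (ord1 j) row_id ipDr ak ak' addr0.
  - case: (splitP i) => j ij.
      by rewrite (_ : i = lshift 1 j) ?rowKu //; exact: val_inj.
    rewrite (_ : i = rshift n.-1 j); last exact: val_inj.
    by rewrite rowKd (ord1 j) row_id.
  - move=> j; case: (splitP i) => i' ii'; case: (splitP j) => j' jj'.
    + rewrite (_ : i = lshift 1 i'); last exact: val_inj.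
      rewrite (_ : j = lshift 1 j'); last exact: val_inj.
      by rewrite !rowKu eq_lshift; exact: uo.
    + rewrite (_ : i = lshift 1 i'); last exact: val_inj.
      rewrite (_ : j = rshift n.-1 j'); last exact: val_inj.
      rewrite rowKu rowKd (ord1 j') row_id => _.
      exact: (base_root_obtuse hG (u_base i') aS (nesym (au i'))).
    + rewrite (_ : i = rshift n.-1 i'); last exact: val_inj.
      rewrite (_ : j = lshift 1 j'); last exact: val_inj.
      rewrite rowKu rowKd (ord1 i') row_id => _.
      exact: (base_root_obtuse hG aS (u_base j') (au j')).
    + by rewrite (ord_inj (etrans ii' (esym (etrans jj' (congr1 (addn _ \o val) (etrans (ord1 j') (esym (ord1 i')))))))) eqxx.
rewrite /row_free; have : (col_mx u a <= u)%MS by rewrite col_mx_sub submx_refl.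
move/mxrankS; rewrite (eqP ufree) => h /eqP e.
by rewrite e addn1 ltnn in h.
Qed.

(** The root of which projU v + r is a multiple is negative at k, hence
    nonpositive at k'. *)
Lemma admissible_side (N rho : R) (v r : V) : 0 < N -> lat_N G N v ->
  rho = N - B (projU G u v) (projU G u v) -> 0 < rho ->
  admissible G u k k' r0 (coset_at G u N v) rho r ->
  [/\ planeP G u r, B r k < 0, B r k' <= 0,
      exists a b : R, 0 < b /\ r = a *: k + b *: k' & B r r = rho].
Proof.
move=> N0 vN rhoE rho0 [rs rc rR /afterr0 ra].
have rP : planeP G u r by case: rs.
have rk : B r k < 0 by exact: ra.
have rr : 0 < B r r by rewrite rR.
split=> //; last exact: shalf.
have [vu _ ve] := pdec v.
set x := projU G u v in rhoE vu ve.
have xr : B r x = 0 by exact: uperp.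
have aL : lat_N G N (x + r).
  case: rc => z [zN zP] e.
  have -> : x + r = v + z by rewrite -e addrA ve.
  exact: lat_N_add.
have aN : B (x + r) (x + r) = N.
  by rewrite !ipE xr (ipC hG x) xr rR rhoE; ring.
have [m m0 [b br e]] := lat_N_root aL aN N0.
have mR : 0 < m%:R :> R by rewrite ltr0n.
have [xk xk'] := sub_u_perp uk uk' vu.
have bk : B b k < 0.
  by rewrite -(pmulr_rlt0 _ mR) -ipZl -e ipDl xk add0r.
have bx0 : B b x0 < 0.
  have [//|h] := root_sign hG hx0 br.
  by have := Ck.2 _ (lattice_rootN br) h; rewrite ipNl oppr_le0 leNgt bk.
by have := Ck'.2 _ br bx0; rewrite -(pmulr_rle0 _ mR) -ipZl -e ipDl xk' add0r.
Qed.

Lemma base_CS (a b : V) : roots_perp G k' a -> roots_perp G k' b ->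
  B a b ^+ 2 <= B a a * B b b.
Proof. exact: (perp_CS hG hk'). Qed.

Lemma base_extension (a : V) : base a -> (forall i, a <> row i u) ->
  exists2 D', extension (B a a) D D' & specified G u D' (projU G u a).
Proof.
move=> aS au; have [aP a0] := base_root_pos aS.
apply: (root_extension hG ht Ck Ck' kk' n_gt0 ur uk uk' ux0 hD) => // [|i|i].
- exact: aP.1.
- exact: (base_root_obtuse hG aS (u_base i) (au i)).
- by apply: base_CS => //; exact: (base_root_pos (u_base i)).1.
Qed.

Section Ordinary.
Hypothesis k'k' : B k' k' < 0.

(** If all roots orthogonal to k' were in U, the edge could be prolonged. *)
Lemma root_outside : exists2 a, roots_perp G k' a & ~ (a <= u)%MS.
Proof.
apply: contrapT => no.
have aU a : roots_perp G k' a -> B a k = 0.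
  move=> aP; have : (a <= u)%MS.
    by apply/negPn/negP => /negP au; apply: no; exists a.
  by case/(sub_u_perp uk uk').
have hyp : Hyp G t k' by case: hk'.
have := near_Hyp hG hyp; have := near_mirrors hG k'k' rootM => n1 n2.
have [e e0 [ez hz]] := nbhs_line (- k) (filterI n1 n2).
have Cx : C (k' + e *: - k).
  split=> [|a ar a0]; first exact: Hyp_Hbar.
  have := Ck'.2 _ ar a0; rewrite le_eqVlt => /orP[/eqP ak'|ak'].
    by rewrite ipDr ipZr ipNr ak' aU ?oppr0 ?mulr0 ?addr0.
  exact/ltW/ez.
have Cy : C (e *: k) by exact: signed_chamberZ.
case: he => _ _ _ /(_ _ _ Cx Cy)[].
  exists 0, 1; rewrite add0r ler01 ltr01 lexx; split=> //.
  by rewrite scalerN subrK scale0r scale1r add0r.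
move=> [a [b [a0 b0 _]]]; rewrite scalerN -scaleNr addrC.
rewrite -[X in _ + X]scale1r => /cinj[ea _] _.
by move: a0; rewrite -ea oppr_ge0 leNgt e0.
Qed.

(** A positive root outside U is a combination of base roots; they are not all
    orthogonal to k. *)
Lemma new_simple_root : exists2 a, base a & B a k < 0.
Proof.
have [a aP au] := root_outside.
wlog a0 : a aP au / B a x0 < 0.
  move=> H; have [h|h] := root_sign hG hx0 aP.1; first exact: H h.
  by apply: (H (- a)) h; [exact: perpN|rewrite eqmx_opp].
have ac := pos_root_cone hG ht rootM hx0 hk' (conj aP a0).
apply: contrapT => no; apply: au; apply/subu; split; last exact: aP.2.
have bk b : base b -> B b k = 0.
  move=> bS; apply/eqP; rewrite eq_le base_ip_k //= leNgt.
  by apply/negP => h; apply: no; exists b.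
apply/eqP; rewrite eq_le; apply/andP; split.
  by apply: (cone_ip_le0 ac) => b /bk ->.
rewrite -oppr_le0 -ipNr; apply: (cone_ip_le0 ac) => b /bk h.
by rewrite ipNr h oppr0.
Qed.

(** Together with the u_i, the two roots would be n + 1 independent vectors in
    the complement of k'. *)
Lemma base_unique (a b : V) : base a -> base b -> B a k < 0 -> B b k < 0 -> a = b.
Proof.
move=> aS bS ak bk; apply: contrapT => ab.
have au i : a <> row i u by move=> e; rewrite e uk ltxx in ak.
have bu i : b <> row i u by move=> e; rewrite e uk ltxx in bk.
pose f (i : 'I_(n.-1 + (1 + 1))) : V := match fintype.split i with
  | inl j => row j u | inr j => if nat_of_ord j == 0%N then a else b end.
pose W := \matrix_i f i.
have fS i : base (f i).
  rewrite /f; case: (fintype.split i) => j; first exact: u_base.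
  by case: eqP.
have fi : injective f.
  move=> i j; rewrite /f -{2}(fintype.splitK i) -{2}(fintype.splitK j).
  case: (fintype.split i) => i'; case: (fintype.split j) => j' /=.
  - move=> e; congr (unsplit (inl _)); exact: u_inj.
  - by case: eqP => _ /esym; [move/au|move/bu].
  - by case: eqP => _; [move/au|move/bu].
  - case: eqP => i0; case: eqP => j0; try by [move/ab|move/esym/ab].
      by move=> _; congr (unsplit (inr _)); apply: val_inj; rewrite /= i0 j0.
    move=> _; congr (unsplit (inr _)); apply: val_inj => /=.
    by have := ltn_ord i'; have := ltn_ord j'; move: i0 j0; lia.
have Wf : row_free W.
  apply: (obtuse_row_free hG k'k' (x0 := x0)) => [i|i|i j ij]; rewrite !rowK.
  - by have [[]] := base_root_pos (fS i).
  - by have [] := base_root_pos (fS i).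
  - by apply: (base_root_obtuse hG) => // /fi e; rewrite e eqxx in ij.
have : (W <= orthmx G k')%MS.
  apply/row_subP => i; rewrite rowK; apply/orthmxP.
  by have [[]] := base_root_pos (fS i).
move/mxrankS; rewrite (rank_orthmx hG (Hbar_neq0 hk')) (eqP Wf) addnA !addn1.
by case: (n) n_gt0 => // m _ /=; rewrite ltnn.
Qed.

Section Alpha.
Context (al : V) (alS : base al) (alk : B al k < 0).
Local Notation ral := (projP G u al).

Lemma base_cases (b : V) : base b -> (exists i, b = row i u) \/ b = al.
Proof.
move=> bS; have [|no] := pselect (exists i, b = row i u); first by left.
right; apply: (base_unique bS alS _ alk); apply: base_outside => // i e.
by apply: no; exists i.
Qed.

Lemma alpha_not_u i : al <> row i u.
Proof. by move=> e; move: alk; rewrite e uk ltxx. Qed.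

Lemma ral_coord : exists a b : R,
  [/\ ral = a *: k + b *: k', a < 0, 0 < b & a * B k k' + b * B k' k' = 0].
Proof.
have [pu pP e] := pdec al; have [pk pk'] := sub_u_perp uk uk' pu.
have [[_ alk'] _] := base_root_pos alS.
have rk : B ral k < 0 by move: alk; rewrite -{1}e ipDl pk add0r.
have rk' : B ral k' = 0 by move: alk'; rewrite -{1}e ipDl pk' add0r.
have [a [b rE]] := pspan pP.
move: rk rk'; rewrite rE !ipE (ipC hG k' k) => rk rk'.
have det := edge_det hG ht hk hk' kk'.
have b0 : 0 < b.
  have : 0 < b * (B k k' ^+ 2 - B k k * B k' k').
    have -> : b * (B k k' ^+ 2 - B k k * B k' k') =
      (a * B k k + b * B k k') * B k k' - (a * B k k' + b * B k' k') * B k k by ring.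
    by rewrite rk' mul0r subr0 nmulr_rgt0.
  by rewrite pmulr_lgt0 // subr_gt0.
exists a, b; split=> //.
rewrite -(nmulr_lgt0 _ kk'0).
have : b * B k' k' < 0 by rewrite pmulr_rlt0.
by lra.
Qed.

Lemma ral_perp : B ral k' = 0.
Proof.
have [pu pP e] := pdec al; have [_ pk'] := sub_u_perp uk uk' pu.
have [[_ alk'] _] := base_root_pos alS.
by move: alk'; rewrite -{1}e ipDl pk' add0r.
Qed.

Lemma ral_k : B ral k = B al k.
Proof.
have [pu pP e] := pdec al; have [pk _] := sub_u_perp uk uk' pu.
by rewrite -[in RHS]e ipDl pk add0r.
Qed.

Lemma ral_gt0 : 0 < B ral ral.
Proof.
apply: (orth_timelike_gt0 hG k'k' ral_perp); apply/eqP => r0'.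
by move: alk; rewrite -ral_k r0' ip0l ltxx.
Qed.

(** The sign of y is that of - B r k', and x is positive because the
    k-coordinates of spacelike vectors of the half-plane are negative. *)
Lemma halfplane_coord (r : V) : (exists a b : R, 0 < b /\ r = a *: k + b *: k') ->
  0 < B r r -> B r k' <= 0 ->
  exists x y : R, [/\ 0 < x, 0 <= y & r = x *: ral + y *: k'].
Proof.
move=> [d [c [c0 rE]]] rr rk'; have [a [b [ralE a0 b0 ab]]] := ral_coord.
have d0 : d < 0.
  rewrite ltNge; apply/negP => d0; move: rr; rewrite rE.
  have h1 : d ^+ 2 * B k k <= 0 by rewrite mulr_ge0_le0 ?sqr_ge0 //; case: hk.
  have h2 : c ^+ 2 * B k' k' <= 0 by rewrite mulr_ge0_le0 ?sqr_ge0 //; case: hk'.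
  have h3 : d * c * B k k' <= 0 by rewrite mulr_ge0_le0 ?(ltW kk'0) // mulr_ge0 // ltW.
  have -> : B (d *: k + c *: k') (d *: k + c *: k') =
     d ^+ 2 * B k k + 2 * (d * c * B k k') + c ^+ 2 * B k' k'.
    by rewrite !ipE (ipC hG k' k); ring.
  by lra.
exists (d / a), (c - d / a * b); split.
- by rewrite nmulr_rgt0 // invr_lt0.
- rewrite -(nmulr_lle0 _ k'k'); move: rk'; rewrite rE !ipE.
  have -> : B k k' = - (b * B k' k') / a.
    by apply: (mulIf (ltr0_neq0 a0)); rewrite divfK ?ltr0_neq0 //; lra.
  have -> : d * (- (b * B k' k') / a) + c * B k' k' = (c - d / a * b) * B k' k'.
    by field; rewrite ltr0_neq0.
  by [].
- rewrite rE ralE scalerDr !scalerA divfK ?ltr0_neq0 // -addrA -scalerDl.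
  by congr (_ + _ *: _); ring.
Qed.

Lemma candidate_k' c : candidate G u D k k' r0 Ns c -> B (cand_r c) k' <= 0.
Proof.
move=> hc; have [m m0 [b [br bx bk e]]] := croot hc.
have [_ [xu _ _] _ _ _] := cfacts hc.
have mR : 0 < m%:R :> R by rewrite ltr0n.
have := Ck'.2 _ br bx; rewrite -(pmulr_rle0 _ mR) -ipZl -e ipDl.
by have [_ ->] := sub_u_perp uk uk' xu; rewrite add0r.
Qed.

Lemma candidate_coord c : candidate G u D k k' r0 Ns c ->
  exists x y : R, [/\ 0 < x, 0 <= y & cand_r c = x *: ral + y *: k'].
Proof.
move=> hc; have [_ _ [_ rr _] [_ h] _] := cfacts hc.
exact: halfplane_coord h rr (candidate_k' hc).
Qed.

(** The vectors of the sector that precede the projection of al have positive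
    product with k', so they are not admissible by admissible_side. *)
Lemma alpha_candidate : exists c, [/\ candidate G u D k k' r0 Ns c,
  cand_alpha c = al, cand_r c = ral & cand_N c = B al al].
Proof.
have [pu pP e] := pdec al; have [[ar _] _] := base_root_pos alS.
have aa := root_gt0 ar.
have [D' eD sD] := base_extension alS alpha_not_u.
have aE : B al al = B (projU G u al) (projU G u al) + B ral ral.
  by rewrite -{1 2}e !ipE (uperp pP pu) (ipC hG _ ral) (uperp pP pu); ring.
have rE : B al al - B (projU G u al) (projU G u al) = B ral ral by rewrite aE; ring.
exists (CandidateData (B al al) D' (projU G u al) ral); split=> //=.
split=> //=.
- by case: hNs => _; exact.
- by split=> //; apply/(extension_spherical hG hD ufree upos eD sD); rewrite rE ral_gt0.
exists al; rewrite /cand_R /= rE; split=> //; first exact: root_lat_N.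
  split=> //.
  - split=> //; first exact/ltW/ral_gt0.
    by left; split=> //; have [a [b [h _ b0 _]]] := ral_coord; exists a, b.
  - exists 0; rewrite ?addr0 //; split; last by apply/planePE => i; rewrite ip0l.
    split; first exact: lat0.
    by move=> w _; exists 0; rewrite ip0l mul0r.
  - by apply/afterr0 => //; rewrite ral_k.
move=> r radm.
have [rP rk rk' rh rr] :=
  admissible_side aa (root_lat_N ar) (esym rE) ral_gt0 radm.
have rr0 : 0 < B r r by rewrite rr ral_gt0.
have [x [y [x0' y0 xy]]] := halfplane_coord rh rr0 rk'.
have [yz|yn] := eqVneq y 0.
  left; have x2 : x ^+ 2 = 1.
    apply: (mulIf (lt0r_neq0 ral_gt0)); rewrite mul1r -[RHS]rr.
    by rewrite xy yz scale0r addr0 !ipE; ring.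
  rewrite xy yz scale0r addr0; move/eqP: x2; rewrite sqrf_eq1 => /orP[/eqP->|].
    by rewrite scale1r.
  by move=> /eqP xN; move: x0'; rewrite xN ltr0N1.
right; left; have [a [b [ralE a0 b0 _]]] := ral_coord.
exists b, a, (x * b + y), (x * a); split.
- by rewrite addrC.
- by rewrite xy ralE scalerDr !scalerA scalerDl [RHS]addrC addrA.
- have -> : b * (x * a) - a * (x * b + y) = - a * y by ring.
  by rewrite mulr_gt0 ?oppr_gt0 // lt_neqAle eq_sym yn.
Qed.

(** In the coordinates of halfplane_coord, y increases - B k r and decreases the
    norm of r. *)
Lemma ral_closest c : candidate G u D k k' r0 Ns c ->
  - B k ral / Num.sqrt (B ral ral) <= - B k (cand_r c) / Num.sqrt (cand_R G c) /\
  (- B k (cand_r c) / Num.sqrt (cand_R G c) <= - B k ral / Num.sqrt (B ral ral) ->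
   B (cand_r c) k' = 0).
Proof.
move=> hc; have [x [y [x0' y0 rE]]] := candidate_coord hc.
have [_ _ [-> rr _] _ _] := cfacts hc.
set r := cand_r c in rE rr *.
have ral0 := ral_gt0; have rp := ral_perp.
pose s := Num.sqrt (B ral ral); pose q := Num.sqrt (B r r).
have s0 : 0 < s by rewrite sqrtr_gt0.
have q0 : 0 < q by rewrite sqrtr_gt0.
have qs : q <= x * s.
  rewrite -(@ler_pXn2r _ 2) ?nnegrE ?mulr_ge0 ?(ltW q0) ?(ltW x0') ?(ltW s0) //.
  rewrite exprMn !sqr_sqrtr ?(ltW rr) ?(ltW ral0) // rE !ipE rp (ipC hG k' ral) rp.
  have : y ^+ 2 * B k' k' <= 0 by rewrite mulr_ge0_le0 ?sqr_ge0 // ltW.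
  by lra.
have kr : - B k r = x * - B k ral + y * - B k k' by rewrite rE !ipE; ring.
have kral : 0 < - B k ral by rewrite oppr_gt0 (ipC hG) ral_k.
have e1 : - B k ral * q <= x * - B k ral * s.
  by have := ler_wpM2l (ltW kral) qs; lra.
have e2 : 0 <= y * - B k k' * s by rewrite !mulr_ge0 ?oppr_ge0 ?(ltW s0) // ltW.
rewrite -/s -/q; split.
  rewrite ler_pdivrMr // mulrAC ler_pdivlMr // kr; lra.
rewrite ler_pdivrMr // mulrAC ler_pdivlMr // kr => h.
have yz : y * - B k k' * s = 0 by lra.
have y00 : y = 0.
  move/eqP: yz; rewrite !mulf_eq0 oppr_eq0 (lt_eqF kk'0) (gt_eqF s0) !orbF.
  by move/eqP.
by rewrite rE y00 scale0r addr0 ipZl rp mulr0.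
Qed.

(** closer_simple_root applies with h = k, and al is the only simple root at k'
    besides the u_i. *)
Lemma alpha_priority c : candidate G u D k k' r0 Ns c -> B (cand_r c) k' = 0 ->
  - B k al / Num.sqrt (B al al) <= - B k (cand_alpha c) / Num.sqrt (cand_N c) /\
  (- B k (cand_alpha c) / Num.sqrt (cand_N c) <= - B k al / Num.sqrt (B al al) ->
   exists2 m : nat, (0 < m)%N & cand_alpha c = m%:R *: al).
Proof.
move=> hc rk'; have [m m0 [b [br bx bk e]]] := croot hc.
have [N0 [xu rP xru] [_ rr NE] [rk _] _] := cfacts hc.
have mR : 0 < m%:R :> R by rewrite ltr0n.
have [xk xk'] := sub_u_perp uk uk' xu.
have bk' : B b k' = 0.
  apply: (mulfI (lt0r_neq0 mR)); rewrite mulr0 -ipZl -e ipDl xk' rk' addr0.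
  by [].
have bp : pos_root G x0 k' b by [].
have vc : cone base (cand_alpha c).
  by rewrite e; apply: coneZ => //; exact: (pos_root_cone hG ht rootM hx0 hk' bp).
have vk : B (cand_alpha c) k' = 0 by rewrite e ipZl bk' mulr0.
have vv : 0 < B (cand_alpha c) (cand_alpha c) by rewrite NE.
have bpos a : base a -> 0 < B a a.
  by move=> /base_root_pos[[ar _] _]; exact: root_gt0 ar.
have CS a : base a -> B a (cand_alpha c) ^+ 2 <= B a a * B (cand_alpha c) (cand_alpha c).
  move=> /base_root_pos[[_ ak'] _].
  exact: (causal_orth_CS hG (ltW k'k') (Hbar_neq0 hk') ak' vk vv).
have [a [aS au av pr]] : exists a, [/\ base a, ~ (exists i, a = row i u),
    0 < B a (cand_alpha c)
  & - B k a / Num.sqrt (B a a) <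
       - B k (cand_alpha c) / Num.sqrt (B (cand_alpha c) (cand_alpha c)) \/
    (- B k a / Num.sqrt (B a a) =
       - B k (cand_alpha c) / Num.sqrt (B (cand_alpha c) (cand_alpha c)) /\
     B a (cand_alpha c) ^+ 2 = B a a * B (cand_alpha c) (cand_alpha c))].
  apply: (closer_simple_root hG vc) => //.
  - move=> _ [i ->]; rewrite (ipC hG k) uk (ipC hG); split=> //; exact: xru.
  - by move=> a aS; rewrite (ipC hG); exact: base_ip_k.
  - by rewrite e ipZr (ipC hG) pmulr_rlt0.
have aE : a = al by case: (base_cases aS) => // /au.
rewrite {}aE in aS au av pr *.
rewrite -NE; split; first by case: pr => [/ltW|[-> _]].
case: pr => [lt|[_ eq]]; first by rewrite leNgt lt.
move=> _; exists m => //.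
pose v := cand_alpha c.
have [[ar ak'] _] := base_root_pos aS; have aa := root_gt0 ar.
have vE : v = (B al v / B al al) *: al.
  exact: (timelike_CS_eq hG k'k' ak' vk aa eq).
have : b = (m%:R^-1 * (B al v / B al al)) *: al.
  by rewrite -scalerA -vE /v e scalerA mulVf ?scale1r // lt0r_neq0.
move/(root_parallel br ar) => be; rewrite e be // mulr_gt0 ?invr_gt0 //.
by rewrite divr_gt0.
Qed.

Lemma best_candidateE : unique (fun a => exists c,
  best_candidate G u D k k' r0 Ns c /\ a = cand_alpha c) al.
Proof.
have [c0 [hc0 c0al c0r c0N]] := alpha_candidate.
have [_ _ [c0R _ _] _ _] := cfacts hc0.
have [ar _] := (base_root_pos alS).1; have aa := root_gt0 ar.
have min1 : minimizers (candidate G u D k k' r0 Ns)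
    (fun c => - B k (cand_r c) / Num.sqrt (cand_R G c)) c0.
  split=> // c hc; rewrite c0R c0r; exact: (ral_closest hc).1.
have perp c : minimizers (candidate G u D k k' r0 Ns)
    (fun c => - B k (cand_r c) / Num.sqrt (cand_R G c)) c -> B (cand_r c) k' = 0.
  move=> [hc cm]; apply: (ral_closest hc).2.
  by have := cm _ hc0; rewrite c0R c0r.
have min2 : minimizers (minimizers (candidate G u D k k' r0 Ns)
      (fun c => - B k (cand_r c) / Num.sqrt (cand_R G c)))
    (fun c => - B k (cand_alpha c) / Num.sqrt (cand_N c)) c0.
  split=> // c cm; rewrite c0al c0N.
  exact: (alpha_priority cm.1 (perp c cm)).1.
have mult c : minimizers (minimizers (candidate G u D k k' r0 Ns)
      (fun c => - B k (cand_r c) / Num.sqrt (cand_R G c)))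
    (fun c => - B k (cand_alpha c) / Num.sqrt (cand_N c)) c ->
    exists2 m : nat, (0 < m)%N & cand_alpha c = m%:R *: al.
  move=> [cm1 cm2]; apply: (alpha_priority cm1.1 (perp c cm1)).2.
  by have := cm2 _ min1; rewrite c0al c0N.
have norm (m : nat) : (0 < m)%N -> B al al <= B (m%:R *: al) (m%:R *: al).
  move=> m0; rewrite !ipE mulrA ler_peMl ?(ltW aa) // -natrM ler1n muln_gt0 m0.
  by [].
split.
  exists c0; split=> //; split=> // c /mult[m m0 ->].
  by rewrite c0al; exact: norm.
move=> a [c [[cm2 cm3] ->]]; have [m m0 e] := mult c cm2.
have := cm3 _ min2; rewrite c0al e !ipE mulrA -natrM ger_pMl // lern1.
by move=> mm; have -> : m = 1%N by [nia|lia]; rewrite scale1r.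
Qed.

Lemma simple_root_at_alpha :
  simple_root_at G t C k' = [set a | (exists i, a = row i u) \/ a = al].
Proof.
rewrite (simple_root_at_base hG ht rootM hx0 hk'); apply/seteqP; split=> a /=.
  exact: base_cases.
by case=> [[i ->]|->]; [exact: u_base|].
Qed.

Lemma alpha_line (x : V) : (planeP G u x /\ B x al = 0) <->
  (exists c : R, x = c *: k').
Proof.
have [[_ alk'] _] := base_root_pos alS.
split=> [[/pspan[a [b ->]] h]|[c ->]]; last first.
  split; first by apply/planePE => i; rewrite ipZl (ipC hG) uk' mulr0.
  by rewrite ipZl (ipC hG) alk' mulr0.
exists b; suff -> : a = 0 by rewrite scale0r add0r.
move: h; rewrite ipDl !ipZl (ipC hG k') alk' mulr0 addr0 (ipC hG) => /eqP.
by rewrite mulf_eq0 (lt_eqF alk) orbF => /eqP.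
Qed.

Lemma ordinary_corner_end : ordinary_corner G C k'.
Proof.
split=> //; have [d dk] := span_rank_exists (roots_perp G k').
suff e : d = n by move: dk; rewrite e.
apply/eqP; rewrite eqn_leq; apply/andP; split.
  rewrite -[leqRHS](rank_orthmx hG (Hbar_neq0 hk')).
  by apply: (span_rank_le dk) => x [_ xk]; apply/orthmxP.
have Wn : (\rank (col_mx u al) = n)%N.
  apply/eqP; rewrite eqn_leq; apply/andP; split.
    by apply: (leq_trans (rank_leq_row _)); case: (n) n_gt0 => // m _; rewrite addn1.
  have : (u < col_mx u al)%MS.
    rewrite ltmxE col_mx_sub submx_refl -addsmxE addsmxSl /=.
    apply/negP => /(sub_u_perp uk uk')[h _].
    by move: alk; rewrite h ltxx.
  move/rank_ltmx; rewrite (eqP ufree) => h; apply: leq_trans h.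
  by case: (n) n_gt0.
rewrite -[leqLHS]Wn; apply: (span_rank_ge dk) => d' S hS.
rewrite col_mx_sub (hS al) ?andbT; last exact: (base_root_pos alS).1.
apply/row_subP => i; apply: hS; exact: (base_root_pos (u_base i)).1.
Qed.

End Alpha.

End Ordinary.

End EdgeEnd.
(** * Rationality of an ideal end *)

Section RationalEnd.
Context (R : realType) (n : nat) (G : 'M[rat]_n.+1).
Local Notation V := 'rV[R]_n.+1.
Local Notation B := (ip G).
Local Notation root := (lattice_roots G).
Hypothesis hG : lorentzian R G.
Context (t : V) (ht : B t t < 0) (x0 : V).
Hypothesis hx0 : mirror_complement G t root x0.
Local Notation C := (signed_chamber G t root x0).
Context (k k' : V).
Hypothesis Ck : C k.
Hypothesis Ck' : C k'.
Hypothesis kk' : forall c, k' <> c *: k.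
Context (u : 'M[R]_(n.-1, n.+1)) (n_gt0 : (0 < n)%N).
Hypothesis ur : forall i, root (row i u).
Hypothesis uk : forall i, B (row i u) k = 0.
Hypothesis uk' : forall i, B (row i u) k' = 0.
Hypothesis ux0 : forall i, B (row i u) x0 < 0.
Context (D : normed_dynkin R 'I_n.-1).
Hypothesis hD : diagram_of G u D.
Context (r0 : V).
Hypothesis hr0 : [/\ primitive r0, sector G u k k' r0 & B r0 k = 0].

Let hk : Hbar G t k := Ck.1.
Let hk' : Hbar G t k' := Ck'.1.
Let uo : forall i j, i != j -> B (row i u) (row j u) <= 0 := u_obtuse hD.
Let pspan := plane_span hG ht hk hk' kk' n_gt0 uk uk' ux0 uo.
Let kk'0 := edge_ip_lt0 hG ht hk hk' kk'.
Let subu := sub_uP hG ht hk hk' kk' n_gt0 uk uk' ux0 uo.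

Lemma ratr_rows m (W : 'M[R]_(m, n.+1)) : (forall i, lat (row i W)) ->
  exists Q : 'M[rat]_(m, n.+1), W = map_mx ratr Q.
Proof.
move=> Wl.
have [z zP] : exists z : 'I_m -> 'I_n.+1 -> int, forall i j, W i j = (z i j)%:~R.
  have E i : exists z : 'I_n.+1 -> int, forall j, W i j = (z j)%:~R.
    have E' j : exists z : int, W i j = z%:~R.
      have /mxOverP/(_ 0 j) := Wl i; rewrite mxE => /intrP[z zE].
      by exists z.
    by have [z zP] := choice E'; exists z.
  by have [z zP] := choice E; exists z.
exists (\matrix_(i, j) (z i j)%:~R); apply/matrixP => i j.
by rewrite !mxE zP ratr_int.
Qed.

(** The u_i are lattice vectors, so their complement is the kernel of a rational
    matrix. *)
Lemma plane_lattice (x : V) : exists q : V,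
  [/\ lat q, planeP G u q & forall c, q <> c *: x].
Proof.
have [Q uQ] := ratr_rows (fun i => root_lat (ur i)).
pose K := kermx (G *m Q^T).
have KE : orthU G u = map_mx ratr K.
  by rewrite /orthU /K map_kermx map_mxM -map_trmx -uQ.
have [i ix] : exists i, ~~ (row i (orthU G u) <= x)%MS.
  apply/existsP; apply: contrapT => /negP; rewrite negb_exists => /forallP h.
  have : (orthU G u <= x)%MS by apply/row_subP => i; move: (h i); rewrite negbK.
  move=> Ux; have kx : (k <= x)%MS := submx_trans (plane_k hG uk) Ux.
  have k'x : (k' <= x)%MS := submx_trans (plane_k' hG uk') Ux.
  have [a ka] := sub_rVP kx; have [b kb] := sub_rVP k'x.
  have a0 : a != 0.
    by apply/eqP => a0; have := Hbar_neq0 hk; rewrite ka a0 scale0r eqxx.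
  by apply: (@kk' (b / a)); rewrite kb ka scalerA divfK.
have [d d0 dl] := scaler_lat_map R (row i K).
exists (d%:R *: row i (orthU G u)); split.
- by rewrite KE -map_row.
- by apply: planeZ; exact: row_sub.
- move=> c e; move/negP: ix; apply; apply/sub_rVP; exists (d%:R^-1 * c).
  by rewrite -scalerA -e scalerA mulVf ?scale1r // pnatr_eq0 -lt0n.
Qed.

Hypothesis k'k' : B k' k' = 0.

Let r0P : planeP G u r0. Proof. by case: hr0 => _ []. Qed.
Let r0k : B r0 k = 0. Proof. by case: hr0. Qed.
Let r0lat : lat r0. Proof. by case: hr0 => [[]]. Qed.

(** r0 is a multiple of k, and its reflection in a lattice vector q of P off the
    line of k, with the denominator cleared, is on the other null line. *)
Lemma null_end_lattice_null : B k k = 0 ->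
  exists2 c : R, 0 < c & lat (c *: k').
Proof.
move=> kk; have [s s0 r0E] := r0_coord hG ht Ck Ck' kk' n_gt0 uk uk' ux0 hD hr0.
pose g := - s * B k k'.
have g0 : g < 0 by rewrite /g pmulr_rlt0 ?oppr_gt0.
have r0E' : r0 = g *: k by rewrite r0E kk mulr0 scale0r add0r.
have [q [ql qP qk]] := plane_lattice k; have [a [b qE]] := pspan qP.
have b0 : b != 0.
  by apply/eqP => b0; apply: (qk a); rewrite qE b0 scale0r addr0.
have [d d0 dP] := ip_denominator R G.
have dR : 0 < d%:R :> R by rewrite ltr0n.
exists (2 * d%:R * g * b ^+ 2 * B k k').
  have : 0 < g * B k k' by rewrite nmulr_rgt0.
  have b2 : 0 < b ^+ 2 by rewrite exprn_even_gt0.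
  move=> h; have -> : 2 * d%:R * g * b ^+ 2 * B k k' = 2 * (d%:R * (b ^+ 2 * (g * B k k'))).
    by ring.
  by rewrite mulr_gt0 // mulr_gt0 // mulr_gt0.
have -> : (2 * d%:R * g * b ^+ 2 * B k k') *: k' =
    (2 * (d%:R * B q r0)) *: q + (- (d%:R * B q q)) *: r0.
  have e1 : B q r0 = g * b * B k k'.
    by rewrite qE r0E' !ipE (ipC hG k' k) kk; ring.
  have e2 : B q q = 2 * a * b * B k k'.
    by rewrite qE !ipE (ipC hG k' k) kk k'k'; ring.
  rewrite e1 e2 r0E' {1}qE scalerDr !scalerA addrAC -scalerDl.
  rewrite [X in X *: k + _](_ : _ = 0); last by ring.
  by rewrite scale0r add0r; congr (_ *: _); ring.
apply: latD; apply: latZ => //; last by rewrite rpredN dP.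
by rewrite rpredM ?dP // -[2]/(2%:R) natr_int.
Qed.

Section Timelike.
Hypothesis kk : B k k < 0.
Hypothesis kn : span_rank (roots_perp G k) n.

(** The roots orthogonal to k have rank n, and U has dimension n - 1. *)
Lemma root_perp_k_outside : exists2 b, roots_perp G k b & 0 < B b r0.
Proof.
have [s s0 r0E] := r0_coord hG ht Ck Ck' kk' n_gt0 uk uk' ux0 hD hr0.
have [b bP bu] : exists2 b, roots_perp G k b & ~ (b <= u)%MS.
  apply: contrapT => no; have := span_rank_le (W := u) kn.
  have h x : roots_perp G k x -> (x <= u)%MS.
    by move=> xP; apply/negPn/negP => /negP xu; apply: no; exists x.
  move=> /(_ h) le; have := leq_trans le (rank_leq_row u).
  by case: (n) n_gt0 => // m _; rewrite ltnn.
have br : B b r0 != 0.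
  apply/eqP => br; apply: bu; apply/subu; split; first exact: bP.2.
  move/eqP: br; rewrite r0E ipDr !ipZr bP.2 mulr0 addr0 mulf_eq0.
  by rewrite mulf_eq0 (lt_eqF s0) (lt_eqF kk) /= => /eqP.
have [h|h] := ltP 0 (B b r0); first by exists b.
exists (- b); first exact: perpN.
by rewrite ipNl oppr_gt0 lt_neqAle br.
Qed.

(** If the plane were anisotropic, a solution of Pell's equation would move a
    mirror through k along the edge to one that separates k from k'. *)
Lemma null_end_lattice_timelike : exists2 c : R, 0 < c & lat (c *: k').
Proof.
have [s s0 r0E] := r0_coord hG ht Ck Ck' kk' n_gt0 uk uk' ux0 hD hr0.
have [d d0 dP] := ip_denominator R G.
have dR : 0 < d%:R :> R by rewrite ltr0n.
pose rho := B r0 k'.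
have rhoE : rho = - s * B k k' ^+ 2.
  by rewrite /rho r0E !ipE k'k'; ring.
have rho0 : 0 < rho.
  by rewrite rhoE mulr_gt0 ?oppr_gt0 // exprn_even_gt0 //= lt_eqF.
have r0r0E : B r0 r0 = s * B k k * rho.
  by rewrite {2}r0E ipDr !ipZr r0k mulr0 addr0.
have r0r0 : 0 < B r0 r0.
  by rewrite r0r0E mulr_gt0 // nmulr_rgt0.
(* The line of k is rational, being the complement of r0 in P. *)
have [k0 [k0l [lam lam0 k0E]]] : exists k0, lat k0 /\ exists2 l : R, 0 < l & k0 = l *: k.
  have [q [ql qP qr]] := plane_lattice r0.
  pose w := (d%:R * B r0 r0) *: q + (- (d%:R * B q r0)) *: r0.
  have wl : lat w.
    by apply: latD; apply: latZ => //; rewrite ?rpredN dP.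
  have wP : planeP G u w by apply: planeD; exact: planeZ.
  have wr : B w r0 = 0 by rewrite /w !ipE; ring.
  have w0 : w != 0.
    apply/eqP => w0; apply: (qr (B q r0 / B r0 r0)).
    have e : (d%:R * B r0 r0) *: q = (d%:R * B q r0) *: r0.
      by apply/eqP; rewrite -subr_eq0 -scaleNr -/w w0.
    have dr : d%:R * B r0 r0 != 0 by rewrite mulf_neq0 // lt0r_neq0.
    apply: (scalerI dr); rewrite e scalerA; congr (_ *: _); field.
    by rewrite lt0r_neq0.
  have [a [b wE]] := pspan wP.
  have b0 : b = 0.
    move/eqP: wr; rewrite wE ipDl !ipZl (ipC hG k) r0k mulr0 add0r mulf_eq0.
    by rewrite (ipC hG k') -/rho (gt_eqF rho0) orbF => /eqP.
  rewrite b0 scale0r addr0 in wE.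
  have a0 : a != 0 by apply: contraNneq w0 => a0; rewrite wE a0 scale0r.
  have [h|h] := ltP 0 a; first by exists w; split=> //; exists a.
  exists (- w); split; first exact: latN.
  by exists (- a); rewrite ?wE ?scaleNr // oppr_gt0 lt_neqAle a0.
have k0k0 : B k0 k0 = lam ^+ 2 * B k k by rewrite k0E !ipE; ring.
have nat_of (x : R) : 0 < x -> x \is a Num.int -> exists2 m : nat, (0 < m)%N & x = m%:R.
  move=> x_gt0 /intrP[z zE]; have z0 : 0 < z by rewrite -(ltr_int R) -zE.
  by exists (absz z); [lia|rewrite zE -[in LHS](gtz0_abs z0)].
have [A A0 AE] : exists2 A : nat, (0 < A)%N & - (d%:R * B k0 k0) = A%:R.
  apply: nat_of; last by rewrite rpredN dP.
  rewrite oppr_gt0 pmulr_rlt0 // k0k0 pmulr_rlt0 //; exact: exprn_gt0.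
have [N N0 NE] : exists2 N : nat, (0 < N)%N & d%:R * B r0 r0 = N%:R.
  by apply: nat_of; [exact: mulr_gt0|exact: dP].
have NR : 0 < N%:R :> R by rewrite ltr0n.
have AR : 0 < A%:R :> R by rewrite ltr0n.
have k0r0 : B k0 r0 = 0 by rewrite k0E ipZl (ipC hG) r0k mulr0.
(* A and N are the norms of k0 and r0, up to the factors - d and d. If A N is a
   square, P has a rational null vector. *)
have [[sq sqE]|ns] := pselect (exists sq, (sq * sq)%N = (A * N)%N).
  pose w := N%:R *: k0 + sq%:R *: r0.
  have sq0 : 0 < sq%:R :> R.
    rewrite ltr0n lt0n; apply/eqP => h; move: sqE; rewrite h => /esym/eqP.
    by rewrite muln_eq0 -leqn0 leqNgt A0 -leqn0 leqNgt N0.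
  have ww : B w w = 0.
    apply: (mulfI (lt0r_neq0 dR)); rewrite mulr0.
    have -> : d%:R * B w w = sq%:R ^+ 2 * (d%:R * B r0 r0) -
        N%:R ^+ 2 * - (d%:R * B k0 k0).
      by rewrite /w !ipE (ipC hG r0 k0) k0r0; ring.
    rewrite AE NE expr2 -natrM sqE natrM; ring.
  pose p := N%:R * lam - sq%:R * s * B k k'.
  pose q := sq%:R * s * B k k.
  have wE : w = p *: k + q *: k'.
    rewrite /w k0E {1}r0E scalerDr !scalerA addrCA [RHS]addrC -scalerDl /p /q.
    by rewrite !mulrA; congr (_ + _ *: _); ring.
  have q0 : 0 < q by rewrite /q -mulrA mulr_gt0 // nmulr_rgt0.
  have wk : p * B k k + q * B k k' = N%:R * lam * B k k by rewrite /p /q; ring.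
  have p0 : p = 0.
    apply/eqP; apply: contraT => pn; exfalso.
    have e : p * B k k + 2 * q * B k k' = 0.
      apply: (mulfI pn); rewrite mulr0 -ww wE !ipE (ipC hG k' k) k'k'; ring.
    have h1 : N%:R * lam * B k k < 0 by rewrite pmulr_rlt0 // mulr_gt0.
    have h2 : q * B k k' < 0 by rewrite pmulr_rlt0.
    by lra.
  exists q => //; move: wE; rewrite p0 scale0r add0r => <-.
  by apply: latD; apply: latZ => //; rewrite natr_int.
exfalso; have ns' (x : nat) : (x * x)%N <> (A * N)%N by move=> h; apply: ns; exists x.
have [b [br bk] br0] := root_perp_k_outside.
have [m m0 mP] := lat_N_multiple br.
(* The component of the root b along r0 is (S / N) r0. When a ^ 2 - A N c ^ 2 = 1,
   the vector a r0 + N c k0 has the norm of r0. Here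
   a = X ^ 2 + A N Mm ^ 2 Y ^ 2 and c = 2 X Mm Y, the square of the solution
   (X, Mm Y), are 1 and 0 modulo Mm, so that replacing (S / N) r0 by
   (S / N) (a r0 + N c k0) changes b by an element of m L. *)
pose Mm := (N * m)%N.
have Mm0 : (0 < Mm)%N by rewrite muln_gt0 N0.
have [X [Y [Y0 XY]]] : exists X Y : nat,
    (0 < Y)%N /\ (X * X = A * N * (Mm * Mm) * (Y * Y) + 1)%N.
  by apply: (pell R) => x; exact: nonsquare_ratio.
have X0 : (0 < X)%N by case: (X) XY => //; rewrite mul0n addn1.
have [S S0 SE] : exists2 S : nat, (0 < S)%N & d%:R * B b r0 = S%:R.
  by apply: nat_of; [exact: mulr_gt0|apply: dP => //; exact: root_lat br].
have XYR : X%:R ^+ 2 = A%:R * N%:R * (Mm%:R ^+ 2) * Y%:R ^+ 2 + 1 :> R.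
  by rewrite !expr2 -!natrM XY natrD.
pose x : R := 2 * S%:R * A%:R * N%:R * Mm%:R * Y%:R ^+ 2.
pose y : R := 2 * S%:R * X%:R * N%:R * Y%:R.
pose b' := b + m%:R *: (x *: r0 + y *: k0).
have SR : 0 < S%:R :> R by rewrite ltr0n.
have mR : 0 < m%:R :> R by rewrite ltr0n.
have XR : 0 < X%:R :> R by rewrite ltr0n.
have YR : 0 < Y%:R :> R by rewrite ltr0n.
have MmE : Mm%:R = N%:R * m%:R :> R by rewrite natrM.
have bb := root_gt0 br.
have b'L : lat_N G (B b b) b'.
  apply: lat_N_add; first exact: root_lat_N.
  apply: mP; apply: latD; apply: latZ => //; by rewrite /x /y !rpredM ?rpredX ?natr_int.
have bk0 : B b k0 = 0 by rewrite k0E ipZr bk mulr0.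
have b'N : B b' b' = B b b.
  have e : B b' b' - B b b = 2 * (m%:R * x) * B b r0 + (m%:R * x) ^+ 2 * B r0 r0 +
      (m%:R * y) ^+ 2 * B k0 k0.
    by rewrite /b' !ipE (ipC hG r0 k0) k0r0 (ipC hG r0 b) (ipC hG k0 b) bk0; ring.
  apply/eqP; rewrite -subr_eq0 e; apply/eqP; apply: (mulfI (lt0r_neq0 dR)).
  rewrite mulr0.
  have -> : d%:R * (2 * (m%:R * x) * B b r0 + (m%:R * x) ^+ 2 * B r0 r0 +
      (m%:R * y) ^+ 2 * B k0 k0) = 2 * (m%:R * x) * (d%:R * B b r0) +
      (m%:R * x) ^+ 2 * (d%:R * B r0 r0) - (m%:R * y) ^+ 2 * - (d%:R * B k0 k0).
    by ring.
  rewrite SE NE AE /x /y.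
  have -> : 2 * (m%:R * (2 * S%:R * A%:R * N%:R * Mm%:R * Y%:R ^+ 2)) * S%:R +
      (m%:R * (2 * S%:R * A%:R * N%:R * Mm%:R * Y%:R ^+ 2)) ^+ 2 * N%:R -
      (m%:R * (2 * S%:R * X%:R * N%:R * Y%:R)) ^+ 2 * A%:R =
    4 * S%:R ^+ 2 * A%:R * Y%:R ^+ 2 * m%:R * N%:R * Mm%:R
    + 4 * S%:R ^+ 2 * A%:R ^+ 2 * N%:R ^+ 3 * Mm%:R ^+ 2 * m%:R ^+ 2 * Y%:R ^+ 4
    - 4 * S%:R ^+ 2 * N%:R ^+ 2 * m%:R ^+ 2 * A%:R * Y%:R ^+ 2 * X%:R ^+ 2 :> R.
    by ring.
  by rewrite XYR MmE; ring.
have b'k : B b' k < 0.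
  have -> : B b' k = m%:R * y * (lam * B k k).
    by rewrite /b' !ipE bk r0k k0E ipZl; ring.
  have y0 : 0 < m%:R * y by rewrite /y !mulr_gt0.
  by rewrite pmulr_rlt0 // pmulr_rlt0.
pose T := - (lam * B k k').
have T0 : 0 < T by rewrite oppr_gt0 pmulr_rlt0.
have TN : T ^+ 2 * N%:R = rho ^+ 2 * A%:R.
  rewrite -NE -AE k0k0 r0r0E /T expr2 [rho ^+ 2]expr2 {2}rhoE; ring.
have bk' : B b k' * B r0 r0 = B b r0 * rho.
  rewrite r0r0E {1}r0E ipDr !ipZr bk; ring.
have b'k' : 0 < B b' k'.
  have e : N%:R * B b' k' = S%:R * ((X%:R ^+ 2 + A%:R * N%:R * Mm%:R ^+ 2 * Y%:R ^+ 2) * rho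
      - N%:R * (2 * X%:R * Mm%:R * Y%:R) * T).
    have -> : B b' k' = B b k' + m%:R * x * rho - m%:R * y * T.
      by rewrite /b' !ipE k0E ipZl /T -/rho; ring.
    have h : N%:R * B b k' = S%:R * rho.
      by rewrite -NE -SE; move: bk'; nra.
    rewrite mulrBr mulrDr h XYR /x /y MmE; ring.
  rewrite -(pmulr_rgt0 _ NR) e pmulr_rgt0 // subr_gt0.
  rewrite -(@ltr_pXn2r _ 2) ?nnegrE ?mulr_ge0 ?(ltW rho0) ?(ltW T0) ?ler0n //.
  rewrite -subr_gt0 [X in 0 < X](_ : _ = rho ^+ 2); first by rewrite exprn_gt0.
  have -> : (N%:R * (2 * X%:R * Mm%:R * Y%:R) * T) ^+ 2 =
    N%:R * (2 * X%:R * Mm%:R * Y%:R) ^+ 2 * (T ^+ 2 * N%:R) by ring.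
  rewrite TN exprMn [in X in _ - X]exprMn [(2 * X%:R * Mm%:R) ^+ 2]exprMn [(2 * X%:R) ^+ 2]exprMn XYR; ring.
have [j j0 [bt btr e]] := lat_N_root b'L b'N bb.
have jR : 0 < j%:R :> R by rewrite ltr0n.
move: b'k b'k'; rewrite e !ipZl pmulr_rlt0 // pmulr_rgt0 // => h1 h2.
have [h|h] := root_sign hG hx0 btr.
  by have := Ck'.2 _ btr h; rewrite leNgt h2.
by have := Ck.2 _ (lattice_rootN btr) h; rewrite ipNl oppr_le0 leNgt h1.
Qed.

End Timelike.

End RationalEnd.
(** * The ideal end and the cuspidal procedure *)

Section IdealEnd.
Context (R : realType) (n : nat) (G : 'M[rat]_n.+1).
Local Notation V := 'rV[R]_n.+1.
Local Notation B := (ip G).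
Local Notation root := (lattice_roots G).
Hypothesis hG : lorentzian R G.
Context (t : V) (ht : B t t < 0) (M : R).
Hypothesis rootM : forall a, root a -> B a a <= M.
Context (x0 : V).
Hypothesis hx0 : mirror_complement G t root x0.
Local Notation C := (signed_chamber G t root x0).
Context (k k' : V).
Hypothesis Ck : C k.
Hypothesis Ck' : C k'.
Hypothesis kk' : forall c, k' <> c *: k.
Hypothesis he : face C (segment k k').
Context (u : 'M[R]_(n.-1, n.+1)) (n_gt0 : (0 < n)%N).
Hypothesis u_inj : injective (fun i => row i u).
Hypothesis us : forall i, simple_root G root C (row i u).
Hypothesis uk : forall i, B (row i u) k = 0.
Hypothesis uk' : forall i, B (row i u) k' = 0.
Context (D : normed_dynkin R 'I_n.-1).
Hypothesis hD : diagram_of G u D.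
Context (r0 : V).
Hypothesis hr0 : [/\ primitive r0, sector G u k k' r0 & B r0 k = 0].
Context (Ns : seq R).
Hypothesis hNs : root_norms G Ns.

Let hk : Hbar G t k := Ck.1.
Let hk' : Hbar G t k' := Ck'.1.


Let ur := u_root us.
Let ux0 := u_neg hG rootM hx0 us.
Let uo : forall i j, i != j -> B (row i u) (row j u) <= 0 := u_obtuse hD.
Let ufree := u_free hG ht hk hk' kk' uk uk' ux0 uo.
Let upos := u_pos hG ht hk hk' kk' uk uk'.
Let pspan := plane_span hG ht hk hk' kk' n_gt0 uk uk' ux0 uo.
Let pdec := proj_decomp hG ht hk hk' kk' n_gt0 uk uk' ux0 uo.
Let kk'0 := edge_ip_lt0 hG ht hk hk' kk'.
Let uperp := plane_u_orth hG (u := u).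
Local Notation base := (base_root G x0 k').

Hypothesis k'k' : B k' k' = 0.
Context (kap : V) (kapp : primitive kap) (c1 : R) (c10 : 0 < c1).
Hypothesis kapE : kap = c1 *: k'.

Let kaplat : lat kap. Proof. by case: kapp. Qed.

Lemma kap_kap : B kap kap = 0.
Proof. by rewrite kapE !ipE k'k' !mulr0. Qed.

Lemma kap_Hbar : Hbar G t kap.
Proof. by rewrite kapE; exact: HbarZ. Qed.

Lemma kap_u i : B (row i u) kap = 0.
Proof. by rewrite kapE ipZr uk' mulr0. Qed.

Lemma kap_k : B kap k < 0.
Proof. by rewrite kapE ipZl (ipC hG) pmulr_rlt0. Qed.

Lemma lat_N_side (N : R) (v : V) : lat_N G N v -> B v v = N -> 0 < N ->
  B v k < 0 -> exists2 m : nat, (0 < m)%N & exists b, [/\ root b, B b x0 < 0 & v = m%:R *: b].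
Proof.
move=> vN vv N0 vk; have [m m0 [b br e]] := lat_N_root vN vv N0.
have mR : 0 < m%:R :> R by rewrite ltr0n.
exists m => //; exists b; split=> //; have [//|h] := root_sign hG hx0 br.
have := Ck.2 _ (lattice_rootN br) h; rewrite ipNl oppr_le0 leNgt.
by move: vk; rewrite e ipZl pmulr_rlt0 // => ->.
Qed.

(** The multiples of kap translate - u_i to positive roots, which bound the
    chamber in the direction of u_i. *)
Lemma u_lower i : exists m : nat, forall x, C x -> m%:R * B kap x <= B (row i u) x.
Proof.
have [m m0 mP] := lat_N_multiple (ur i).
exists m => x Cx; pose v := m%:R *: kap + - row i u.
have mR : 0 < m%:R :> R by rewrite ltr0n.
have vL : lat_N G (B (row i u) (row i u)) v.
  apply: lat_N_add; first exact: mP.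
  have -> : B (row i u) (row i u) = B (- row i u) (- row i u) by rewrite !ipE opprK.
  exact/root_lat_N/lattice_rootN.
have vv : B v v = B (row i u) (row i u).
  by rewrite /v !ipE (ipC hG kap (row i u)) kap_u kap_kap; ring.
have vk : B v k < 0.
  by rewrite /v ipDl ipNl ipZl uk oppr0 addr0 pmulr_rlt0 // kap_k.
have [j j0 [b [br bx e]]] := lat_N_side vL vv (root_gt0 (ur i)) vk.
have : B v x <= 0 by rewrite e ipZl pmulr_rle0 ?ltr0n //; exact: Cx.2.
by rewrite /v ipDl ipNl ipZl subr_le0.
Qed.

(** The Gram matrix of the u_i is invertible, so the products with the u_i bound
    the coefficients. *)
Lemma norm_bounded (K : 'I_n.-1 -> R) : exists Y : R, forall y : V, (y <= u)%MS ->
  (forall i, `|B (row i u) y| <= K i) -> B y y <= Y.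
Proof.
pose H := u *m gramR R G *m u^T.
have HE (y : V) i : (y *m gramR R G *m u^T) 0 i = B (row i u) y.
  rewrite (ipC hG) /ip; move: (y *m _) => X.
  by rewrite !mxE; apply: eq_bigr => j _; rewrite !mxE.
have Hu : H \in unitmx.
  rewrite -row_free_unit -kermx_eq0; apply/eqP/row_matrixP => l; rewrite row0.
  have : row l (kermx H) *m H = 0 by apply/sub_kermxP; exact: row_sub.
  move: (row l (kermx H)) => c cH.
  have cu : (c *m u <= u)%MS by exact: submxMl.
  have : c *m u = 0.
    apply: (upos cu).2; rewrite ip_mull big1 // => i _.
    by rewrite -HE -!mulmxA [u *m _]mulmxA -/H cH mxE mulr0.
  by move/eqP; rewrite mulmx_free_eq0 // => /eqP.
exists (\sum_i (\sum_j `|K j| * `|invmx H j i|) * `|K i|) => y /submxP[c yE] yK.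
have cE : c = (y *m gramR R G *m u^T) *m invmx H.
  by rewrite yE -[c *m u *m _ *m _]mulmxA -[c *m u *m _]mulmxA [u *m _]mulmxA mulmxK.
have yK' i : `|B (row i u) y| <= `|K i| by rewrite (le_trans (yK i)) ?ler_norm.
apply: (le_trans (ler_norm _)); rewrite {1}yE ip_mull.
apply: (le_trans (ler_norm_sum _ _ _)); apply: ler_sum => i _.
rewrite normrM ler_pM // cE mxE; apply: (le_trans (ler_norm_sum _ _ _)).
by apply: ler_sum => j _; rewrite normrM HE ler_pM.
Qed.

(** On a horosphere the product of x with k' is constant. By u_lower the products
    with the u_i are bounded, hence so is the norm of the component in U, and
    since the norm of x is - 1, so is the product with k. *)
Lemma ideal_corner_end : ideal_corner G t C k'.
Proof.
split=> // c c0.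
have [m mP] := choice u_lower.
have [Y YP] := norm_bounded (fun i => (m i)%:R * (c1 * c)).
pose a := - c / B k k'.
have a0 : 0 < a by rewrite /a nmulr_rgt0 ?oppr_lt0 // invr_lt0.
pose K := (`|a ^+ 2 * B k k - 1| + `|Y|) / (2 * a) + c.
have mid := edge_mid hG ht hk hk' kk'.
have [Cb CbP] := timelike_bounded hG 0 K mid.
pose E : set V := (\bigcap_(b in [set b | root b /\ B b x0 < 0]) [set x | B b x <= 0])
  `&` [set x | B x t <= 0] `&` [set x | B x x = -1] `&` [set x | B x k' = - c].
have EE : C `&` horosphere G t k' c = E.
  apply/seteqP; split=> x.
    move=> [[hx Cx] [[_ xt] xx xk']]; split=> //; split=> //; split; last exact: ltW.
    by move=> b [br b0]; exact: Cx.
  move=> [[[Cx xt] xx] xk'].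
  have xx0 : B x x < 0 by rewrite xx; lra.
  have xt0 : B x t < 0.
    rewrite lt_neqAle xt andbT; apply/eqP => h.
    by have := orth_timelike_ge0 hG ht h; rewrite leNgt xx0.
  split; last by split.
  by split=> [|b br b0]; [split=> //; exact: ltW|apply: Cx].
have Ecl : closed E.
  have cl_le b : closed [set x : V | B b x <= 0].
    by apply: (@closed_comp _ _ (fun z => B b z) [set r | r <= 0]);
       [move=> z _; exact: ip_continuousr|exact: closed_le].
  apply: closedI; [apply: closedI; [apply: closedI|]|].
  - by apply: closed_bigI => b _; exact: cl_le.
  - have -> : [set x : V | B x t <= 0] = [set x | B t x <= 0].
      by apply/seteqP; split=> x /=; rewrite (ipC hG).
    exact: cl_le.
  - apply: (@closed_comp _ _ (fun z : V => B z z) [set r | r = -1]);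
       [by move=> z _; exact: sq_continuous|exact: closed_eq].
  - apply: (@closed_comp _ _ (fun z => B z k') [set r | r = - c]);
       [by move=> z _; exact: ip_continuousl|exact: closed_eq].
rewrite EE; apply: (@subclosed_compact _ _
  [set v : V | forall i, v ord0 i \in `[(- Cb), Cb]]) => //.
  apply: (@rV_compact _ _ (fun=> `[(- Cb), Cb]%classic)) => i.
  exact: segment_compact.
rewrite -EE => x [Cx [_ xx xk']] i; rewrite in_itv /= -ler_norml.
have [yu yP e] := pdec x; set y := projU G u x in yu e.
have yi j : B (row j u) y = B (row j u) x.
  by rewrite -[in RHS]e ipDr (ipC hG _ (projP G u x)) (uperp yP (row_sub j u)) addr0.
have yY : B y y <= Y.
  apply: YP => // j; rewrite yi ler_norml.
  have h1 : B (row j u) x <= 0 by apply: Cx.2 => //; exact: ux0.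
  have h2 := mP j x Cx; have h3 : B kap x = - (c1 * c).
    by rewrite kapE ipZl (ipC hG) xk' mulrN.
  rewrite h3 mulrN in h2; rewrite h2 /=; apply: (le_trans h1).
  by rewrite mulr_ge0 // mulr_ge0 // ltW.
have y0 : 0 <= B y y by case: (upos yu).
have [a' [b' pE]] := pspan yP.
have [yk yk'] := sub_u_perp uk uk' yu.
have a'E : a' = a.
  have ck : a' * B k k' = - c.
    by rewrite -xk' -e ipDl yk' add0r pE ipDl !ipZl k'k' mulr0 addr0.
  by rewrite /a -ck mulfK // lt_eqF.
have xk : 2 * a * B x k = a ^+ 2 * B k k - 1 - B y y.
  have py : B (projP G u x) y = 0 by exact: uperp.
  have xxE : B y y + B (projP G u x) (projP G u x) = -1.
    by rewrite -xx -{3 4}e !ipE (ipC hG y) py; ring.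
  have -> : B x k = a * B k k + b' * B k k'.
    by rewrite -e ipDl yk add0r pE a'E ipDl !ipZl (ipC hG k' k).
  move: xxE; rewrite pE a'E !ipE (ipC hG k' k) k'k' => xxE.
  have -> : B y y = -1 - (a * (a * B k k + b' * B k k') + b' * (a * B k k' + b' * 0)).
    by rewrite -xxE; ring.
  by ring.
apply: CbP; first by rewrite xx; lra.
rewrite ipDr xk' /K; apply: (le_trans (ler_normB _ _)).
rewrite (gtr0_norm c0) lerD2r.
have a20 : 0 < 2 * a by rewrite mulr_gt0.
rewrite ler_pdivlMr // -[X in _ * X](gtr0_norm a20) -normrM mulrC xk.
apply: (le_trans (ler_normB _ _)); rewrite lerD2l.
by rewrite ger0_norm // (le_trans yY) // ler_norm.
Qed.

Section Batch.
Context (Ms : seq R) (h : V).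
Hypothesis hMs : root_norms G Ms.
Hypothesis hh : Hbar G t h.
Hypothesis hP : planeP G u h.
Hypothesis hkap : ~ (exists c : R, h = c *: kap).
Local Notation cusp := (cuspidal_candidate G u D kap Ms).
Local Notation prec := (precedes G h).

Lemma h_kap : B h kap < 0.
Proof.
rewrite (ipC hG); apply: (Hbar_ip_lt0 hG ht kap_Hbar hh) => c e.
by apply: hkap; exists c.
Qed.

Lemma h_u i : B h (row i u) = 0.
Proof. by apply: uperp => //; exact: row_sub. Qed.

Lemma perp_kap (a : V) : B a k' = 0 -> B a kap = 0.
Proof. by move=> e; rewrite kapE ipZr e mulr0. Qed.

Lemma perp_decomp (a : V) : B a k' = 0 -> exists y, a = projU G u a + y *: kap.
Proof.
move=> ak'; have [pu pP e] := pdec a; have [_ pk'] := sub_u_perp uk uk' pu.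
have [x [y pE]] := pspan pP.
have x0' : x = 0.
  move: ak'; rewrite -e ipDl pk' add0r pE ipDl !ipZl k'k' mulr0 addr0 => /eqP.
  by rewrite mulf_eq0 (lt_eqF kk'0) orbF => /eqP.
exists (y / c1); rewrite kapE scalerA divfK ?lt0r_neq0 //.
by rewrite -{1}e pE x0' scale0r add0r.
Qed.

Lemma cusp_facts p : cusp p ->
  [/\ 0 < p.1, B p.2 p.2 = p.1, B p.2 k' = 0 /\ (forall i, B p.2 (row i u) <= 0),
      B h p.2 < 0
    & exists2 m : nat, (0 < m)%N & exists2 b, pos_root G x0 k' b & p.2 = m%:R *: b].
Proof.
move=> [pM [D' [x [c [[eD cD] xD [pE pL] c0 _]]]]].
have N0 : 0 < p.1 by case: hMs => + _; exact.
have xN : p.1 = B x x by apply/(extension_cuspidal hG hD ufree upos eD xD).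
have xu := xD.1; have [xk xk'] := sub_u_perp uk uk' xu.
have cR : 0 < ratr c :> R by rewrite ltr0q.
have xkap := perp_kap xk'.
have pp : B p.2 p.2 = p.1.
  by rewrite pE !ipE (ipC hG kap x) xkap kap_kap xN; ring.
have pk' : B p.2 k' = 0.
  by rewrite pE ipDl ipZl xk' kapE ipZl k'k' !mulr0 addr0.
have pk : B p.2 k < 0 by rewrite pE ipDl ipZl xk add0r pmulr_rlt0 // kap_k.
split=> //.
- split=> // i; rewrite pE ipDl ipZl (ipC hG kap) kap_u mulr0 addr0 xD.2.
  exact: dynkin_ip_le0.
- by rewrite pE ipDr ipZr (uperp hP xu) add0r pmulr_rlt0 // h_kap.
have [m m0 [b [br bx e]]] := lat_N_side pL pp N0 pk.
exists m => //; exists b => //; split=> //; split=> //.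
move/eqP: pk'; rewrite e ipZl mulf_eq0 pnatr_eq0 -leqn0 leqNgt m0 /=.
by move/eqP.
Qed.

(** A translate of a with smaller c would be a positive root, but it would have a
    positive product with the wall point of a. The coefficient is rational
    because the products with r0 are. *)
Lemma base_cusp (a : V) : base a -> (forall i, a <> row i u) -> cusp (B a a, a).
Proof.
move=> aS au; have [[ar ak'] a0] := base_root_pos aS.
have aa := root_gt0 ar.
have [D' eD sD] := base_extension hG ht rootM hx0 Ck Ck' kk' n_gt0 us uk uk' hD aS au.
have [y aE] := perp_decomp ak'; set x := projU G u a in sD aE.
have xu := sD.1; have [xk xk'] := sub_u_perp uk uk' xu.
have xkap := perp_kap xk'.
have y0 : 0 < y.
  have := base_outside hG ht rootM hx0 Ck Ck' kk' n_gt0 us uk uk' hD aS au.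
  by rewrite aE ipDl ipZl xk add0r nmulr_llt0 // kap_k.
have aaE : B a a = B x x.
  by rewrite {1 2}aE !ipE (ipC hG kap x) xkap kap_kap; ring.
have [_ [r0P _ _] r0k] := hr0.
have [s s0 r0E] := r0_coord hG ht Ck Ck' kk' n_gt0 uk uk' ux0 hD hr0.
have kr : B kap r0 != 0.
  have -> : B kap r0 = c1 * (- s * B k k' ^+ 2).
    by rewrite kapE r0E !ipE k'k' (ipC hG k' k); ring.
  rewrite lt0r_neq0 // mulr_gt0 // mulr_gt0 ?oppr_gt0 //.
  by rewrite exprn_even_gt0 //= ltr0_neq0.
have r0l : lat r0 by case: hr0 => [[]].
have [d d0 dP] := ip_denominator R G.
have dn : d%:R != 0 :> R by rewrite pnatr_eq0 -lt0n.
have /intrP[z1 z1E] := dP _ _ (root_lat ar) r0l.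
have /intrP[z2 z2E] := dP _ _ kaplat r0l.
pose c : rat := z1%:~R / z2%:~R.
have cE : ratr c = y.
  rewrite /c fmorph_div !rmorph_int -z1E -z2E {1}aE ipDl ipZl (ipC hG x) (uperp r0P xu).
  by rewrite add0r; field; apply/andP; split.
split; first by case: hMs => _; exact.
exists D', x, c; rewrite /= cE; split=> //.
- by split=> //; apply/(extension_cuspidal hG hD ufree upos eD sD).
- by split=> //; exact: root_lat_N.
- by rewrite -(ltr0q R) cE.
move=> c' c'0 c'L; rewrite leNgt; apply/negP => c'c.
have c'R : 0 < ratr c' :> R by rewrite ltr0q.
have c'y : ratr c' < y by rewrite -cE ltr_rat.
pose v := x + ratr c' *: kap.
have vv : B v v = B a a.
  by rewrite /v aaE !ipE (ipC hG kap x) xkap kap_kap; ring.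
have vk : B v k < 0 by rewrite /v ipDl ipZl xk add0r pmulr_rlt0 // kap_k.
have [m m0 [b [br bx e]]] := lat_N_side c'L vv aa vk.
have mR : 0 < m%:R :> R by rewrite ltr0n.
have bk' : B b k' = 0.
  have : B v k' = 0 by rewrite /v ipDl ipZl xk' kapE ipZl k'k' !mulr0 addr0.
  by rewrite /v e ipZl => /eqP; rewrite mulf_eq0 gt_eqF //= => /eqP.
have [wH aw bw] := wall_pointP hG ht rootM hx0 hk' aS.
set w := wall_point G x0 a in wH aw bw.
have bw0 : B b w <= 0.
  have [->|/eqP ba] := eqVneq b a; first by rewrite aw.
  by apply/ltW/bw.
have vw : B v w <= 0 by rewrite /v e ipZl pmulr_rle0.
have kw : B kap w < 0 by rewrite (ipC hG); exact: (Hyp_ip_lt0 hG ht wH kap_Hbar).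
move: vw; have -> : v = a + (ratr c' - y) *: kap.
  by rewrite /v aE -addrA -scalerDl; congr (_ + _ *: _); ring.
by rewrite ipDl ipZl aw add0r nmulr_lle0 // subr_ge0 leNgt c'y.
Qed.

Lemma prec_trans p q r : prec p q -> prec q r -> prec p r.
Proof.
rewrite /precedes => -[h1|[h1 h2]] [h3|[h3 h4]].
- by left; exact: lt_trans h1 h3.
- by left; rewrite -h3.
- by left; rewrite h1.
- by right; rewrite h1; split=> //; exact: lt_trans h2 h4.
Qed.

Lemma prec_irr p : ~ prec p p.
Proof. by case=> [|[_]]; rewrite ltxx. Qed.

(** This is closer_simple_root. In the case of equality p.2 and a are parallel
    modulo kap, and equal priorities make them parallel; as a is primitive, the
    norm decides. *)
Lemma nonsimple_preceded p : cusp p -> ~ base p.2 -> exists a,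
  [/\ base a, forall i, a <> row i u, 0 < B a p.2 & prec (B a a, a) p].
Proof.
move=> hp pS; have [N0 pp [pk' pu] hp0 [m m0 [b bp e]]] := cusp_facts hp.
have mR : 0 < m%:R :> R by rewrite ltr0n.
have vv : 0 < B p.2 p.2 by rewrite pp.
have vc : cone base p.2.
  by rewrite e; apply: coneZ => //; exact: (pos_root_cone hG ht rootM hx0 hk' bp).
have hb a : base a -> B h a <= 0.
  move=> aS; have [[_ ak'] _] := base_root_pos aS.
  have [y aE] := perp_decomp ak'; have [xu _ _] := pdec a.
  have ak := base_ip_k Ck aS.
  have [xk _] := sub_u_perp uk uk' xu.
  rewrite aE ipDr ipZr (uperp hP xu) add0r mulr_ge0_le0 ?(ltW h_kap) //.
  by move: ak; rewrite aE ipDl ipZl xk add0r nmulr_lle0 // kap_k.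
have [a [aS aR av pr]] : exists a, [/\ base a, ~ (exists i, a = row i u),
    0 < B a p.2
  & - B h a / Num.sqrt (B a a) < - B h p.2 / Num.sqrt (B p.2 p.2) \/
    (- B h a / Num.sqrt (B a a) = - B h p.2 / Num.sqrt (B p.2 p.2) /\
     B a p.2 ^+ 2 = B a a * B p.2 p.2)].
  apply: (closer_simple_root hG vc) => //.
  - by move=> a /base_root_pos[[ar _] _]; exact: root_gt0 ar.
  - by move=> _ [i ->]; rewrite h_u (ipC hG).
  - move=> a /base_root_pos[[_ ak'] _].
    exact: (causal_orth_CS hG hk'.1 (Hbar_neq0 hk') ak' pk' vv).
have au i : a <> row i u by move=> ai; apply: aR; exists i.
exists a; split=> //; rewrite /precedes /priority /= -pp.
case: pr => [lt|[eq CS]]; [by left|right; split=> //].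
have [[ar ak'] _] := base_root_pos aS; have aa := root_gt0 ar.
pose la := B a p.2 / B a a.
pose z := p.2 - la *: a.
have zk' : B z k' = 0 by rewrite /z !ipE pk' ak'; ring.
have zz : B z z = 0.
  have -> : B z z = (B a a * B p.2 p.2 - B a p.2 ^+ 2) / B a a.
    by rewrite /z /la !ipE (ipC hG p.2 a); field; rewrite gt_eqF.
  by rewrite CS subrr mul0r.
have [y zE] := causal_orth_eq0 hG ht hk' zk' zz.
have hz : B h z = 0.
  have sa : 0 < Num.sqrt (B a a) by rewrite sqrtr_gt0.
  have sv : 0 < Num.sqrt (B p.2 p.2) by rewrite sqrtr_gt0.
  have ava : B a p.2 = Num.sqrt (B a a) * Num.sqrt (B p.2 p.2).
    apply/eqP; rewrite -(@eqrXn2 _ 2) ?mulr_ge0 ?(ltW av) ?(ltW sa) ?(ltW sv) //.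
    by rewrite CS exprMn !sqr_sqrtr // ltW.
  have laE : la = Num.sqrt (B p.2 p.2) / Num.sqrt (B a a).
    rewrite /la ava -[B a a in X in _ / X]sqr_sqrtr ?ltW //.
    by field; rewrite gt_eqF.
  rewrite /z ipDr ipNr ipZr laE.
  move/eqP: eq; rewrite eqr_div ?(gt_eqF sa) ?(gt_eqF sv) // => /eqP eq.
  apply: (mulIf (lt0r_neq0 sa)); rewrite mul0r mulrBl.
  have -> : Num.sqrt (B p.2 p.2) / Num.sqrt (B a a) * B h a * Num.sqrt (B a a) =
    B h a * Num.sqrt (B p.2 p.2) by field; rewrite gt_eqF.
  by move: eq; lra.
have z0 : z = 0.
  move: hz; rewrite zE ipZr => /eqP; rewrite mulf_eq0.
  have hk'0 : B h k' < 0.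
    by have := h_kap; rewrite kapE ipZr pmulr_rlt0.
  by rewrite (lt_eqF hk'0) orbF => /eqP ->; rewrite scale0r.
have vE : p.2 = la *: a by apply/eqP; rewrite -subr_eq0 -/z z0.
have la0 : 0 < la by rewrite divr_gt0.
have ba : b = a.
  apply: (root_parallel bp.1.1 ar (c := m%:R^-1 * la)).
    by rewrite mulr_gt0 ?invr_gt0.
  by rewrite -scalerA -vE e scalerA mulVf ?scale1r // gt_eqF.
have m2 : (1 < m)%N.
  rewrite ltn_neqAle m0 andbT; apply/eqP => m1; apply: pS.
  by rewrite e ba -m1 scale1r.
rewrite e ba !ipE mulrA ltr_pMl // -natrM ltr1n.
by apply: leq_trans m2 _; rewrite leq_pmulr.
Qed.

(** Induction along the precedence. Its segments are finite because h + kap is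
    timelike and has the same products as h with vectors orthogonal to k'. *)
Lemma simple_approved (a : V) : base a -> (forall i, a <> row i u) ->
  approved G cusp h (B a a, a).
Proof.
move=> aS au.
apply: (@finite_wf_ind _ [set a | base a /\ forall i, a <> row i u]
  (fun b a => prec (B b b, b) (B a a, a)) (fun a => approved G cusp h (B a a, a))) => //.
- by move=> b c d; exact: prec_trans.
- by move=> b; exact: prec_irr.
- move=> b [bS bu].
  have [_ _ _ hb _] := cusp_facts (base_cusp bS bu).
  have [[br _] _] := base_root_pos bS; have bb := root_gt0 br.
  have tl : B (h + kap) (h + kap) < 0.
    by have := h_kap; have := hh.1; rewrite !ipE (ipC hG kap h) kap_kap; lra.
  pose Q := - B h b / Num.sqrt (B b b).
  have Q0 : 0 <= Q by rewrite divr_ge0 ?sqrtr_ge0 // oppr_ge0 ltW.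
  apply: sub_finite_set (lat_finite hG M (Q * Num.sqrt `|M|) tl) => c /= [[cS cu] cb].
  have [[cr ck'] _] := base_root_pos cS; have cc := root_gt0 cr.
  have [_ _ _ hc _] := cusp_facts (base_cusp cS cu).
  split; [exact: root_lat cr|exact: rootM|].
  rewrite ipDr (perp_kap ck') addr0 (ipC hG) ltr0_norm //=.
  have : - B h c / Num.sqrt (B c c) <= Q.
    by case: cb => [/ltW//|[+ _]]; rewrite /priority /= /Q => ->.
  rewrite ler_pdivrMr ?sqrtr_gt0 // => /le_trans; apply.
  by rewrite ler_wpM2l // ler_wsqrtr // (le_trans (rootM cr)) // ler_norm.
move=> b [bS bu] IH; apply: Approved; first exact: base_cusp.
move=> p pA pb; have [pS|pS] := pselect (base p.2).
  right; apply: (base_root_obtuse hG pS bS) => e.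
  have [_ pp _ _ _] := cusp_facts pA.
  by apply: (@prec_irr p); rewrite {2}(_ : p = (B b b, b)) // -e pp; case: (p).
left; have [c [cS cu cp prp]] := nonsimple_preceded pA pS.
apply: (@Rejected _ _ G cusp h (B c c, c)) => //.
by apply: IH => //; exact: prec_trans prp pb.
Qed.

Lemma approved_cusp p : approved G cusp h p -> cusp p.
Proof. by case. Qed.

(** Induction on the derivation, which is nested under a disjunction. *)
Fixpoint approved_base p (H : approved G cusp h p) {struct H} : base p.2
with rejected_nonbase p (H : rejected G cusp h p) {struct H} : ~ base p.2.
Proof.
- case: p / H => q qA f; apply: contrapT => qS.
  have [a [aS au aq pr]] := nonsimple_preceded qA qS.
  case: (f (B a a, a) (base_cusp aS au) pr) => [r|le].
    exact: (rejected_nonbase _ r aS).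
  by move: aq; rewrite ltNge le.
- case: p / H => p q qA pa pr pq qS.
  have pS := approved_base _ pa.
  have [_ pp _ _ _] := cusp_facts (approved_cusp pa).
  have [_ qq _ _ _] := cusp_facts qA.
  have pq' : p.2 <> q.2.
    move=> e; apply: (@prec_irr p); rewrite {2}(_ : p = q) //.
    by rewrite (surjective_pairing p) (surjective_pairing q) -pp -qq e.
  by move: pq; rewrite ltNge (base_root_obtuse hG pS qS pq').
Qed.

Lemma batch0_simple : batch0 G u D kap Ms h = simple_root_at G t C k'.
Proof.
rewrite (simple_root_at_base hG ht rootM hx0 hk'); apply/seteqP; split=> a.
  case=> [[i ->]|[N /approved_base //]].
  exact: (u_base hG ht rootM hx0 Ck' us uk').
move=> aS; have [|no] := pselect (exists i, a = row i u); first by left.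
right; exists (B a a); apply: simple_approved => // i e.
by apply: no; exists i.
Qed.

End Batch.
End IdealEnd.
(** * The theorem *)

Lemma root_norms_bounded (R : realType) (n : nat) (G : 'M[rat]_n.+1)
    (Ns : seq R) : root_norms G Ns ->
  forall a, lattice_roots G a -> ip G a a <= \sum_(N <- Ns) N.
Proof.
move=> [N0 rN] a /rN aN.
rewrite (big_rem _ aN) /= lerDl big_seq; apply: sumr_ge0 => N /mem_rem /N0.
exact: ltW.
Qed.

Unset Implicit Arguments.

Theorem mainTheorem2 (R : realType) (n : nat) (n_gt0 : (0 < n)%N)
  (G : 'M[rat]_n.+1) (hG : lorentzian R G)
  (t : 'rV[R]_n.+1) (ht : ip G t t < 0)
  (C : set 'rV[R]_n.+1) (hC : chamber G t (lattice_roots G) C)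
  (k : 'rV[R]_n.+1) (hk : corner G t C k)
  (e : set 'rV[R]_n.+1) (he : edge C e)
  (k' : 'rV[R]_n.+1) (hk' : e = segment k k')
  (u : 'M[R]_(n.-1, n.+1)) (u_inj : injective (fun i => row i u))
  (hu : forall a : 'rV[R]_n.+1,
     (simple_root G (lattice_roots G) C a /\ (forall x, e x -> ip G a x = 0)) <->
     (exists i, a = row i u))
  (D : normed_dynkin R 'I_n.-1) (hD : diagram_of G u D)
  (r0 : 'rV[R]_n.+1)
  (hr0 : [/\ primitive r0, sector G u k k' r0 & ip G r0 k = 0])
  (Ns : seq R) (hNs : root_norms G Ns) :
  [/\ corner G t C k',
      (~ (exists c, candidate G u D k k' r0 Ns c)) ->
        ip G k' k' = 0 /\
        exists kappa : 'rV[R]_n.+1,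
          [/\ primitive kappa,
              exists c : R, 0 < c /\ kappa = c *: k'
            & forall (Ms : seq R) (h : 'rV[R]_n.+1),
                root_norms G Ms ->
                Hbar G t h -> planeP G u h ->
                ~ (exists c : R, h = c *: kappa) ->
                batch0 G u D kappa Ms h = simple_root_at G t C k']
    & (exists c, candidate G u D k k' r0 Ns c) ->
        exists alpha : 'rV[R]_n.+1,
          [/\ unique (fun a => exists c,
                best_candidate G u D k k' r0 Ns c /\ a = cand_alpha c) alpha,
              simple_root_at G t C k' =
                [set a | (exists i, a = row i u) \/ a = alpha]
            & forall x, (planeP G u x /\ ip G x alpha = 0) <->
                (exists c : R, x = c *: k')]].
Proof.
pose root := lattice_roots (R := R) G.
pose M := \sum_(N <- Ns) N.
have rootM a : root a -> ip G a a <= M by exact: root_norms_bounded.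
have [x0 hx0 CE] := hC.
rewrite (chamberE hG ht (fun a h => h) (@lattice_rootN _ _ G) hx0) in CE.
rewrite {hC}CE in hk he hu *.
have [eC e2] := he.
rewrite hk' in eC e2 hu.
have ek : segment k k' k.
  by exists 1, 0; rewrite addr0 ler01 ltr01 lexx scale1r scale0r addr0.
have ek' : segment k k' k'.
  by exists 0, 1; rewrite add0r ler01 ltr01 lexx scale1r scale0r add0r.
have [sC _ _ _] := eC; have Ck := sC _ ek; have Ck' := sC _ ek'.
have kk' c : k' <> c *: k.
  move=> e'; suff : (2 <= 1)%N by [].
  apply: leq_trans (rank_leq_row k); apply: (span_rank_le e2) => _ [a [b [_ _ _ ->]]].
  by apply/sub_rVP; exists (a + b * c); rewrite e' scalerA scalerDl.
have usP i : simple_root G root (signed_chamber G t root x0) (row i u) /\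
    forall x, segment k k' x -> ip G (row i u) x = 0.
  by apply/hu; exists i.
have us i := (usP i).1.
have uk i := (usP i).2 k ek.
have uk' i := (usP i).2 k' ek'.
have ur i : root (row i u) by case: (us i).
have ux0 := u_neg hG rootM hx0 us.
have [k'k'|k'k'] : ip G k' k' < 0 \/ ip G k' k' = 0.
    by have := Ck'.1.1; rewrite le_eqVlt => /orP[/eqP|]; [right|left].
  have [al alS alk] :=
    new_simple_root hG ht rootM hx0 Ck Ck' kk' eC n_gt0 us uk uk' hD k'k'.
  split.
  - left; exact: (ordinary_corner_end hG ht rootM hx0 Ck Ck' kk' n_gt0 us uk uk'
      hD k'k' alS alk).
  - have [c [hc _ _ _]] := alpha_candidate hG ht rootM hx0 Ck Ck' kk' n_gt0 us
      uk uk' hD hr0 hNs k'k' alS alk.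
    by case; exists c.
  - move=> _; exists al; split.
    + exact: (best_candidateE hG ht rootM hx0 Ck Ck' kk' n_gt0 u_inj us uk uk' hD
        hr0 hNs k'k' alS alk).
    + exact: (simple_root_at_alpha hG ht rootM hx0 Ck Ck' kk' n_gt0 u_inj us uk uk'
        hD k'k' alS alk).
    + exact: (alpha_line hG ht rootM hx0 Ck Ck' kk' n_gt0 us uk uk' hD alS alk).
have [c c0 cl] : exists2 c : R, 0 < c & lat (c *: k').
  case: hk => [[_ kk kn]|[_ kk _]].
    exact: (null_end_lattice_timelike hG ht hx0 Ck Ck' kk' n_gt0 ur uk uk' ux0 hD
      hr0 k'k' kk kn).
  exact: (null_end_lattice_null hG ht Ck Ck' kk' n_gt0 ur uk uk' ux0 hD hr0
    k'k' kk).
have ck0 : c *: k' != 0.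
  by rewrite scaler_eq0 (gt_eqF c0) (negPf (Hbar_neq0 Ck'.1)).
have [m m0 [kap kapp mkap]] := lat_primitive cl ck0.
have mR : 0 < m%:R :> R by rewrite ltr0n.
have c10 : 0 < m%:R^-1 * c by rewrite mulr_gt0 ?invr_gt0.
have kapE : kap = (m%:R^-1 * c) *: k'.
  by rewrite -scalerA mkap scalerA mulVf ?scale1r // gt_eqF.
split.
- right; exact: (ideal_corner_end hG ht rootM hx0 Ck Ck' kk' n_gt0 us uk uk' hD
    k'k' kapp c10 kapE).
- move=> _; split=> //; exists kap; split=> //; first by exists (m%:R^-1 * c).
  move=> Ms h hMs hh hP hkap.
  exact: (batch0_simple hG ht rootM hx0 Ck Ck' kk' n_gt0 us uk uk' hD hr0 k'k'
    kapp c10 kapE hMs hh hP hkap).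
- move=> [c' hc']; have := candidate_timelike hG ht hx0 Ck Ck' kk' n_gt0 uk uk'
    ux0 hD hr0 hNs hc'.
  by rewrite k'k' ltxx.
Qed.
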